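(* Let $R>0$, let $\Omega=B_R=\{x\in\mathbb{R}^N:|x|<R\}$ and let $F_1,F_2$ be operators satisfying the structural condition (SC) described in the context. For $\alpha,\beta\ge0$ and $p,q>0$ with $pq\ge1$, let $u,v\in C^1(\overline\Omega)$ be a radial viscosity solution of $$\begin{cases}F_1(x,Du,D^2u)+|x|^\beta|v|^{q-1}v=0&\text{in }\Omega,\\ F_2(x,Dv,D^2v)+|x|^\alpha|u|^{p-1}u=0&\text{in }\Omega.\end{cases}$$ If $u(R)=v(R)=0$, and either $u'(R)=0$ or $v'(R)=0$, then $u\equiv v\equiv0$ in $\Omega$.
   Context: Radial functions $u(x)=u(|x|)$ are identified with functions of $r=|x|$, and $u'$ denotes the derivative in $r$. Let $\mathbb{S}^N$ be the space of real symmetric $N\times N$ matrices. For constants $0<\lambda\le\Lambda$, Pucci's extremal operators are defined, for $X\in\mathbb{S}^N$ with eigenvalues $e_1,\dots,e_N$, by $\mathcal{M}^+_{\lambda,\Lambda}(X)=\Lambda\sum_{e_i>0}e_i+\lambda\sum_{e_i<0}e_i$ and $\mathcal{M}^-_{\lambda,\Lambda}(X)=\lambda\sum_{e_i>0}e_i+\Lambda\sum_{e_i<0}e_i$. Condition (SC) on an operator $F:\Omega\times\mathbb{R}^N\times\mathbb{S}^N\to\mathbb{R}$: $F(\cdot,0,0)\equiv0$ and, for some $\gamma\ge0$, $$\mathcal{M}^-_{\lambda,\Lambda}(X-Y)-\gamma|\xi-\eta|\le F(x,\xi,X)-F(x,\eta,Y)\le\mathcal{M}^+_{\lambda,\Lambda}(X-Y)+\gamma|\xi-\eta|$$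 for all $x\in\Omega$, $\xi,\eta\in\mathbb{R}^N$, $X,Y\in\mathbb{S}^N$. No other regularity is imposed on $F$. Viscosity solutions: let $m>N$ and $h\in L^m_{\mathrm{loc}}(\Omega)$. A function $w\in C(\Omega)$ is an $L^m$-viscosity subsolution (resp. supersolution) of $F(x,Dw,D^2w)=h(x)$ if whenever $\phi\in W^{2,m}_{\mathrm{loc}}(\Omega)$, $\varepsilon>0$ and an open set $\mathcal{O}\subset\Omega$ are such that $F(x,D\phi(x),D^2\phi(x))-h(x)\le-\varepsilon$ (resp. $\ge\varepsilon$) for a.e. $x\in\mathcal{O}$, then $w-\phi$ cannot have a local maximum (resp. minimum) in $\mathcal{O}$. A solution is both a sub- and a supersolution. If $F$ and $h$ are continuous in $x$, solutions are understood in the $C$-viscosity sense, where test functions are taken in $C^2(\Omega)$ and the inequality is evaluated at a point; if in addition $F$ is convex or concave in the Hessian entry, they are understood in the strong sense ($W^{2,m}_{\mathrm{loc}}$, equation holding a.e.). The pair $(u,v)$ is a viscosity solution of the system if $u$ is a viscosity solution of the first equation (with $h=-|x|^\beta|v|^{q-1}v$) and $v$ is a viscosity solution of the second one (with $h=-|x|^\alpha|u|^{p-1}u$). *)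

(* Defs.v *)
From HB Require Import structures.
From mathcomp Require Import all_boot all_order all_algebra.
From mathcomp Require Import all_classical all_reals all_analysis.

Set Implicit Arguments.
Unset Strict Implicit.
Unset Printing Implicit Defensive.
Import Order.TTheory GRing.Theory Num.Theory.
Import numFieldNormedType.Exports.
Local Open Scope classical_set_scope.
Local Open Scope ring_scope.

(* n-fold product of a sigma-finite measure, on the product sigma-algebra of
   n.-tuple T. *)
Section tuple_measure.
Context d (T : measurableType d) (R : realType).
Variable mu : {sigma_finite_measure set T -> \bar R}.

Definition tcons n (z : T * n.-tuple T) : n.+1.-tuple T := [tuple of z.1 :: z.2].

Definition tuncons n (t : n.+1.-tuple T) : T * n.-tuple T :=
  (thead t, [tuple of behead t]).

Lemma tconsK n : cancel (@tcons n) (@tuncons n).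
Proof.
by move=> [x t]; rewrite /tuncons /tcons theadE; congr pair; exact: val_inj.
Qed.

Lemma measurable_tcons n : measurable_fun setT (@tcons n).
Proof. exact: measurable_cons. Qed.

Lemma measurable_tuncons n : measurable_fun setT (@tuncons n).
Proof.
apply/measurable_fun_pairP; split; first exact: measurable_tnth.
exact: measurable_behead.
Qed.

Section cons_measure.
Variables (n : nat) (nu : {sigma_finite_measure set (n.-tuple T) -> \bar R}).

Definition cons_measure : set (n.+1.-tuple T) -> \bar R :=
  pushforward (mu \x nu)%E (@tcons n).

HB.instance Definition _ := Measure.copy cons_measure
  (measure_function_pushforward__canonical__measure_function_Measure
     (mu \x nu)%E (@measurable_tcons n)).

Let cons_measure_sigma_finite : sigma_finite setT cons_measure.
Proof.
have /sigma_finiteP[F [TF ndF Foo]] := sigma_finiteT mu.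
have /sigma_finiteP[G [TG ndG Goo]] := sigma_finiteT nu.
exists (fun k => @tuncons n @^-1` (F k `*` G k)).
  rewrite -preimage_bigcup -[LHS](@preimage_setT _ _ (@tuncons n)).
  congr (_ @^-1` _); rewrite -setXTT TF TG predeqE => -[x y]; split.
    move=> [/= [k _ Fkx] [l _ Gly]]; exists (maxn k l) => //; split.
    - by move: x Fkx; exact/subsetPset/ndF/leq_maxl.
    - by move: y Gly; exact/subsetPset/ndG/leq_maxr.
  by move=> [k _ []/= ? ?]; split; exists k.
move=> k; have [mFk Fk] := Foo k; have [mGk Gk] := Goo k; split.
  rewrite -[X in measurable X]setTI.
  by apply: measurable_tuncons => //; exact: measurableX.
rewrite /cons_measure /pushforward -comp_preimage.
rewrite (_ : @tuncons n \o @tcons n = id); last first.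
  by apply/funext => z; exact: tconsK.
rewrite preimage_id product_measure1E//.
by rewrite lte_mul_pinfty// ge0_fin_numE.
Qed.

HB.instance Definition _ := Measure_isSigmaFinite.Build _ _ _ cons_measure
  cons_measure_sigma_finite.

End cons_measure.

Fixpoint tuple_measure n : {sigma_finite_measure set (n.-tuple T) -> \bar R} :=
  if n is n'.+1 then cons_measure (tuple_measure n') else \d_([tuple] : 0.-tuple T).

End tuple_measure.

Section euclidean_space.
Context {R : realType}.
Implicit Types N : nat.

(* The library norm on 'rV[R]_N is the sup norm (it induces the same topology). *)
Definition enorm N (x : 'rV[R]_N) : R := Num.sqrt (\sum_i x 0 i ^+ 2).

Definition eball N (r : R) : set 'rV[R]_N := [set x | enorm x < r].

(* The radial function on R^N with profile f. *)
Definition radial N (f : R -> R) : 'rV[R]_N -> R := fun x => f (enorm x).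

Definition left_deriv (f : R -> R) (a l : R) : Prop :=
  (fun r => (f r - f a) / (r - a)) @ a^'- --> l.

(* Lebesgue measure on R^N is carried by N.-tuple; [vec] transports it to
   'rV[R]_N. *)
Definition lebN N : {sigma_finite_measure
    set (N.-tuple (measurableTypeR R)) -> \bar R} :=
  tuple_measure (@lebesgue_measure R) N.

Definition vec N (t : N.-tuple (measurableTypeR R)) : 'rV[R]_N :=
  \row_i (tnth t i : R).

Definition ae_in N (D : set 'rV[R]_N) (P : 'rV[R]_N -> Prop) : Prop :=
  {ae lebN N, forall t, D (vec t) -> P (vec t)}.

Definition int_in N (D : set 'rV[R]_N) (f : 'rV[R]_N -> R) : R :=
  \int[lebN N]_(t in @vec N @^-1` D) f (vec t).

End euclidean_space.

Section function_spaces.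
Context {R : realType} {N : nat}.
Implicit Types (Om : set 'rV[R]_N) (f g phi : 'rV[R]_N -> R).

Definition partial (i : 'I_N) f : 'rV[R]_N -> R :=
  fun x => 'D_(delta_mx 0 i) f x.

Definition grad f (x : 'rV[R]_N) : 'rV[R]_N := \row_i partial i f x.

Definition hess f (x : 'rV[R]_N) : 'M[R]_N :=
  \matrix_(i, j) partial i (partial j f) x.

Definition C0 Om f : Prop := forall x, Om x -> {for x, continuous f}.

Definition C1 Om f : Prop := C0 Om f /\
  forall i, (forall x, Om x -> derivable f x (delta_mx 0 i)) /\
            C0 Om (partial i f).

Definition C2 Om f : Prop := C1 Om f /\ forall i, C1 Om (partial i f).

(* f is C^1 in Om, and f and its first derivatives extend continuously to the
   closure of Om. *)
Definition C1_closure Om f : Prop := {within closure Om, continuous f} /\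
  forall i, (forall x, Om x -> derivable f x (delta_mx 0 i)) /\
    exists g, {within closure Om, continuous g} /\
              forall x, Om x -> g x = partial i f x.

(* Borel measurability costs no generality: every Lebesgue measurable function
   agrees a.e. with a Borel one. *)
Definition Lloc (m : R) Om f : Prop :=
  measurable_fun (@vec R N @^-1` Om) (f \o @vec R N) /\
  forall K : set 'rV[R]_N, compact K -> K `<=` Om ->
    (\int[lebN N]_(t in @vec R N @^-1` K) (`|f (vec t)| `^ m)%:E < +oo)%E.

Definition C1_compact_support Om (eta : 'rV[R]_N -> R) : Prop :=
  C1 setT eta /\
  exists K : set 'rV[R]_N,
    [/\ compact K, K `<=` Om & forall x, ~ K x -> eta x = 0].

(* First-order weak derivatives tested against C^1_c(Om), as in
   Gilbarg-Trudinger, Section 7.3. *)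
Definition weak_partial Om (i : 'I_N) f g : Prop :=
  forall eta, C1_compact_support Om eta ->
    int_in Om (fun x => f x * partial i eta x) =
    - int_in Om (fun x => g x * eta x).

Definition symm (X : 'M[R]_N) : Prop := X^T = X.

(* f belongs to W^{2,m}_loc(Om), with weak gradient G and weak Hessian H.
   For m > N such a function has a continuous representative; f denotes it, so
   that its pointwise values are meaningful. The weak Hessian is symmetric a.e.,
   and H is a representative that is symmetric everywhere. *)
Definition W2loc (m : R) Om f (G : 'rV[R]_N -> 'rV[R]_N)
    (H : 'rV[R]_N -> 'M[R]_N) : Prop :=
  [/\ C0 Om f, Lloc m Om f,
      forall i, Lloc m Om (fun x => G x 0 i) /\
                weak_partial Om i f (fun x => G x 0 i),
      forall i j, Lloc m Om (fun x => H x i j) /\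
                  weak_partial Om i (fun x => G x 0 j) (fun x => H x i j)
    & forall x, symm (H x)].

End function_spaces.

Section pucci.
Context {R : realType} {N : nat}.
Implicit Types X : 'M[R]_N.

(* Eigenvalues with multiplicity: a list of roots splitting the characteristic
   polynomial (it exists when X is symmetric, and is unique up to order). *)
Definition eigenvalues X : seq R :=
  xget [::] [set s : seq R | char_poly X = \prod_(e <- s) ('X - e%:P)].

Definition Mplus (lam Lam : R) X : R :=
  Lam * (\sum_(e <- eigenvalues X | 0 < e) e) +
  lam * (\sum_(e <- eigenvalues X | e < 0) e).

Definition Mminus (lam Lam : R) X : R :=
  lam * (\sum_(e <- eigenvalues X | 0 < e) e) +
  Lam * (\sum_(e <- eigenvalues X | e < 0) e).

End pucci.

Section viscosity.
Context {R : realType} {N : nat}.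

(* Only the values of an operator at points of Om and symmetric matrices are
   ever constrained or used. *)
Definition operator := 'rV[R]_N -> 'rV[R]_N -> 'M[R]_N -> R.

Implicit Types (Om : set 'rV[R]_N) (F : operator) (h w phi : 'rV[R]_N -> R).

Definition SC (lam Lam : R) Om F : Prop :=
  (forall x, Om x -> F x 0 0 = 0) /\
  exists2 gamma : R, 0 <= gamma &
    forall x xi eta X Y, Om x -> symm X -> symm Y ->
      Mminus lam Lam (X - Y) - gamma * enorm (xi - eta)
        <= F x xi X - F x eta Y
        <= Mplus lam Lam (X - Y) + gamma * enorm (xi - eta).

Definition local_max f (x : 'rV[R]_N) : Prop :=
  \forall y \near x, (f y <= f x :> R).

Definition local_min f (x : 'rV[R]_N) : Prop :=
  \forall y \near x, (f x <= f y :> R).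

Definition Lm_subsolution (m : R) Om F h w : Prop := C0 Om w /\
  forall phi G H (eps : R) (O : set 'rV[R]_N),
    W2loc m Om phi G H -> 0 < eps -> open O -> O `<=` Om ->
    ae_in O (fun x => F x (G x) (H x) - h x <= - eps) ->
    forall x, O x -> ~ local_max (fun y => w y - phi y) x.

Definition Lm_supersolution (m : R) Om F h w : Prop := C0 Om w /\
  forall phi G H (eps : R) (O : set 'rV[R]_N),
    W2loc m Om phi G H -> 0 < eps -> open O -> O `<=` Om ->
    ae_in O (fun x => eps <= F x (G x) (H x) - h x) ->
    forall x, O x -> ~ local_min (fun y => w y - phi y) x.

Definition Lm_solution (m : R) Om F h w : Prop :=
  [/\ Lloc m Om h, Lm_subsolution m Om F h w & Lm_supersolution m Om F h w].

Definition C_subsolution Om F h w : Prop := C0 Om w /\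
  forall phi x, C2 Om phi -> Om x -> local_max (fun y => w y - phi y) x ->
    h x <= F x (grad phi x) (hess phi x).

Definition C_supersolution Om F h w : Prop := C0 Om w /\
  forall phi x, C2 Om phi -> Om x -> local_min (fun y => w y - phi y) x ->
    F x (grad phi x) (hess phi x) <= h x.

Definition C_solution Om F h w : Prop :=
  C_subsolution Om F h w /\ C_supersolution Om F h w.

Definition strong_solution (m : R) Om F h w : Prop :=
  exists G H, W2loc m Om w G H /\ ae_in Om (fun x => F x (G x) (H x) = h x).

Definition continuous_data Om F h : Prop :=
  (forall xi X, symm X -> C0 Om (fun x => F x xi X)) /\ C0 Om h.

Definition convex_hessian Om F : Prop :=
  forall x xi X Y (t : R), Om x -> symm X -> symm Y -> 0 <= t <= 1 ->
    F x xi (t *: X + (1 - t) *: Y) <= t * F x xi X + (1 - t) * F x xi Y.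

Definition concave_hessian Om F : Prop :=
  forall x xi X Y (t : R), Om x -> symm X -> symm Y -> 0 <= t <= 1 ->
    t * F x xi X + (1 - t) * F x xi Y <= F x xi (t *: X + (1 - t) *: Y).

(* w solves F(x, Dw, D^2 w) = h in Om: in the L^m-viscosity sense in general,
   in the C-viscosity sense if F and h are continuous in x, and in the strong
   sense if moreover F is convex or concave in the Hessian entry. *)
Definition solution (m : R) Om F h w : Prop :=
  [/\ ~ continuous_data Om F h -> Lm_solution m Om F h w,
      continuous_data Om F h ->
        ~ (convex_hessian Om F \/ concave_hessian Om F) ->
        C_solution Om F h w
    & continuous_data Om F h ->
        convex_hessian Om F \/ concave_hessian Om F ->
        strong_solution m Om F h w].

Definition system_solution (m : R) Om (F1 F2 : operator) (alpha beta p q : R)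
    (u v : 'rV[R]_N -> R) : Prop :=
  solution m Om F1
    (fun x => - (enorm x `^ beta * `|v x| `^ (q - 1) * v x)) u /\
  solution m Om F2
    (fun x => - (enorm x `^ alpha * `|u x| `^ (p - 1) * u x)) v.

End viscosity.

Arguments operator : clear implicits.

(* Main.v *)
(* Writing w for u', testing the equation with radial quartics turns the (viscosity or
   strong) inequalities into the one-sided differential inequality
   m(w') + (N - 1) m(w / r) - gamma |w| + f <= 0 for 0 < r < R, with
   m(e) = min(lam e, Lam e), for u and, by negation, for -u. For strong solutions this
   requires computing the weak Hessian of a radial function and an energy argument.

   If u'(R) = 0 and v'(R) <> 0, say v'(R) < 0, then v > 0 near R, so u' >= 0 and u <= 0
   there, and v' cannot vanish when moving inwards from R, against v'(0) = 0. Hence all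
   Cauchy data vanish at R. On a short interval ending at R one then gets
   max |u| <= D (max |v|)^q and max |v| <= D (max |u|)^p with D small, which forces
   u = v = 0 as pq >= 1; this is iterated towards 0 with a step that is uniform on [a, R]. *)

Require Import Defs.
From mathcomp Require Import all_boot all_order all_algebra.
From mathcomp Require Import ring lra.
From mathcomp Require Import all_classical all_reals all_analysis.
From mathcomp Require Import measurable_realfun.

Set Implicit Arguments.
Unset Strict Implicit.
Unset Printing Implicit Defensive.
Import Order.TTheory GRing.Theory Num.Theory.
Import numFieldNormedType.Exports.
Local Open Scope classical_set_scope.
Local Open Scope ring_scope.

(** * One-sided slope bounds for continuous functions *)

Section slopes.
Context {R : realType}.
Implicit Types (w : R -> R) (a b r x y K : R).

(** The profiles are only C^1, so w = u' has no derivative to insert in the inequality. It is read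
    instead as a bound on difference quotients: a number that violates it as a value of w' at r
    bounds the quotients of w near r from above. Gronwall, sign and smallness arguments are all run
    in this form. Quartics B |x|^2 + (C/2) |x|^4 are smooth at the origin, and their two
    coefficients prescribe independently the first and second radial derivatives at a radius r > 0.
    Their Hessian is a scalar matrix plus a multiple of x^T x, whose spectrum is explicit. (SC)
    enters only through M^-(X) - gamma |xi| <= F(x, xi, X). The operator - F(x, - xi, - X) satisfies
    the same bound, so subsolutions reduce to supersolutions. A strong solution has its Hessian only
    almost everywhere, and a contact radius is a null set. Pointwise comparison there is replaced by
    an integral one, in which the unknown radial eigenvalue of the weak Hessian enters only through
    the trace. *)

Definition local_slope_le w r K := exists2 d : R, 0 < d &
  forall x y, r - d < x -> x < y -> y < r + d -> w y - w x <= K * (y - x).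

(** Induction along the interval: the supremum of the points up to which [w t - K * t] stays below
    its value at [x] can always be passed, because the bound at that supremum compares points on its
    two sides. *)
Lemma slope_le_open w a b K : (forall r, a < r < b -> local_slope_le w r K) ->
  forall x y, a < x -> x <= y -> y < b -> w y - w x <= K * (y - x).
Proof.
move=> loc x y ax xy yb.
pose g t := w t - K * t.
suff : g y <= g x by rewrite /g; lra.
pose S := [set z | x <= z <= y /\ forall t, x <= t <= z -> g t <= g x].
have Sx : S x by split=> [|t]; [lra|move=> /andP[? ?]; have -> : t = x by lra].
have hS : has_sup S by split; [exists x|exists y => z [] /andP[]].
have xs : x <= sup S by apply: ub_le_sup Sx; case: hS.
have sy : sup S <= y by apply: ge_sup; [exists x|move=> z [] /andP[]].
have [d d0 Hd] : local_slope_le w (sup S) K by apply: loc; lra.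
have [z Sz zd] := sup_adherent d0 hS.
have zs : z <= sup S by apply: ub_le_sup Sz; case: hS.
have [zxy Hz] := Sz.
have key t : x <= t -> t <= y -> t < sup S + d -> g t <= g x.
  move=> xt ty ts; have [tz|zt] := leP t z; first by apply: Hz; lra.
  have h1 : g z <= g x by apply: Hz; lra.
  have := Hd z t zd zt ts; move: h1; rewrite /g; lra.
have [ys|sy'] := ltP y (sup S + d); first exact: key.
have : S (sup S + d / 2).
  by split=> [|t /andP[? ?]]; [lra|apply: key; lra].
by move=> /(ub_le_sup (proj2 hS)); lra.
Qed.

Lemma slope_le w a b K : continuous w ->
  (forall r, a < r < b -> local_slope_le w r K) ->
  forall x y, a <= x -> x <= y -> y <= b -> w y - w x <= K * (y - x).
Proof.
move=> cw loc x y ax xy yb.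
have [->|xny] := eqVneq x y; first by rewrite !subrr mulr0.
have xy' : x < y by rewrite lt_neqAle xny.
(* The interval is shrunk by [e] at both ends, so that it lies where the local bounds hold, and [e]
   tends to 0. *)
pose F e := w (y - e) - w (x + e) - K * (y - e - (x + e)).
have cF : F e @[e --> 0^'+] --> F 0.
  apply: cvg_at_right_filter; rewrite /F.
  apply: cvgB; [apply: cvgB|apply: cvgMl_tmp].
  - by apply: continuous_comp; [|exact: cw]; apply: cvgB; [exact: cvg_cst|exact: cvg_id].
  - by apply: continuous_comp; [|exact: cw]; apply: cvgD; [exact: cvg_cst|exact: cvg_id].
  - apply: cvgB; [apply: cvgB|apply: cvgD]; try exact: cvg_cst; exact: cvg_id.
have : F 0 <= 0.
  rewrite -(cvg_lim _ cF)//; apply: limr_le; first by apply/cvg_ex; exists (F 0).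
  near=> e; rewrite /F subr_le0; apply: (slope_le_open loc).
  - have : 0 < e by near: e; exact: nbhs_right_gt.
    lra.
  - suff : e < (y - x) / 2 by lra.
    by near: e; apply: nbhs_right_lt; lra.
  - have : 0 < e by near: e; exact: nbhs_right_gt.
    lra.
by rewrite /F subr0 addr0 subr_le0.
Unshelve. all: by end_near.
Qed.

(** Here [w' <= c * w] is meant in slope form. Instead of the product rule, the increment of
    [w t * expR (- (c * t))] is split: the slope bound controls the increment of [w], the mean value
    theorem that of the exponential. *)
Lemma gronwall w a b c : continuous w ->
  (forall r K, a < r < b -> c * w r < K -> local_slope_le w r K) ->
  a <= b -> w b * expR (- (c * b)) <= w a * expR (- (c * a)).
Proof.
move=> cw H ab.
pose Z t := w t * expR (- (c * t)).
have cE : continuous (fun t : R => expR (- (c * t))).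
  move=> t; apply: continuous_comp; last exact: continuous_expR.
  by apply: cvgN; apply: cvgMl_tmp; exact: cvg_id.
have cZ : continuous Z by move=> t; apply: cvgM; [exact: cw|exact: cE].
suff HZ e : 0 < e -> Z b - Z a <= e * (b - a).
  have [->//|anb] := eqVneq a b.
  have ab' : 0 < b - a by rewrite subr_gt0 lt_neqAle anb.
  rewrite -subr_le0; apply/ler_addgt0Pr => e e0.
  have := HZ (e / (b - a)) (divr_gt0 e0 ab'); rewrite -/(Z a) -/(Z b).
  by rewrite divfK ?gt_eqF// add0r.
move=> e0; apply: (slope_le cZ) => // r rab.
pose E := expR (- (c * r)).
have E0 : 0 < E := expR_gt0 _.
(* Gives the three-variable function below the value [e / 2] on the diagonal, so that it stays below
   [e] nearby. *)
pose e1 := e / (2 * E).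
have e10 : 0 < e1 by rewrite divr_gt0// mulr_gt0.
have [d d0 Hd] := H r (c * w r + e1) rab ltac:(lra).
(* The variables stand for the two endpoints of a short interval around [r] and the mean value point
   of the exponential between them. *)
have cF : continuous (fun xyz : R * R * R => (c * w r + e1) * expR (- (c * xyz.1.2)) -
    w xyz.1.1 * (c * expR (- (c * xyz.2)))).
  have c1 : continuous (fun xyz : R * R * R => xyz.1.1).
    by move=> t; apply: (@continuous_comp _ _ _ fst fst); exact: cvg_fst.
  have c2 : continuous (fun xyz : R * R * R => xyz.1.2).
    by move=> t; apply: (@continuous_comp _ _ _ fst snd); [exact: cvg_fst|exact: cvg_snd].
  have c3 : continuous (fun xyz : R * R * R => xyz.2) by move=> t; exact: cvg_snd.
  move=> t; apply: cvgB; [apply: cvgMl_tmp|apply: cvgM; [|apply: cvgMl_tmp]].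
  - exact: (@continuous_comp _ _ _ _ (fun t => expR (- (c * t))) _ (c2 t) (cE _)).
  - exact: (@continuous_comp _ _ _ _ w _ (c1 t) (cw _)).
  - exact: (@continuous_comp _ _ _ _ (fun t => expR (- (c * t))) _ (c3 t) (cE _)).
have : \forall xyz \near ((r, r), r), (c * w r + e1) * expR (- (c * xyz.1.2)) -
    w xyz.1.1 * (c * expR (- (c * xyz.2))) < e.
  apply: (cvgr_lt _ (cF ((r, r), r))) => /=.
  have -> : (c * w r + e1) * expR (- (c * r)) - w r * (c * expR (- (c * r))) = e / 2.
    by rewrite -/E /e1; field; rewrite gt_eqF.
  lra.
move=> /nbhs_ballP[d1 /= d10 Hd1].
exists (Num.min d d1) => [|x y rx xy yr]; first by rewrite lt_min d0.
have [m1 m2] : Num.min d d1 <= d /\ Num.min d d1 <= d1.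
  by rewrite !ge_min !lexx orbT.
have Hxy := Hd x y ltac:(lra) xy ltac:(lra).
have [xi xixy Hxi] : exists2 xi, xi \in `]x, y[%R & expR (- (c * y)) - expR (- (c * x)) =
    (- c * expR (- (c * xi))) * (y - x).
  apply: (@MVT _ (fun t => expR (- (c * t))) (fun t => - c * expR (- (c * t)))) => //.
    move=> t _; apply: (@is_derive_eq _ _ _ _ t 1 _ (expR (- (c * t)) *: - c)).
    apply: is_derive1_comp; apply: is_derive_eq.
    by rewrite /GRing.scale /= mulr1.
  by rewrite /GRing.scale /= mulrC.
  exact: continuous_subspaceT.
move: xixy; rewrite in_itv /= => /andP[xxi xiy].
have /= Hb : (c * w r + e1) * expR (- (c * y)) - w x * (c * expR (- (c * xi))) < e.
  by apply: (Hd1 ((x, y), xi)); split; [split|]; rewrite /ball /= ltr_norml; lra.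
have -> : Z y - Z x = (w y - w x) * expR (- (c * y)) +
    w x * (expR (- (c * y)) - expR (- (c * x))) by rewrite /Z; ring.
rewrite Hxi.
have Ey : 0 < expR (- (c * y)) := expR_gt0 _.
have h1 : (w y - w x) * expR (- (c * y)) <= (c * w r + e1) * (y - x) * expR (- (c * y)).
  by rewrite ler_pM2r.
have h2 : ((c * w r + e1) * expR (- (c * y)) - w x * (c * expR (- (c * xi)))) * (y - x)
    <= e * (y - x) by rewrite ler_pM2r ?subr_gt0// ltW.
lra.
Qed.
End slopes.

Lemma first_zero {R : realType} (w : R -> R) a b : continuous w -> a <= b -> w a < 0 -> 0 <= w b ->
  exists c, [/\ a < c, c <= b, 0 <= w c & forall t, a <= t < c -> w t < 0].
Proof.
move=> cw ab wa wb.
pose S := [set z | a <= z <= b /\ forall t, a <= t <= z -> w t < 0].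
have Sa : S a by split=> [|t]; [lra|move=> h; have -> : t = a by lra].
have hS : has_sup S by split; [exists a|exists b => z [] /andP[]].
have aS : a <= sup S by apply: ub_le_sup Sa; case: hS.
have Sb : sup S <= b by apply: ge_sup; [exists a|move=> z [] /andP[]].
have before t : a <= t < sup S -> w t < 0.
  move=> /andP[at_ ts]; have [z Sz tz] := sup_gt (ex_intro _ _ Sa) ts.
  by apply: (proj2 Sz); rewrite at_ ltW.
have ws : 0 <= w (sup S).
  rewrite leNgt; apply/negP => ws.
  have [d /= d0 Hd] := (nbhs_ballP _ _).1 (cvgr_lt _ (cw (sup S)) 0 ws).
  have sb : sup S < b by rewrite lt_neqAle Sb andbT; apply/eqP => e; move: wb; rewrite -e; lra.
  pose z := Num.min b (sup S + d / 2).
  have [zb zd] : z <= b /\ z <= sup S + d / 2 by rewrite !ge_min !lexx orbT.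
  have sz : sup S < z by rewrite lt_min sb; lra.
  have : S z.
    split=> [|t /andP[at_ tz]]; first by lra.
    have [ts|st] := ltP t (sup S); first by apply: before; rewrite at_.
    by apply: Hd; rewrite /ball /= ltr_norml; lra.
  by move=> /(ub_le_sup (proj2 hS)); lra.
exists (sup S); split => //.
by rewrite lt_neqAle aS andbT; apply/eqP => e; move: ws; rewrite -e; lra.
Qed.

(* [M^-] of the 1 x 1 matrix [e]. *)
Definition pucci1 {R : realType} (lam Lam e : R) : R := Num.min (lam * e) (Lam * e).

(** * The radial differential inequality and its consequences for the Cauchy data at the boundary *)

Section ode.
Context {R : realType} (lam Lam k rad : R).
Hypotheses (lam0 : 0 < lam) (lamLam : lam <= Lam) (k0 : 0 <= k) (rad0 : 0 < rad).
Local Notation m := (pucci1 lam Lam).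
Implicit Types (w f u v : R -> R) (g a b r K A B : R).

Let params : [/\ 0 < lam, lam <= Lam, 0 <= k & 0 < rad].
Proof. by []. Qed.

Lemma pucci1_pos (e : R) : 0 <= e -> m e = lam * e.
Proof. by move=> e0; apply/min_idPl; rewrite ler_wpM2r. Qed.

Lemma pucci1_neg (e : R) : e <= 0 -> m e = Lam * e.
Proof. by move=> e0; apply/min_idPr; rewrite ler_wnM2r. Qed.

Lemma pucci1_ge (e A : R) : 0 <= A -> - A <= e -> - (Lam * A) <= m e.
Proof.
move=> A0 Ae; have [? ? ? ?] := params; have Lam0 : 0 <= Lam by lra.
have LA : 0 <= Lam * A by rewrite mulr_ge0.
have [e0|e0] := leP 0 e.
  by rewrite pucci1_pos//; have := mulr_ge0 (ltW lam0) e0; lra.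
by rewrite (pucci1_neg (ltW e0)) -mulrN ler_wpM2l.
Qed.

(* The differential inequality [m w' + k m (w / r) - g |w| + f <= 0] for a [w] that is
   merely continuous: every number [K] violating it as a value of [w'] is a local
   upper bound for the difference quotients of [w]. *)
Definition supD g w f := forall r K, 0 < r < rad ->
  0 < m K + k * m (w r / r) - g * `|w r| + f r -> local_slope_le w r K.

(** At a slope slightly above the claimed one, [lam * K] outweighs the worst values of the other
    terms: [k * Lam / a * A] from the curvature term, [g * A] from the gradient term and [B] from
    [f]; the summand 1 in the constant pays for [B]. Increments are bounded from above only; lower
    bounds come from [- w]. *)
Lemma supD_bound g w f a x0 y0 A B : 0 <= g -> continuous w -> supD g w f ->
  0 < a -> a <= x0 -> y0 <= rad ->
  (forall r, x0 < r < y0 -> `|w r| <= A /\ `|f r| <= B) ->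
  0 <= A -> 0 <= B ->
  forall x y, x0 <= x -> x <= y -> y <= y0 ->
    w y - w x <= (k * Lam / a + g + 1) / lam * (A + B) * (y - x).
Proof.
have [? ? ? ?] := params; move=> g0 cw sD a0 ax yr bnd A0 B0 x y xx xy yy.
set C := (X in X * (A + B)).
have Lam0 : 0 < Lam by lra.
have kL : 0 <= k * Lam / a by rewrite divr_ge0 ?mulr_ge0// ltW.
have C0 : 0 <= C by rewrite divr_ge0//; [lra|exact: ltW].
have AB0 : 0 <= C * (A + B) by rewrite mulr_ge0//; lra.
have main e : 0 < e -> w y - w x <= (C * (A + B) + e) * (y - x).
  move=> e0; apply: (slope_le cw) xx xy yy => r rxy.
  have [wA fB] := bnd r rxy.
  apply: sD; first by lra.
  rewrite pucci1_pos; last by lra.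
  have r0 : 0 < r by lra.
  have m1 : - (Lam * (A / a)) <= m (w r / r).
    apply: pucci1_ge; first by rewrite divr_ge0// ltW.
    rewrite lerNl; apply: (@le_trans _ _ (`|w r| / r)).
      by rewrite -mulNr ler_pM2r ?invr_gt0// -normrN ler_norm.
    apply: ler_pM => //; first by rewrite invr_ge0 ltW.
    by rewrite lef_pV2 ?posrE//; lra.
  have m2 := ler_wpM2l k0 m1.
  have m3 : g * `|w r| <= g * A by rewrite ler_wpM2l.
  have m4 : - B <= f r by move: fB; rewrite ler_norml => /andP[].
  have -> : lam * (C * (A + B) + e) = (k * Lam / a + g + 1) * (A + B) + lam * e.
    by rewrite /C; field; rewrite !gt_eqF.
  have e1 : 0 < lam * e by rewrite mulr_gt0.
  have : 0 <= k * Lam / a * B by rewrite mulr_ge0.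
  have : 0 <= g * B by rewrite mulr_ge0.
  have e2 : k * - (Lam * (A / a)) = - (k * Lam / a * A) by field; rewrite gt_eqF.
  by lra.
have [->|nxy] := eqVneq x y; first by rewrite !subrr mulr0.
have xy' : 0 < y - x by rewrite subr_gt0 lt_neqAle nxy.
apply/ler_addgt0Pr => e e0; have := main (e / (y - x)) (divr_gt0 e0 xy').
by rewrite mulrDl divfK// gt_eqF.
Qed.

(** A negative value would persist to the right: as long as [w < 0], the inequality gives
    [w' <= - C * w], so [w r * expR (C * r)] is nonincreasing and [w] cannot climb back to 0. *)
Lemma supD_ge0 g w f a b : 0 <= g -> continuous w -> supD g w f ->
  0 < a -> b <= rad -> (forall r, a < r < b -> 0 <= f r) -> 0 <= w b ->
  forall r, a <= r <= b -> 0 <= w r.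
Proof.
have [? ? ? ?] := params; move=> g0 cw sD a0 br f0 wb r0 /andP[ar rb]; rewrite leNgt; apply/negP => w0.
have [c [rc cb wc wneg]] := first_zero cw rb w0 wb.
have Lam0 : 0 < Lam by lra.
pose C := (k * Lam / a + g) / lam.
have kL : 0 <= k * Lam / a by rewrite divr_ge0 ?mulr_ge0// ltW.
have C0 : 0 <= C by rewrite divr_ge0//; [lra|exact: ltW].
have := @gronwall _ w r0 c (- C) cw.
suff H : forall r K, r0 < r < c -> - C * w r < K -> local_slope_le w r K.
  move=> /(_ H (ltW rc)).
  have : 0 <= w c * expR (- (- C * c)) by rewrite mulr_ge0// expR_ge0.
  have : w r0 * expR (- (- C * r0)) < 0 by rewrite nmulr_rlt0// expR_gt0.
  lra.
move=> r K rr HK.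
have wr : w r < 0 by apply: wneg; lra.
have fr : 0 <= f r by apply: f0; lra.
have K0 : 0 < K by apply: le_lt_trans HK; rewrite mulNr -mulrN mulr_ge0//; lra.
apply: sD; first by lra.
rewrite pucci1_pos; last by lra.
have r_gt0 : 0 < r by lra.
have m1 : - (Lam * (- w r / a)) <= m (w r / r).
  apply: pucci1_ge; first by rewrite divr_ge0//; lra.
  rewrite lerNl -mulNr; apply: ler_pM; [lra|by rewrite invr_ge0 ltW|by []|].
  by rewrite lef_pV2 ?posrE//; lra.
have m2 := ler_wpM2l k0 m1.
have m3 : lam * (- C * w r) < lam * K by rewrite ltr_pM2l.
have e1 : lam * (- C * w r) = - (k * Lam / a + g) * w r by rewrite /C; field; rewrite !gt_eqF.
have e2 : k * - (Lam * (- w r / a)) = (k * Lam / a) * w r by field; rewrite gt_eqF.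
rewrite ltr0_norm//; lra.
Qed.

Definition deriv_on u w := forall r, 0 < r < rad -> is_derive r 1 u (w r).

Lemma deriv_on_MVT u w x y : continuous u -> deriv_on u w -> 0 <= x -> x < y -> y <= rad ->
  exists2 c, x < c < y & u y - u x = w c * (y - x).
Proof.
have [? ? ? ?] := params; move=> cu du x0 xy yr.
have [c] := @MVT _ u w x y xy (fun r h => du r ltac:(move: h; rewrite in_itv /=; lra))
  (continuous_subspaceT cu).
by rewrite in_itv /=; exists c.
Qed.

(* If [w2 rad < 0], then [v > 0] on an interval ending at [rad], so [w1 >= 0] and
   [u <= 0] there; by Gronwall from a point where [w2] is nearly zero (one exists, as
   [w2 0 = 0]), [- w2 rad] would then be too small. *)
Lemma supD_opposite_signs g1 g2 u w1 v w2 f1 f2 : 0 <= g1 -> 0 <= g2 ->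
  continuous u -> continuous v -> continuous w1 -> continuous w2 ->
  deriv_on u w1 -> deriv_on v w2 ->
  supD g1 w1 f1 -> supD g2 (fun r => - w2 r) (fun r => - f2 r) ->
  (forall r, 0 < r < rad -> 0 <= v r -> 0 <= f1 r) ->
  (forall r, 0 < r < rad -> u r <= 0 -> f2 r <= 0) ->
  u rad = 0 -> v rad = 0 -> w1 rad = 0 -> w2 0 = 0 -> 0 <= w2 rad.
Proof.
have [? ? ? ?] := params; move=> g10 g20 cu cv cw1 cw2 du dv sD1 sD2 Hf1 Hf2 uR vR w1R w20.
rewrite leNgt; apply/negP => w2R.
pose c := g2 / lam.
have c0 : 0 <= c by rewrite divr_ge0// ltW.
(* Half of what Gronwall transports back from [rad]: starting from [- w2 rs <= eta] it would give
   [2 * eta <= eta]. *)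
pose eta := - w2 rad * expR (- (c * rad)) / 2.
have eta0 : 0 < eta by rewrite divr_gt0 ?mulr_gt0 ?expR_gt0//; lra.
have E1 : expR (- (c * rad)) <= 1 by rewrite expR_le1 lerNl oppr0 mulr_ge0// ltW.
have etaR : eta < - w2 rad.
  rewrite /eta; have : - w2 rad * expR (- (c * rad)) <= - w2 rad by rewrite ler_piMr//; lra.
  lra.
have cz : continuous (fun t => eta + w2 (rad - t)).
  move=> t; apply: cvgD; first exact: cvg_cst.
  apply: (@continuous_comp _ _ _ (fun t => rad - t) w2); last exact: cw2.
  by apply: cvgB; [exact: cvg_cst|exact: cvg_id].
(* Run in the reversed variable [rad - t], so [s] is the first distance from [rad], moving inwards,
   at which [- w2] has dropped to [eta]. *)
have [||s [s0 sR ws wneg]] := @first_zero _ _ 0 rad cz (ltW rad0).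
- by rewrite subr0; lra.
- by rewrite subrr w20 addr0 ltW.
set rs := rad - s; have rs0 : 0 <= rs by rewrite /rs; lra.
have rsR : rs < rad by rewrite /rs; lra.
have w2neg r : rs < r <= rad -> w2 r < 0.
  rewrite /rs => rr; have /wneg : 0 <= rad - r < s by lra.
  have -> : rad - (rad - r) = r by ring.
  lra.
have v_ge0 r : rs < r < rad -> 0 <= v r.
  move=> rr; have [xi xir] := @deriv_on_MVT v w2 r rad cv dv ltac:(lra) ltac:(lra) (lexx _).
  have : w2 xi * (rad - r) <= 0 by rewrite mulr_le0_ge0//; [apply/ltW/w2neg; lra|lra].
  lra.
have w1_ge0 r : rs < r <= rad -> 0 <= w1 r.
  move=> rr; apply: (@supD_ge0 g1 w1 f1 r rad) => //; rewrite ?w1R//; try lra.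
  by move=> t rt; apply: Hf1; [lra|apply: v_ge0; lra].
have u_le0 r : rs < r < rad -> u r <= 0.
  move=> rr; have [xi xir] := @deriv_on_MVT u w1 r rad cu du ltac:(lra) ltac:(lra) (lexx _).
  have : 0 <= w1 xi * (rad - r) by rewrite mulr_ge0//; [apply: w1_ge0; lra|lra].
  lra.
have := @gronwall _ (fun r => - w2 r) rs rad c ltac:(move=> t; apply: cvgN; exact: cw2).
suff H : forall r K, rs < r < rad -> c * - w2 r < K -> local_slope_le (fun r => - w2 r) r K.
  move=> /(_ H (ltW rsR)).
  have : - w2 rs * expR (- (c * rs)) <= eta.
    apply: (@le_trans _ _ (eta * expR (- (c * rs)))).
      by rewrite ler_pM2r ?expR_gt0//; rewrite -/rs in ws; lra.
    by rewrite ler_piMr ?(ltW eta0)// expR_le1 lerNl oppr0 mulr_ge0.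
  have : - w2 rad * expR (- (c * rad)) = 2 * eta by rewrite /eta; field.
  lra.
move=> r K rr HK.
have w2r : w2 r < 0 by apply: w2neg; lra.
have f2r : f2 r <= 0 by apply: Hf2; [lra|apply: u_le0; lra].
have K0 : 0 < K by apply: le_lt_trans HK; rewrite mulr_ge0//; lra.
apply: sD2; first by lra.
rewrite pucci1_pos; last by lra.
rewrite pucci1_pos; last by rewrite divr_ge0//; lra.
(* The singular term has the favourable sign and is dropped; hence the Gronwall constant [c] does
   not blow up as [r] approaches 0. *)
have m2 : 0 <= k * (lam * (- w2 r / r)) by rewrite mulr_ge0// mulr_ge0 ?divr_ge0//; lra.
have m3 : lam * (c * - w2 r) < lam * K by rewrite ltr_pM2l.
have e1 : lam * (c * - w2 r) = g2 * - w2 r by rewrite /c; field; rewrite gt_eqF.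
rewrite ger0_norm; lra.
Qed.

Lemma continuous_max_norm (h : R -> R) a b : continuous h -> a <= b ->
  exists2 c, a <= c <= b & forall t, a <= t <= b -> `|h t| <= `|h c|.
Proof.
move=> ch ab; have cn : continuous (fun t => `|h t|).
  by move=> t; apply: (continuous_comp (ch t)); exact: norm_continuous.
have [c + Hc] := EVT_max ab (continuous_subspaceT cn).
by rewrite in_itv /= => cT; exists c => // t tT; apply: Hc; rewrite in_itv.
Qed.

(** Let A be the maximum of [|w|] on the interval. Slope bounds for [w] and [- w] between the
    maximum point and [T], where [w] vanishes, give A <= C dl (A + B), and [C * dl <= 1/2] absorbs A
    on the right. One more integration, over a length at most 1, bounds [h]. *)
Lemma supD_bound_from_zero g (h w f : R -> R) a (C dl x0 T B : R) : 0 <= g ->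
  continuous h -> continuous w -> deriv_on h w ->
  supD g w f -> supD g (fun r => - w r) (fun r => - f r) ->
  0 < a -> a <= x0 -> x0 < T -> T <= rad -> T - x0 <= dl -> dl <= 1 ->
  (k * Lam / a + g + 1) / lam <= C -> C * dl <= 2^-1 ->
  h T = 0 -> w T = 0 -> 0 <= B -> (forall r, x0 < r < T -> `|f r| <= B) ->
  forall r, x0 <= r <= T -> `|h r| <= 2 * C * dl * B /\ `|w r| <= 2 * C * dl * B.
Proof.
move=> g0 ch cw dh sg sg' a0 ax0 xT TR Tx dl1 + Cdl hT wT B0 fB.
have [c cT wc] := continuous_max_norm cw (ltW xT).
have cwN : continuous (fun r => - w r) by move=> t; apply: cvgN; exact: cw.
have [xc cT'] : x0 <= c /\ c <= T by move/andP: cT.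
have bw r : x0 < r < T -> `|w r| <= `|w c| /\ `|f r| <= B.
  by move=> /andP[? ?]; split; [apply: wc; rewrite !ltW|apply: fB; apply/andP].
have bwN r : x0 < r < T -> `|- w r| <= `|w c| /\ `|- f r| <= B.
  by rewrite !normrN; exact: bw.
have := supD_bound g0 cwN sg' a0 ax0 TR bwN (normr_ge0 _) B0 xc cT' (lexx T).
have := supD_bound g0 cw sg a0 ax0 TR bw (normr_ge0 _) B0 xc cT' (lexx T).
have : 0 <= (k * Lam / a + g + 1) / lam.
  have [? ? ? ?] := params; have Lam0 : 0 <= Lam by lra.
  have : 0 <= k * Lam / a by rewrite divr_ge0 ?mulr_ge0// ltW.
  by move=> ?; rewrite divr_ge0 ?(ltW lam0)//; lra.
move: ((k * Lam / a + g + 1) / lam) => Cg Cg0 b1 b2 CgC.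
rewrite wT in b1 b2.
have AB : 0 <= `|w c| + B by rewrite addr_ge0.
have b3 : Cg * (`|w c| + B) * (T - c) <= C * (`|w c| + B) * dl.
  apply: ler_pM; [by rewrite mulr_ge0|lra|by rewrite ler_wpM2r|lra].
have b4 : `|w c| <= C * (`|w c| + B) * dl by rewrite ler_norml; lra.
have b5 : C * dl * `|w c| <= 2^-1 * `|w c| by rewrite ler_wpM2r.
have wcD : `|w c| <= 2 * C * dl * B by lra.
move=> r rT; split; last by apply: le_trans wcD; exact: wc.
apply: le_trans wcD.
have [->|rnT] := eqVneq r T; first by rewrite hT normr0.
have rT' : r < T by rewrite lt_neqAle rnT; case/andP: rT.
have r0 : 0 <= r by lra.
have [xi xir hxi] := deriv_on_MVT ch dh r0 rT' TR.
have -> : h r = - (w xi * (T - r)) by rewrite -hxi hT; ring.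
rewrite normrN normrM (ger0_norm (_ : 0 <= T - r)); last by lra.
have h1 : `|w xi| <= `|w c| by apply: wc; lra.
have h2 : `|w xi| * (T - r) <= `|w xi| * 1 by rewrite ler_wpM2l//; lra.
lra.
Qed.

(** Composing the bounds gives U <= D U^(pq) = D U^(pq - 1) U. The exponent [p * q - 1] is
    nonnegative, so the a priori bound [M] turns the factor into a number below 1, also in the
    critical case pq = 1. *)
Lemma mutual_powR_bound_eq0 (U V D M p q : R) : 0 <= U -> 0 <= V -> U <= M -> 0 <= D -> D <= 1 ->
  0 < p -> 0 < q -> 1 <= p * q -> D * M `^ (p * q - 1) < 1 ->
  U <= D * V `^ q -> V <= D * U `^ p -> U = 0 /\ V = 0.
Proof.
move=> U0 V0 UM D0 D1 p0 q0 pq DM hU hV.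
suff Uz : U = 0.
  by split=> //; apply/eqP; rewrite eq_le V0 andbT (le_trans hV)// Uz powR0 ?mulr0// gt_eqF.
apply/eqP; rewrite eq_le U0 andbT leNgt; apply/negP => Upos.
have h1 : V `^ q <= U `^ (p * q).
  rewrite powRrM ge0_ler_powR ?nnegrE ?powR_ge0 ?(ltW q0)//.
  by apply: (le_trans hV); rewrite ler_piMl ?powR_ge0.
have h2 : U `^ (p * q) = U * U `^ (p * q - 1).
  by rewrite mulr_powRB1// mulr_gt0.
have h3 : U `^ (p * q - 1) <= M `^ (p * q - 1).
  by rewrite ge0_ler_powR ?nnegrE// ?subr_ge0//; exact: le_trans UM.
have h4 : D * V `^ q <= D * (U * M `^ (p * q - 1)).
  by rewrite ler_wpM2l// (le_trans h1)// h2 ler_wpM2l.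
have h5 : D * M `^ (p * q - 1) * U < 1 * U by rewrite ltr_pM2r.
lra.
Qed.

(* Near [rad] each profile is a small multiple of a power of the other one, and [pq >= 1]
   makes the composition of the two bounds contracting; the step [dl] does not depend
   on the position, so the argument propagates down to any [a > 0]. *)
Lemma supD_zero g1 g2 u w1 v w2 f1 f2 (p q Cf : R) : 0 <= g1 -> 0 <= g2 ->
  continuous u -> continuous v -> continuous w1 -> continuous w2 ->
  deriv_on u w1 -> deriv_on v w2 ->
  supD g1 w1 f1 -> supD g1 (fun r => - w1 r) (fun r => - f1 r) ->
  supD g2 w2 f2 -> supD g2 (fun r => - w2 r) (fun r => - f2 r) ->
  0 < p -> 0 < q -> 1 <= p * q -> 0 < Cf ->
  (forall r, 0 < r < rad -> `|f1 r| <= Cf * `|v r| `^ q) ->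
  (forall r, 0 < r < rad -> `|f2 r| <= Cf * `|u r| `^ p) ->
  [/\ u rad = 0, v rad = 0, w1 rad = 0 & w2 rad = 0] ->
  forall r, 0 < r <= rad -> u r = 0 /\ v r = 0.
Proof.
have [? ? ? ?] := params.
move=> g10 g20 cu cv cw1 cw2 du dv s1 s1' s2 s2' p0 q0 pq Cf0 Hf1 Hf2 zR a /andP[a0 aR].
have Lam0 : 0 < Lam by lra.
have [c _ Hc] := continuous_max_norm cu (ltW rad0).
set M := `|u c| in Hc.
have kL : 0 <= k * Lam / a by rewrite divr_ge0 ?mulr_ge0// ltW.
pose C := (k * Lam / a + g1 + g2 + 1) / lam.
have C0 : 0 < C by rewrite divr_gt0//; lra.
pose P := M `^ (p * q - 1).
have P0 : 0 <= P by exact: powR_ge0.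
(* Chosen for the identity [dlE], whose nonnegative summands yield all smallness conditions at once:
   [dl <= 1], [C * dl <= 1/2], [D <= 1] and [D * P < 1]. *)
pose dl := (1 + 2 * C + 2 * C * Cf + 2 * C * Cf * P)^-1.
have CC : 0 <= C * Cf by rewrite mulr_ge0// ltW.
have CP : 0 <= C * Cf * P by rewrite mulr_ge0.
have dl0 : 0 < dl by rewrite invr_gt0; lra.
have dlE : dl + 2 * C * dl + 2 * C * Cf * dl + 2 * C * Cf * P * dl = 1.
  rewrite /dl; field; rewrite gt_eqF//; lra.
have t1 : 0 <= C * dl by rewrite mulr_ge0// ltW.
have t2 : 0 <= C * Cf * dl by rewrite mulr_ge0// ltW.
have t3 : 0 <= C * Cf * P * dl by rewrite mulr_ge0// ltW.
have gC1 : (k * Lam / a + g1 + 1) / lam <= C by rewrite ler_pM2r ?invr_gt0//; lra.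
have gC2 : (k * Lam / a + g2 + 1) / lam <= C by rewrite ler_pM2r ?invr_gt0//; lra.
clearbody dl; clearbody C.
have dl1 : dl <= 1 by lra.
have Cdl : C * dl <= 2^-1 by lra.
pose D := 2 * C * dl * Cf.
have D0 : 0 <= D by rewrite /D; lra.
have D1 : D <= 1 by rewrite /D; lra.
have DM : D * P < 1 by rewrite /D; lra.
(* The derivatives belong to the invariant because each step restarts from zero Cauchy data at a
   point [T] at most [dl] further right. *)
suff H n : forall r, a <= r <= rad -> rad - n%:R * dl <= r ->
    [/\ u r = 0, v r = 0, w1 r = 0 & w2 r = 0].
  have [| |//] := H (Num.bound (rad / dl)) a; first by rewrite lexx.
  have := archi_boundP (divr_ge0 (ltW rad0) (ltW dl0)); rewrite ltr_pdivrMr// => h.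
  by rewrite lerBlDr (le_trans (ltW h))// lerDr ltW.
clear dlE t1 t2 t3 CC CP.
elim: n => [r rr|n IH r rr rn].
  by rewrite mul0r subr0 => ?; have -> : r = rad by lra.
have [ar rR] : a <= r /\ r <= rad by move/andP: rr.
pose T := Num.min (r + dl) rad.
have [T1 T2] : T <= r + dl /\ T <= rad by rewrite !ge_min !lexx orbT.
have [->//|rnR] := eqVneq r rad.
have rT : r < T by rewrite lt_min ltrDl dl0 lt_neqAle rnR.
have [||uT vT w1T w2T] := IH T.
- by rewrite T2 (le_trans ar)// ltW.
- rewrite /T le_min; apply/andP; split; last by rewrite gerBl mulr_ge0// ltW.
  by move: rn; rewrite -natr1 mulrDl mul1r opprD addrA lerBlDr.
have Tr : T - r <= dl by rewrite lerBlDl.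
have rsub t : r <= t <= T -> 0 <= t <= rad.
  by move=> /andP[h1 h2]; rewrite (le_trans h2)// andbT (le_trans (ltW a0))// (le_trans ar).
have rsub' t : r < t < T -> 0 < t < rad.
  by move=> /andP[h1 h2]; rewrite (lt_le_trans h2)// andbT (lt_trans a0)// (le_lt_trans ar).
have [cU cUT HU] := continuous_max_norm cu (ltW rT).
have [cV cVT HV] := continuous_max_norm cv (ltW rT).
have r1 t : r <= t <= T -> `|u t| <= D * `|v cV| `^ q /\ `|w1 t| <= D * `|v cV| `^ q.
  rewrite /D -(mulrA _ Cf); apply: (supD_bound_from_zero g10 cu cw1 du s1 s1' a0 ar) => //.
    by rewrite mulr_ge0 ?powR_ge0// ltW.
  move=> z zz; apply: (le_trans (Hf1 z (rsub' _ zz))); rewrite ler_wpM2l ?(ltW Cf0)//.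
  rewrite ge0_ler_powR ?nnegrE ?(ltW q0)//; apply: HV.
  by case/andP: zz => ? ?; rewrite !ltW.
have r2 t : r <= t <= T -> `|v t| <= D * `|u cU| `^ p /\ `|w2 t| <= D * `|u cU| `^ p.
  rewrite /D -(mulrA _ Cf); apply: (supD_bound_from_zero g20 cv cw2 dv s2 s2' a0 ar) => //.
    by rewrite mulr_ge0 ?powR_ge0// ltW.
  move=> z zz; apply: (le_trans (Hf2 z (rsub' _ zz))); rewrite ler_wpM2l ?(ltW Cf0)//.
  rewrite ge0_ler_powR ?nnegrE ?(ltW p0)//; apply: HU.
  by case/andP: zz => ? ?; rewrite !ltW.
have UM : `|u cU| <= M by apply: Hc; exact: rsub.
have [Uz Vz] := mutual_powR_bound_eq0 (normr_ge0 _) (normr_ge0 _) UM D0 D1 p0 q0 pq DM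
  (r1 _ cUT).1 (r2 _ cVT).1.
have hr : r <= r <= T by rewrite lexx ltW.
have [+ +] := r1 _ hr; have [+ +] := r2 _ hr.
rewrite Uz Vz !powR0 ?gt_eqF// mulr0 !normr_le0.
by move=> /eqP-> /eqP-> /eqP-> /eqP->.
Qed.

Definition signed_powR (c q : R) (r x : R) := r `^ c * `|x| `^ (q - 1) * x.

Lemma signed_powR_ge0 c q r x : 0 <= x -> 0 <= signed_powR c q r x.
Proof. by move=> x0; rewrite !mulr_ge0 ?powR_ge0. Qed.

Lemma signed_powR_le0 c q r x : x <= 0 -> signed_powR c q r x <= 0.
Proof. by move=> x0; rewrite mulr_ge0_le0// mulr_ge0 ?powR_ge0. Qed.

Lemma norm_signed_powR c q r x : 0 < q -> `|signed_powR c q r x| = r `^ c * `|x| `^ q.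
Proof.
move=> q0; rewrite /signed_powR !normrM !(ger0_norm (powR_ge0 _ _)) -mulrA.
by rewrite [X in _ * X]mulrC mulr_powRB1.
Qed.

Lemma norm_signed_powR_le c q r x : 0 <= c -> 0 < q -> 0 < r < rad ->
  `|signed_powR c q r x| <= rad `^ c * `|x| `^ q.
Proof.
move=> c0 q0 /andP[r0 rR]; rewrite norm_signed_powR// ler_wpM2r ?powR_ge0//.
by rewrite ge0_ler_powR ?nnegrE// ?ltW// (lt_trans r0).
Qed.

(** Each nonlinearity has the sign of its unknown, so the sign argument applies to [(u, v)] and to
    [(- u, - v)], with the equations in either order. The four instances show that a zero derivative
    of one component at [rad] forces a zero derivative of the other. *)
Lemma profile_system_eq0 g1 g2 (u w1 v w2 : R -> R) (p q al be : R) : 0 <= g1 -> 0 <= g2 ->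
  continuous u -> continuous v -> continuous w1 -> continuous w2 ->
  deriv_on u w1 -> deriv_on v w2 ->
  let f1 r := signed_powR be q r (v r) in
  let f2 r := signed_powR al p r (u r) in
  supD g1 w1 f1 -> supD g1 (fun r => - w1 r) (fun r => - f1 r) ->
  supD g2 w2 f2 -> supD g2 (fun r => - w2 r) (fun r => - f2 r) ->
  0 <= al -> 0 <= be -> 0 < p -> 0 < q -> 1 <= p * q ->
  u rad = 0 -> v rad = 0 -> w1 0 = 0 -> w2 0 = 0 ->
  w1 rad = 0 \/ w2 rad = 0 ->
  forall r, 0 < r <= rad -> u r = 0 /\ v r = 0.
Proof.
move=> g10 g20 cu cv cw1 cw2 du dv f1 f2 s1 s1' s2 s2' al0 be0 p0 q0 pq uR vR w10 w20 wR.
have neg (h : R -> R) : continuous h -> continuous (fun r => - h r).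
  by move=> ch t; apply: cvgN; exact: ch.
have dneg h w : deriv_on h w -> deriv_on (fun r => - h r) (fun r => - w r).
  by move=> dh r rr; have ? := dh r rr; apply: is_deriveN.
have [[[cun cvn] cw1n] cw2n] := (neg _ cu, neg _ cv, neg _ cw1, neg _ cw2).
have [dun dvn] := (dneg _ _ du, dneg _ _ dv).
have nn (h : R -> R) : (fun r => - - h r) = h by apply/funext => r; rewrite opprK.
have [s1n s2n] : supD g1 (fun r => - - w1 r) (fun r => - - f1 r) /\
    supD g2 (fun r => - - w2 r) (fun r => - - f2 r) by rewrite !nn.
have F1 r : 0 < r < rad -> 0 <= v r -> 0 <= f1 r by move=> _; exact: signed_powR_ge0.
have F1' r : 0 < r < rad -> v r <= 0 -> f1 r <= 0 by move=> _; exact: signed_powR_le0.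
have F2 r : 0 < r < rad -> 0 <= u r -> 0 <= f2 r by move=> _; exact: signed_powR_ge0.
have F2' r : 0 < r < rad -> u r <= 0 -> f2 r <= 0 by move=> _; exact: signed_powR_le0.
have F1n r : 0 < r < rad -> 0 <= - v r -> 0 <= - f1 r.
  by rewrite !oppr_ge0; exact: F1'.
have F1n' r : 0 < r < rad -> - v r <= 0 -> - f1 r <= 0.
  by rewrite !oppr_le0; exact: F1.
have F2n r : 0 < r < rad -> 0 <= - u r -> 0 <= - f2 r.
  by rewrite !oppr_ge0; exact: F2'.
have F2n' r : 0 < r < rad -> - u r <= 0 -> - f2 r <= 0.
  by rewrite !oppr_le0; exact: F2.
have oz (x : R) : x = 0 -> - x = 0 by move=> ->; rewrite oppr0.
have z12 : w1 rad = 0 -> w2 rad = 0.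
  move=> w1R; apply/eqP; rewrite eq_le -oppr_ge0; apply/andP; split.
    have := @supD_opposite_signs g1 g2 _ _ _ _ (fun r => - f1 r) (fun r => - f2 r)
      g10 g20 cun cvn cw1n cw2n dun dvn s1' s2n F1n F2n'.
    by apply; exact: oz.
  exact: (supD_opposite_signs g10 g20 cu cv cw1 cw2 du dv s1 s2' F1 F2' uR vR w1R w20).
have z21 : w2 rad = 0 -> w1 rad = 0.
  move=> w2R; apply/eqP; rewrite eq_le -oppr_ge0; apply/andP; split.
    have := @supD_opposite_signs g2 g1 _ _ _ _ (fun r => - f2 r) (fun r => - f1 r)
      g20 g10 cvn cun cw2n cw1n dvn dun s2' s1n F2n F1n'.
    by apply; exact: oz.
  exact: (supD_opposite_signs g20 g10 cv cu cw2 cw1 dv du s2 s1' F2 F1' vR uR w2R w10).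
have [w1R w2R] : w1 rad = 0 /\ w2 rad = 0 by case: wR => h; split => //; auto.
have Cf0 : 0 < rad `^ be + rad `^ al by rewrite addr_gt0 ?powR_gt0.
apply: (supD_zero g10 g20 cu cv cw1 cw2 du dv s1 s1' s2 s2' p0 q0 pq Cf0) => //.
- move=> r rr; apply: (le_trans (norm_signed_powR_le _ be0 q0 rr)).
  by rewrite ler_wpM2r ?powR_ge0// lerDl powR_ge0.
- move=> r rr; apply: (le_trans (norm_signed_powR_le _ al0 p0 rr)).
  by rewrite ler_wpM2r ?powR_ge0// lerDr powR_ge0.
Qed.

End ode.

(** * Borel sets of R^N carried by tuples *)

Section tuple_borel.
Context {R : realType} {N : nat}.
Local Notation mR := (measurableTypeR R).
Implicit Types (O : set 'rV[R]_N) (g : 'rV[R]_N -> R).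

Lemma vecE (t : N.-tuple mR) i : vec t 0 i = tnth t i.
Proof. by rewrite mxE. Qed.

Lemma measurable_tuple_box (A : 'I_N -> set mR) : (forall i, measurable (A i)) ->
  measurable [set t : N.-tuple mR | forall i, A i (tnth t i)].
Proof.
move=> mA.
have -> : [set t : N.-tuple mR | forall i, A i (tnth t i)] =
    \bigcap_(i in [set: 'I_N]) (fun t : N.-tuple mR => tnth t i) @^-1` A i.
  by apply/seteqP; split => t /= h i; [move=> _|]; exact: h.
apply: fin_bigcap_measurable => // i _.
by rewrite -[X in measurable X]setTI; exact: measurable_tnth.
Qed.

(** The sigma-algebra on tuples is generated by coordinates, so an open set must be exhibited as a
    countable union of boxes: those with rational centre and radius [1 / (n + 1)] that it contains,
    enumerated through [pickle]. *)
Lemma open_measurable_vec O : open O -> measurable (@vec R N @^-1` O).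
Proof.
move=> oO.
pose B (qn : 'rV[rat]_N * nat) := [set t : N.-tuple mR |
  forall i, ball (ratr (qn.1 0 i) : R) qn.2.+1%:R^-1 (tnth t i)].
pose C k := if unpickle k is Some qn then
  if `[< B qn `<=` @vec R N @^-1` O >] then B qn else set0 else set0.
have -> : @vec R N @^-1` O = \bigcup_k C k.
  apply/seteqP; split => [t /= Ot|t [k _]]; last first.
    by rewrite /C; case: unpickle => // qn; case: asboolP => // h /h.
  have [e /= e0 He] := (nbhs_ballP _ _).1 (oO _ Ot).
  (* With radius below [e / 2], a box whose rational centre is that close to [t] contains [t] and
     stays in the ball of radius [e]. *)
  have [n _ hn] := near_infty_natSinv_lt (PosNum (divr_gt0 e0 (ltr0n R 2))).
  have := hn n (leqnn n) => /= hn'; have n0 : (0 : R) < n.+1%:R^-1 by rewrite invr_gt0.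
  have /(_ _)/cid-/all_sig[q Hq] i : exists q : rat, ball (tnth t i : R) n.+1%:R^-1 (ratr q).
    have [x [xq [q _ qx]]] := @dense_rat R (ball (tnth t i : R) n.+1%:R^-1)
      (ex_intro _ _ (ballxx (tnth t i : R) n0)) (ball_open _ _).
    by exists q; rewrite qx.
  pose qn := (\row_i q i, n) : 'rV[rat]_N * nat.
  exists (pickle qn) => //; rewrite /C pickleK.
  have -> : `[< B qn `<=` @vec R N @^-1` O >].
    apply/asboolP => s Bs; apply: He; split => // i j.
    rewrite ord1 !vecE; have := Bs j; have := Hq j; rewrite /= mxE => h1 h2.
    have := ball_triangle h1 h2; apply: le_ball.
    by move: (_^-1) hn' => z ?; lra.
  by move=> i; rewrite /= mxE; apply: ball_sym; exact: Hq.
apply: bigcupT_measurable => k; rewrite /C; case: unpickle => // qn; case: ifP => // _.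
apply: (@measurable_tuple_box (fun i => ball (ratr (qn.1 0 i) : R) qn.2.+1%:R^-1)) => i.
by apply: open_measurable; exact: ball_open.
Qed.

Lemma closed_measurable_vec O : closed O -> measurable (@vec R N @^-1` O).
Proof.
by move=> cO; rewrite -(setCK O) preimage_setC; 
apply: measurableC; apply: (@open_measurable_vec (~` O)); rewrite openC.
Qed.

Lemma C0_measurable O g : open O -> C0 O g ->
  measurable_fun (@vec R N @^-1` O) (g \o @vec R N).
Proof.
move=> oO cg; apply: (measurability (@RGenOInfty.G R)) => [|_ [_ [a ->] <-]].
  exact: RGenOInfty.measurableE.
rewrite [X in measurable X](_ : _ = @vec R N @^-1` (O `&` g @^-1` `]a, +oo[))//.
apply: open_measurable_vec; rewrite openE => x [Ox ax].
apply: filterI; first exact: open_nbhs_nbhs.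
move: ax; rewrite /= in_itv /= andbT => ax.
near=> y; rewrite /= in_itv /= andbT; near: y.
exact: (cvgr_gt _ (cg x Ox)).
Unshelve. all: by end_near.
Qed.

Lemma continuous_measurable_vec g : continuous g -> measurable_fun setT (g \o @vec R N).
Proof. by move=> cg; apply: (@C0_measurable setT) => //; [exact: openT|move=> x _; exact: cg]. Qed.

End tuple_borel.

Lemma lebN_box (R : realType) N (e : R) (c : 'I_N -> R) : 0 < e ->
  lebN N [set t : N.-tuple (measurableTypeR R) |
    forall i, `[c i - e, c i + e]%classic (tnth t i : R)] = ((2 * e) ^+ N)%:E.
Proof.
move=> e0; elim: N c => [|N IH] c.
  by rewrite /lebN /= expr0 diracE mem_set// => -[].
rewrite [LHS](_ : _ = (@lebesgue_measure R \x lebN N)%E (`[c ord0 - e, c ord0 + e]%classic `*`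
   [set t : N.-tuple (measurableTypeR R) |
    forall i, `[c (lift ord0 i) - e, c (lift ord0 i) + e]%classic (tnth t i : R)])).
  rewrite product_measure1E//; last first.
    apply: (@measurable_tuple_box _ _ (fun i => `[c (lift ord0 i) - e, c (lift ord0 i) + e]%classic)) => i.
    exact: measurable_itv.
  rewrite [X in (_ * X)%E]IH /= lebesgue_measure_itv /= lte_fin ifT; last by lra.
  by rewrite -EFinD -EFinM exprS; congr (_ * _)%:E; ring.
rewrite /lebN /=; congr ((_ \x _)%E _); apply/seteqP; split => -[x t] /=.
  move=> h; split; first by have := h ord0; rewrite tnth0.
  by move=> i; have := h (lift ord0 i); rewrite tnthS.
move=> [h0 h] i; case: (unliftP ord0 i) => [j ->|->]; first by rewrite tnthS; exact: h.
by rewrite tnth0.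
Qed.

(** * Fubini in a single coordinate *)

Section coordinate_fubini.
Context {R : realType}.
Local Notation mR := (measurableTypeR R).
Local Notation leb := (@lebesgue_measure R).

Definition tset n (t : n.-tuple mR) (i : 'I_n) (s : mR) : n.-tuple mR :=
  [tuple if j == i then s else tnth t j | j < n].

(** Spelled with [0 - M] and [0 + M] to match [lebN_box] at centre 0. *)
Definition box n (M : R) := [set t : n.-tuple mR | forall j, `[0 - M, 0 + M]%classic (tnth t j : R)].

Lemma measurable_box n M : measurable (@box n M).
Proof.
by apply: (@measurable_tuple_box _ _ (fun=> `[0 - M, 0 + M]%classic)) => i; exact: measurable_itv.
Qed.

Lemma bounded_support_integrable n (f : n.-tuple mR -> R) (C M : R) : 0 < M ->
  measurable_fun setT f -> (forall t, `|f t| <= C) -> (forall t, f t != 0 -> box M t) ->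
  (lebN n).-integrable setT (EFin \o f).
Proof.
move=> M0 mf fC fM.
have -> : f = f \_ (box M).
  apply/funext => t; rewrite patchE; case: ifPn => // /negP tM.
  by apply/eqP; apply: contra_notT tM => /fM; rewrite inE.
rewrite -restrict_EFin; apply/integrable_restrict; rewrite ?setTI//.
  exact: measurable_box.
apply: measurable_bounded_integrable => //; first exact: measurable_box.
- by rewrite [X in (X < _)%E](lebN_box (fun=> 0) M0) ltry.
- exact: measurable_funTS.
- exists C; split; first exact: num_real.
  by move=> x Cx t _ /=; apply: le_trans (ltW Cx); exact: fC.
Qed.

(** The measure is built from the head, so Fubini directly separates only the head coordinate. If
    [i] is the head, it is integrated first; otherwise the tail is, by induction, for each fixed
    head. *)
Lemma integral_coordinate_eq0 n (i : 'I_n) (f : n.-tuple mR -> R) (C M : R) : 0 < M ->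
  measurable_fun setT f -> (forall t, `|f t| <= C) -> (forall t, f t != 0 -> box M t) ->
  (forall t, \int[leb]_s (f (tset t i s))%:E = 0)%E ->
  (\int[lebN n]_t (f t)%:E = 0)%E.
Proof.
elim: n i f => [[]//|n IH] i f M0 mf fC fM f0.
have intf := bounded_support_integrable M0 mf fC fM.
have mt : measurable_fun setT (@tcons _ mR n) by exact: measurable_tcons.
have ift : (leb \x lebN n)%E.-integrable setT (EFin \o f \o @tcons _ mR n).
  apply/integrableP; split.
    by apply/measurable_EFinP; apply: measurableT_comp mf mt.
  have /integrableP[_] := intf; rewrite /lebN /= -/(lebN n).
  rewrite /cons_measure ge0_integral_pushforward//=.
  by apply/measurable_EFinP; exact: (measurableT_comp _ mf).
have -> : (\int[lebN n.+1]_t (f t)%:E = \int[(leb \x lebN n)]_z (f (tcons z))%:E)%E.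
  rewrite /lebN /= -/(lebN n) /cons_measure.
  by apply: (integral_pushforward mt) => //; exact/measurable_EFinP.
case: (unliftP ord0 i) => [j ij|i0].
  rewrite -integral12_prod_meas1//=.
  apply: integral0_eq => x _; apply: (IH j) => //.
  - by apply: measurableT_comp mf _; apply: measurable_cons => //; exact: measurable_id.
  - by move=> t /fM h k; have := h (lift ord0 k); rewrite tnthS.
  - move=> t; rewrite -(f0 (tcons (x, t))); apply: eq_integral => s _; congr (f _)%:E.
    apply: eq_from_tnth => k; rewrite tnth_mktuple; case: (unliftP ord0 k) => [l ->|->].
      by rewrite !tnthS tnth_mktuple ij (inj_eq lift_inj).
    by rewrite !tnth0 ij (negPf (neq_lift _ _)).
rewrite -integral21_prod_meas1//=.
apply: integral0_eq => y _; rewrite -(f0 (@tcons _ mR n ((0 : R), y))); apply: eq_integral => s _; congr (f _)%:E.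
apply: eq_from_tnth => k; rewrite tnth_mktuple i0; case: (unliftP ord0 k) => [l ->|->].
  by rewrite !tnthS eq_sym (negPf (neq_lift _ _)).
by rewrite !tnth0 eqxx.
Qed.
End coordinate_fubini.

(** * Directional derivatives as derivatives along lines *)

Section lines.
Context {R : realType} {N : nat}.
Implicit Types (f g : 'rV[R]_N -> R) (x v : 'rV[R]_N).

Lemma is_derive_lineP f x v df :
  is_derive x v f df <-> is_derive (0 : R) (1 : R) (fun h => f (h *: v + x)) df.
Proof.
have E : (fun h : R => h^-1 *: ((f \o shift x) (h *: v) - f x)) =
    (fun h => h^-1 *: (((fun h0 : R => f (h0 *: v + x)) \o shift 0) (h *: 1) -
      (fun h0 : R => f (h0 *: v + x)) 0)).
  by apply/funext => h /=; rewrite scale0r add0r addr0 /GRing.scale /= mulr1.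
split=> -[d e]; split.
- by rewrite /derivable -E.
- by rewrite -e /derive E.
- by rewrite /derivable E.
- by rewrite -e /derive E.
Qed.

Lemma is_derive_line f x v s df :
  is_derive (s *: v + x) v f df -> is_derive s (1 : R) (fun h : R => f (h *: v + x)) df.
Proof.
move=> /is_derive_lineP h.
have E : (fun h : R => f (h *: v + (s *: v + x))) = (fun h : R => f (h *: v + x)) \o (fun h => h + s).
  by apply/funext => k /=; rewrite scalerDl addrA.
rewrite E in h.
have h' : is_derive (s - s) 1 ((fun h : R => f (h *: v + x)) \o (fun h => h + s)) df by rewrite subrr.
have -> : (fun h : R => f (h *: v + x)) =
    ((fun h : R => f (h *: v + x)) \o (fun h => h + s)) \o (fun h => h - s).
  by apply/funext => k /=; rewrite subrK.
rewrite -[df]mulr1; apply: is_derive1_comp.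
by apply: is_derive_eq; rewrite oppr0 addr0.
Qed.

Lemma is_derive_partial f x (i : 'I_N) df : is_derive x (delta_mx 0 i) f df -> partial i f x = df.
Proof. by move=> h; rewrite /partial derive_val. Qed.

Lemma derivable_partial f x (i : 'I_N) : derivable f x (delta_mx 0 i) ->
  is_derive x (delta_mx 0 i) f (partial i f x).
Proof. by move=> h; apply: derivableP. Qed.

End lines.

(** * Compactly supported functions and the integral of a partial derivative *)

Section compact_support.
Context {R : realType} {N : nat}.
Implicit Types (f g eta : 'rV[R]_N -> R) (Om K : set 'rV[R]_N).

Lemma near_closed_compl_eq0 K f x : closed K -> (forall y, ~ K y -> f y = 0) -> ~ K x ->
  \forall y \near x, cst 0 y = f y.
Proof.
move=> cK f0 nKx; have : nbhs x (~` K) by apply: open_nbhs_nbhs; split => //; rewrite openC.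
by apply: filterS => y /f0 ->.
Qed.

Lemma C0_extend Om K f : closed K -> K `<=` Om -> C0 Om f -> (forall x, ~ K x -> f x = 0) ->
  continuous f.
Proof.
move=> cK KO cf f0 x; have [Kx|nKx] := pselect (K x); first exact: cf (KO _ Kx).
rewrite /continuous_at (f0 _ nKx).
by apply: cvg_trans (near_eq_cvg (near_closed_compl_eq0 cK f0 nKx)) _; exact: cvg_cst.
Qed.

Lemma compact_support_derive0 K f x v : closed K -> (forall x, ~ K x -> f x = 0) -> ~ K x ->
  is_derive x v f 0.
Proof.
by move=> cK f0 nKx; apply: (near_eq_is_derive (near_closed_compl_eq0 cK f0 nKx)).
Qed.

(** Points of [K] lie in [Om], where regularity is assumed; off the closed set [K], [f] vanishes in
    a neighbourhood. *)
Lemma C1_extend Om K f : closed K -> K `<=` Om -> C1 Om f -> (forall x, ~ K x -> f x = 0) ->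
  C1 setT f.
Proof.
move=> cK KO [cf df] f0; split; first by move=> x _; apply: (C0_extend cK KO cf f0).
move=> i; split => x _.
  have [Kx|nKx] := pselect (K x); first exact: (df i).1 (KO _ Kx).
  by have [] := compact_support_derive0 (delta_mx 0 i) cK f0 nKx.
apply: (C0_extend cK KO (df i).2) => y nKy.
exact: is_derive_partial (compact_support_derive0 _ cK f0 nKy).
Qed.

Lemma compact_sub_box K : compact K ->
  exists2 M : R, 0 < M & forall t, K (vec t) -> box M t.
Proof.
move=> cK; have [M [_ HM]] := compact_bounded cK.
pose M1 := Num.max 1 (M + 1).
have M1M : M < M1 by rewrite lt_max ltrDl ltr01 orbT.
have M10 : 0 < M1 by rewrite lt_max ltr01.
exists (M1 + 1) => [|t Kt j]; first by rewrite addr_gt0.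
have : ball (0 : 'rV[R]_N) (M1 + 1) (vec t).
  rewrite mx_norm_ball /ball_ /= sub0r normrN; apply: (le_lt_trans (HM _ M1M _ Kt)).
  by rewrite ltrDl.
move=> [_ /(_ 0 j)]; rewrite /ball /= !mxE sub0r normrN ltr_norml => /andP[h1 h2].
by rewrite in_itv /= sub0r add0r !ltW.
Qed.

Lemma continuous_compact_support_bounded K f : compact K -> continuous f ->
  (forall x, ~ K x -> f x = 0) -> exists2 C : R, 0 <= C & forall x, `|f x| <= C.
Proof.
move=> cK cf f0.
have [M [_ HM]] := compact_bounded (continuous_compact (continuous_subspaceT cf) cK).
pose C := Num.max 0 (M + 1).
have CM : M < C by rewrite lt_max ltrDl ltr01 orbT.
have C00 : 0 <= C by rewrite le_max lexx.
exists C => // x; have [Kx|nKx] := pselect (K x); last by rewrite f0// normr0.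
by apply: HM CM _ _; exists x.
Qed.

Lemma compact_support_integrable K f : compact K -> continuous f ->
  (forall x, ~ K x -> f x = 0) ->
  (lebN N).-integrable setT (EFin \o (f \o @vec R N)).
Proof.
move=> cK cf f0; have [M M0 KM] := compact_sub_box cK.
have [C _ fC] := continuous_compact_support_bounded cK cf f0.
apply: (bounded_support_integrable M0 (continuous_measurable_vec cf) (fun t => fC (vec t))).
by move=> t /eqP ft0; apply: KM; apply: contrapT => /f0.
Qed.

Lemma int_inT Om f : (forall x, ~ Om x -> f x = 0) -> int_in Om f = int_in setT f.
Proof.
move=> f0; rewrite /int_in Rintegral_mkcond preimage_setT; apply: eq_Rintegral => t _.
by rewrite patchE; case: ifPn => // /negP; rewrite inE => /f0 ->.
Qed.

Lemma vec_tset (t : N.-tuple (measurableTypeR R)) i s :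
  vec (tset t i s) = s *: delta_mx 0 i + vec (tset t i 0).
Proof.
apply/rowP => j; rewrite !mxE !tnth_mktuple /=.
by case: (eqVneq j i) => _ /=; rewrite ?mulr1 ?mulr0 ?addr0 ?add0r.
Qed.

(** On every line in direction [i], the fundamental theorem of calculus reduces the integral to
    values of [f] outside its support; Fubini in that coordinate concludes. *)
Lemma integral_partial_eq0 K f i : compact K -> C1 setT f -> (forall x, ~ K x -> f x = 0) ->
  int_in setT (partial i f) = 0.
Proof.
move=> cK [cf df] f0.
have closedK : closed K by apply: compact_closed => //; exact: norm_hausdorff.
have df0 x : ~ K x -> partial i f x = 0.
  by move=> nKx; exact: is_derive_partial (compact_support_derive0 _ closedK f0 nKx).
have cdf : continuous (partial i f) by move=> x; apply: (df i).2.
have [M M0 KM] := compact_sub_box cK.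
have [C C0 fC] := continuous_compact_support_bounded cK cdf df0.
rewrite /int_in /Rintegral preimage_setT.
rewrite (@integral_coordinate_eq0 _ _ i (partial i f \o @vec R N) C M) => //.
- exact: continuous_measurable_vec.
- by move=> t; exact: fC.
- by move=> t /eqP ft0; apply: KM; apply: contrapT => /df0.
move=> t; rewrite /=.
pose g s := f (s *: delta_mx 0 i + vec (tset t i 0)).
pose dg s := partial i f (s *: delta_mx 0 i + vec (tset t i 0)).
have cl : continuous (fun s : R => s *: (delta_mx 0 i : 'rV[R]_N) + vec (tset t i 0)).
  by move=> s; apply: cvgD; [exact: scalel_continuous|exact: cvg_cst].
have dgE s : is_derive s (1 : R) g (dg s).
  by apply: is_derive_line; apply: derivable_partial; exact: (df i).1.
have cg : continuous g by move=> s; apply: continuous_comp (cl s) _; exact: cf.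
have cdg : continuous dg by move=> s; apply: continuous_comp (cl s) _; exact: cdf.
have out s : ~ (- M <= s <= M) -> ~ K (s *: delta_mx 0 i + vec (tset t i 0)).
  rewrite -vec_tset => sM /KM /(_ i); rewrite tnth_mktuple eqxx /= in_itv /= sub0r add0r.
  by move/sM.
have gb s : ~ (- M <= s <= M) -> g s = 0 by move=> /out; exact: f0.
(* The endpoints [M + 1] are strictly outside the box containing the support, so the primitive
   vanishes there. *)
rewrite (_ : (fun s => _) = EFin \o (dg \_ `[- (M + 1), M + 1])); last first.
  apply/funext => s /=; congr EFin; rewrite vec_tset -/(dg s) patchE; case: ifPn => // /negP sM.
  apply: df0; apply: out => /andP[h1 h2]; apply: sM; rewrite inE /= in_itv /=; lra.
rewrite -restrict_EFin -integral_mkcond.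
rewrite (@continuous_FTC2 _ _ g) //; first by rewrite !gb ?subee//; lra.
- lra.
- exact: continuous_subspaceT.
- split; first by move=> s _; have [] := dgE s.
  + exact: cvg_at_right_filter (cg _).
  + exact: cvg_at_left_filter (cg _).
- by move=> s _; rewrite derive1E derive_val.
Qed.

End compact_support.

(** * Calculus of C^1 functions, C^1 truncation and integration by parts *)

Section C1_calculus.
Context {R : realType} {N : nat}.
Implicit Types (f g eta : 'rV[R]_N -> R) (Om K : set 'rV[R]_N) (df dg : 'I_N -> 'rV[R]_N -> R).

(* Unlike [C1], it names the partial derivatives, so that it composes. *)
Definition C1_with Om f df := forall x, Om x -> {for x, continuous f} /\
  forall i, is_derive x (delta_mx 0 i) f (df i x) /\ {for x, continuous (df i)}.

Lemma C1_with_partial Om f df : C1_with Om f df ->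
  forall i x, Om x -> partial i f x = df i x.
Proof. by move=> h i x /h[_ /(_ i)[hx _]]; exact: is_derive_partial. Qed.

Lemma C1_withP Om f df : open Om -> C1_with Om f df -> C1 Om f.
Proof.
move=> oO h; split; first by move=> x /h[].
move=> i; split => x Ox; first by have [_ /(_ i)[[]]] := h x Ox.
have [_ /(_ i)[_ cx]] := h x Ox; rewrite /prop_for /continuous_at (C1_with_partial h)//.
have nE : \forall y \near x, df i y = partial i f y.
  have nO : nbhs x Om by exact: open_nbhs_nbhs.
  by apply: filterS nO => y Oy; rewrite (C1_with_partial h).
exact: cvg_trans (near_eq_cvg nE) cx.
Qed.

Lemma C1_with_of Om f : C1 Om f -> C1_with Om f (fun i => partial i f).
Proof.
move=> [cf df] x Ox; split; first exact: cf.
by move=> i; split; [apply: derivable_partial; exact: (df i).1|exact: (df i).2].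
Qed.

Lemma C1_with_mul Om f g df dg : C1_with Om f df -> C1_with Om g dg ->
  C1_with Om (fun x => f x * g x) (fun i x => f x * dg i x + df i x * g x).
Proof.
move=> hf hg x Ox; have [cf {}hf] := hf x Ox; have [cg {}hg] := hg x Ox.
split=> [|i]; first exact: (cvgM cf cg).
have [df1 cdf] := hf i; have [dg1 cdg] := hg i; split.
  by apply: (is_derive_eq (is_deriveM df1 dg1)); rewrite [X in _ + X]mulrC.
exact: (cvgD (cvgM cf cdg) (cvgM cdf cg)).
Qed.

Lemma C1_with_add Om f g df dg : C1_with Om f df -> C1_with Om g dg ->
  C1_with Om (fun x => f x + g x) (fun i x => df i x + dg i x).
Proof.
move=> hf hg x Ox; have [cf {}hf] := hf x Ox; have [cg {}hg] := hg x Ox.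
split=> [|i]; first exact: (cvgD cf cg).
have [df1 cdf] := hf i; have [dg1 cdg] := hg i; split; last exact: (cvgD cdf cdg).
exact: (is_deriveD df1 dg1).
Qed.

Lemma C1_with_cst Om (c : R) : C1_with Om (fun=> c) (fun i x => 0).
Proof.
by move=> x Ox; split=> [|i]; [|split]; [exact: cst_continuous|exact: is_derive_cst|exact: cst_continuous].
Qed.

Lemma is_derive_comp_line (phi : R -> R) f (x v : 'rV[R]_N) a b :
  is_derive (f x) 1 phi a -> is_derive x v f b -> is_derive x v (phi \o f) (a * b).
Proof.
move=> hphi /is_derive_lineP hf; apply/is_derive_lineP.
apply: (@is_derive1_comp _ phi (fun h => f (h *: v + x))) => //.
by rewrite scale0r add0r.
Qed.

Lemma C1_with_comp Om f df (phi dphi : R -> R) :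
  (forall z : R, is_derive z 1 phi (dphi z)) -> continuous dphi -> C1_with Om f df ->
  C1_with Om (phi \o f) (fun i x => dphi (f x) * df i x).
Proof.
move=> hphi cphi hf x Ox; have [cf {}hf] := hf x Ox; split => [|i].
  apply: continuous_comp cf _; apply: differentiable_continuous.
  by apply/derivable1_diffP; have [] := hphi (f x).
have [df1 cdf] := hf i; split; first exact: is_derive_comp_line.
exact: (cvgM (continuous_comp cf (cphi _)) cdf).
Qed.

Lemma C1_with_coord Om (j : 'I_N) : C1_with Om (fun x => x 0 j) (fun i x => (i == j)%:R).
Proof.
move=> x Ox; split=> [|i]; first exact: coord_continuous.
split; last exact: cst_continuous.
apply/is_derive_lineP.
rewrite (_ : (fun h => _) = (fun h : R => h * (i == j)%:R + x 0 j)); last first.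
  by apply/funext => h; rewrite !mxE eqxx /= eq_sym.
apply: is_derive_eq; rewrite addr0 scaler0 add0r /GRing.scale /= mulr1 //.
Qed.

(** The square makes the positive part C^1. This truncation produces the half-space and ball cutoffs
    as well as the test function of the energy argument. *)
Lemma is_derive_pos_sqr (z : R) : is_derive z 1 (fun z => Num.max z 0 ^+ 2) (2 * Num.max z 0).
Proof.
have [z0|z0|->] := ltgtP z 0.
- rewrite mulr0; apply: (@near_eq_is_derive _ _ _ (cst 0)).
  have : \forall y \near z, y < 0 by exact: lt_nbhsl.
  by apply: filterS => y y0 /=; rewrite max_r ?expr0n// ltW.
- have h2 : is_derive z (1 : R) (fun z : R => z ^+ 2) (2 * z).
    by apply: is_derive_eq; rewrite /GRing.scale /=; ring.
  apply: (near_eq_is_derive _ h2).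
  have : \forall y \near z, 0 < y by exact: lt_nbhsr.
  by apply: filterS => y y0 /=; rewrite max_l// ltW.
rewrite mulr0.
pose p (z : R) : R := Num.max z 0 ^+ 2; rewrite -/p.
have H : (fun h : R => h^-1 *: ((p \o shift (0 : R)) (h *: (1 : R)) - p 0)) @ (0 : R)^' --> (0 : R).
  have nE : \forall h \near (0 : R)^',
      Num.max h 0 = h^-1 *: ((p \o shift (0 : R)) (h *: (1 : R)) - p 0).
    near=> h; have h0 : h != 0 by near: h; exact: nbhs_dnbhs_neq.
    rewrite /p /= addr0 maxxx expr0n subr0 /GRing.scale /= mulr1.
    have [hn|hp] := leP h 0; first by rewrite expr0n mulr0.
    by rewrite expr2 mulKf.
  apply: cvg_trans (near_eq_cvg nE) _; apply: cvg_within_filter.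
  have : {for (0 : R), continuous (fun h : R => Num.max h 0)}.
    by apply: continuous_max; [exact: cvg_id|exact: cst_continuous].
  by rewrite /prop_for /continuous_at maxxx.
split; first by apply/cvg_ex; exists 0.
exact: cvg_lim.
Unshelve. all: by end_near.
Qed.

Lemma continuous_pos_sqr_deriv : continuous (fun z : R => 2 * Num.max z 0).
Proof.
move=> z; apply: cvgMl_tmp.
by apply: continuous_max; [exact: cvg_id|exact: cst_continuous].
Qed.

(** The product [f * eta] is C^1 with compact support in [Om], hence C^1 on the whole space, and its
    partial derivative integrates to 0. *)
Lemma weak_partial_C1 Om f i : open Om -> C1 Om f -> weak_partial Om i f (partial i f).
Proof.
move=> oO C1f eta [C1eta [K [cK KO eta0]]].
have closedK : closed K by apply: compact_closed => //; exact: norm_hausdorff.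
have deta0 x : ~ K x -> partial i eta x = 0.
  by move=> nKx; exact: is_derive_partial (compact_support_derive0 _ closedK eta0 nKx).
have hf := C1_with_of C1f.
have heta : C1_with Om eta (fun i => partial i eta).
  by move=> x _; exact: (C1_with_of C1eta).
have hpsi := C1_with_mul hf heta.
have psi0 x : ~ K x -> f x * eta x = 0 by move=> /eta0 ->; rewrite mulr0.
have C1psi := C1_extend closedK KO (C1_withP oO hpsi) psi0.
have := integral_partial_eq0 i cK C1psi psi0.
have nOm x : ~ Om x -> ~ K x by move=> nO /KO.
have -> : partial i (fun x => f x * eta x) = fun x => f x * partial i eta x + partial i f x * eta x.
  apply/funext => x; have [Ox|nOx] := pselect (Om x).
    exact: (C1_with_partial hpsi).
  rewrite deta0 ?eta0 ?mulr0 ?addr0; [|exact: nOm..].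
  exact: is_derive_partial (compact_support_derive0 _ closedK psi0 (nOm _ nOx)).
have z1 x : ~ K x -> f x * partial i eta x = 0 by move=> /deta0 ->; rewrite mulr0.
have z2 x : ~ K x -> partial i f x * eta x = 0 by move=> /eta0 ->; rewrite mulr0.
rewrite (int_inT (f := fun x => f x * partial i eta x)); last by move=> x /nOm /z1.
rewrite (int_inT (f := fun x => partial i f x * eta x)); last by move=> x /nOm /z2.
have c1 : continuous (fun x => f x * partial i eta x).
  apply: (C0_extend closedK KO _ z1) => x Ox; exact: cvgM (C1f.1 x Ox) ((C1eta.2 i).2 x I).
have c2 : continuous (fun x => partial i f x * eta x).
  apply: (C0_extend closedK KO _ z2) => x Ox; exact: cvgM ((C1f.2 i).2 x Ox) (C1eta.1 x I).
rewrite /int_in preimage_setT RintegralD//; [|exact: compact_support_integrable cK c1 z1|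
  exact: compact_support_integrable cK c2 z2].
by move/eqP; rewrite addr_eq0 => /eqP.
Qed.

End C1_calculus.

(** * Locally integrable functions and the fundamental lemma of the calculus of variations *)

Section pairing.
Context {R : realType} {N : nat}.
Implicit Types (f g eta : 'rV[R]_N -> R) (Om K : set 'rV[R]_N).

Definition intg Om f := (lebN N).-integrable (@vec R N @^-1` Om) (EFin \o (f \o @vec R N)).

Definition L1loc Om f := measurable_fun (@vec R N @^-1` Om) (f \o @vec R N) /\
  forall K, compact K -> K `<=` Om -> intg K f.

Lemma ae_inS Om (P Q : 'rV[R]_N -> Prop) : (forall x, Om x -> P x -> Q x) -> ae_in Om P -> ae_in Om Q.
Proof. by move=> PQ; rewrite /ae_in; apply: filterS => t h Ot; apply: PQ => //; exact: h. Qed.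

Lemma ae_in_and Om (P Q : 'rV[R]_N -> Prop) : ae_in Om P -> ae_in Om Q ->
  ae_in Om (fun x => P x /\ Q x).
Proof. by rewrite /ae_in; apply: filterS2 => t h1 h2 Ot; split; auto. Qed.

Lemma ae_in_all (I : finType) Om (P : I -> 'rV[R]_N -> Prop) : (forall i, ae_in Om (P i)) ->
  ae_in Om (fun x => forall i, P i x).
Proof.
by rewrite /ae_in => hP; apply: filterS (filter_forall _ hP) => t h Ot i; exact: h.
Qed.

Lemma ae_inW Om (P : 'rV[R]_N -> Prop) : (forall x, Om x -> P x) -> ae_in Om P.
Proof. by move=> hP; apply: aeW => t /= Ot; exact: hP. Qed.

Lemma compact_measurable_vec K : compact K -> measurable (@vec R N @^-1` K).
Proof.
by move=> cK; apply: closed_measurable_vec; apply: compact_closed cK; exact: norm_hausdorff.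
Qed.

Lemma compact_lebN_lty K : compact K -> (lebN N (@vec R N @^-1` K) < +oo)%E.
Proof.
move=> cK; have [M M0 KM] := compact_sub_box cK.
apply: (@le_lt_trans _ _ (lebN N (box M))).
  apply: le_measure; rewrite ?inE; [exact: compact_measurable_vec|exact: measurable_box|].
  by move=> t /KM.
by rewrite [X in (X < _)%E](lebN_box (fun=> 0) M0) ltry.
Qed.

(** On a compact set, which has finite measure, |f| <= 1 + |f|^m. *)
Lemma Lloc_L1loc m Om f : open Om -> 1 <= m -> Lloc m Om f -> L1loc Om f.
Proof.
move=> oO m1 [mf fK]; split => // K cK KO; have mK := compact_measurable_vec cK.
have mfK : measurable_fun (@vec R N @^-1` K) (f \o @vec R N).
  by apply: measurable_funS mf; [exact: open_measurable_vec|move=> t /KO].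
have mp : measurable_fun (@vec R N @^-1` K) (fun t => `|f (vec t)| `^ m).
  by apply: (measurableT_comp (measurable_powR m)); exact: (measurableT_comp _ mfK).
have i1 : (lebN N).-integrable (@vec R N @^-1` K) (fun t => 1 + (`|f (vec t)| `^ m)%:E)%E.
  apply: integrableD => //.
    apply/integrableP; split; first exact: measurable_cst.
    rewrite (eq_integral (cst 1%E)); last by move=> t _; rewrite /= normr1.
    by rewrite integral_cst// mul1e; exact: compact_lebN_lty.
  apply/integrableP; split; first exact/measurable_EFinP.
  have := fK K cK KO; apply: le_lt_trans; rewrite le_eqVlt; apply/orP; left; apply/eqP.
  by apply: eq_integral => t _; rewrite gee0_abs// lee_fin powR_ge0.
apply: le_integrable i1 => //; first exact/measurable_EFinP.
move=> t _ /=; rewrite lee_fin [X in _ <= X]ger0_norm ?addr_ge0 ?powR_ge0//.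
have [f1|f1] := leP `|f (vec t)| 1; first by rewrite (le_trans f1)// lerDl powR_ge0.
rewrite -[leLHS](powRr1 (normr_ge0 _)) (@le_trans _ _ (`|f (vec t)| `^ m))//.
  by rewrite ler_powR// ltW.
by rewrite lerDr.
Qed.

Lemma C0_L1loc Om f : open Om -> C0 Om f -> L1loc Om f.
Proof.
move=> oO cf; split; first exact: C0_measurable.
move=> K cK KO; apply: measurable_bounded_integrable.
- exact: compact_measurable_vec.
- exact: compact_lebN_lty.
- apply: (measurable_funS (open_measurable_vec oO)); last exact: C0_measurable.
  by move=> t /KO.
have cKf : {within K, continuous f}.
  by apply: continuous_in_subspaceT => x; rewrite inE => /KO; exact: cf.
have [M [Mr HM]] := compact_bounded (continuous_compact cKf cK).
exists M; split => // x Mx t Kt /=; apply: HM Mx _ _; by exists (vec t).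
Qed.

Lemma L1loc_mul_C0 Om f g : open Om -> L1loc Om f -> C0 Om g -> L1loc Om (fun x => f x * g x).
Proof.
move=> oO [mf fK] cg; split; first by apply: measurable_funM mf (C0_measurable oO cg).
move=> K cK KO; have cKg : {within K, continuous g}.
  by apply: continuous_in_subspaceT => x; rewrite inE => /KO; exact: cg.
have [M [Mr HM]] := compact_bounded (continuous_compact cKg cK).
apply: (integrableMl (compact_measurable_vec cK) (fK K cK KO)).
  by apply: (measurable_funS (open_measurable_vec oO) _ (C0_measurable oO cg)) => t /KO.
exists M; split => // x Mx t Kt /=; apply: HM Mx _ _; by exists (vec t).
Qed.

Lemma L1locD Om f g : L1loc Om f -> L1loc Om g -> L1loc Om (fun x => f x + g x).
Proof.
move=> [mf fK] [mg gK]; split; first exact: measurable_funD.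
by move=> K cK KO; apply: integrableD (fK K cK KO) (gK K cK KO); exact: compact_measurable_vec.
Qed.

Lemma L1locZ Om (c : R) f : L1loc Om f -> L1loc Om (fun x => c * f x).
Proof.
move=> [mf fK]; split; first by apply: measurable_funM => //; exact: measurable_cst.
by move=> K cK KO; apply: integrableZl (fK K cK KO); exact: compact_measurable_vec.
Qed.

Lemma L1loc_support_intg Om K f : open Om -> compact K -> K `<=` Om -> L1loc Om f ->
  (forall x, ~ K x -> f x = 0) -> intg Om f.
Proof.
move=> oO cK KO [mf fK] f0.
have mO := open_measurable_vec oO.
have mK := compact_measurable_vec cK.
rewrite /intg; have -> : EFin \o (f \o @vec R N) = (EFin \o (f \o @vec R N)) \_ (@vec R N @^-1` K).
  apply/funext => t; rewrite patchE; case: ifPn => // /negP; rewrite inE => /f0 /= ->//.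
apply/integrable_restrict => //.
rewrite setIidr; last by move=> t /KO.
exact: fK.
Qed.

Lemma int_inD Om f g : open Om -> intg Om f -> intg Om g ->
  int_in Om (fun x => f x + g x) = int_in Om f + int_in Om g.
Proof. by move=> oO hf hg; rewrite /int_in RintegralD//; exact: open_measurable_vec. Qed.

Lemma int_inZ Om (c : R) f : open Om -> intg Om f -> int_in Om (fun x => c * f x) = c * int_in Om f.
Proof. by move=> oO hf; rewrite /int_in RintegralZl//; exact: open_measurable_vec. Qed.

Lemma intgD Om f g : open Om -> intg Om f -> intg Om g -> intg Om (fun x => f x + g x).
Proof. move=> oO hf hg; exact: (integrableD (open_measurable_vec oO) hf hg). Qed.

Lemma intgZ Om (c : R) f : open Om -> intg Om f -> intg Om (fun x => c * f x).
Proof. move=> oO hf; exact: (integrableZl (open_measurable_vec oO) c hf). Qed.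

Lemma eq_int_in_ae Om f g : open Om -> L1loc Om f -> L1loc Om g ->
  {ae lebN N, forall t, Om (vec t) -> f (vec t) = g (vec t)} -> int_in Om f = int_in Om g.
Proof.
move=> oO [mf _] [mg _] fg; rewrite /int_in /Rintegral; congr fine.
apply: ae_eq_integral; [exact: open_measurable_vec|exact/measurable_EFinP|exact/measurable_EFinP|].
by apply: filterS fg => t /= h Ot; rewrite h.
Qed.

Lemma le_int_in_ae Om f g : open Om -> intg Om f -> intg Om g ->
  {ae lebN N, forall t, Om (vec t) -> f (vec t) <= g (vec t)} -> int_in Om f <= int_in Om g.
Proof.
move=> oO hf hg fg; have mO := open_measurable_vec oO.
have hg' : intg Om (fun x => g x + -1 * f x) by apply: intgD => //; exact: intgZ.
rewrite -subr_ge0 -mulN1r -int_inZ// -int_inD//; last exact: intgZ.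
have -> : int_in Om (fun x => g x + -1 * f x) = int_in Om (fun x => `|g x + -1 * f x|).
  rewrite /int_in /Rintegral; congr fine; apply: ae_eq_integral => //.
  - exact: measurable_int hg'.
  - by apply/measurable_EFinP; apply: measurableT_comp => //; apply/measurable_EFinP; exact: measurable_int hg'.
  - apply: filterS fg => t /= h Ot; rewrite ger0_norm// mulN1r subr_ge0; exact: h.
by apply: Rintegral_ge0.
Qed.

Lemma int_in_gt0 f (x0 : 'rV[R]_N) K : compact K -> continuous f -> (forall x, 0 <= f x) ->
  (forall x, ~ K x -> f x = 0) -> 0 < f x0 -> 0 < int_in setT f.
Proof.
move=> cK cf f0 fK fx0.
have c0 : 0 < f x0 / 2 by rewrite divr_gt0.
have cfx : f x0 / 2 < f x0 by rewrite ltr_pdivrMr// ltr_pMr// ltr1n.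
have [e /= e0 He] := (nbhs_ballP _ _).1 (cvgr_gt _ (cf x0) _ cfx).
have e20 : 0 < e / 2 by rewrite divr_gt0.
pose B := [set t : N.-tuple (measurableTypeR R) |
  forall i, `[x0 0 i - e / 2, x0 0 i + e / 2]%classic (tnth t i : R)].
have mB : measurable B by apply: (@measurable_tuple_box _ _
  (fun i => `[x0 0 i - e / 2, x0 0 i + e / 2]%classic)) => i; exact: measurable_itv.
have Bf t : B t -> f x0 / 2 <= f (vec t).
  move=> Bt; apply/ltW/He; split => // i j; rewrite ord1 vecE /ball /=.
  by have := Bt j; rewrite /= in_itv /= ltr_norml; lra.
have int := compact_support_integrable cK cf fK.
have mf : measurable_fun setT (fun t => (f (vec t))%:E) by exact: measurable_int int.
have fin : (\int[lebN N]_t (f (vec t))%:E \is a fin_num)%E by exact: integrable_fin_num int.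
have : ((f x0 / 2 * (2 * (e / 2)) ^+ N)%:E <= \int[lebN N]_t (f (vec t))%:E)%E.
  rewrite EFinM -(lebN_box (fun i => x0 0 i) e20) -/B -integral_cst//.
  apply: (@le_trans _ _ (\int[lebN N]_(t in B) (f (vec t))%:E)%E).
    apply: ge0_le_integral => //.
    - by move=> t _; rewrite lee_fin ltW.
    - exact: measurable_funTS.
  by apply: ge0_subset_integral => // t _; rewrite lee_fin.
rewrite /int_in /Rintegral preimage_setT -[X in (_ <= X)%E]fineK// lee_fin.
by apply: lt_le_trans; rewrite mulr_gt0// exprn_gt0// mulr_gt0.
Qed.

(* The supports of C^1 functions form a pi-system generating the Borel sets, and
   [1 - exp (- n c)] increases to the indicator of [c > 0]. *)
Lemma du_bois_reymond Om f zeta : open Om -> L1loc Om f -> C1_compact_support Om zeta ->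
  (forall eta, C1_compact_support Om eta -> int_in Om (fun x => f x * eta x) = 0) ->
  ae_in Om (fun x => f x * zeta x = 0).
Proof.
move=> oO L1f [C1z [K [cK KO z0]]] fint.
have mO := open_measurable_vec oO.
have Czeta : C0 Om zeta by move=> x _; exact: C1z.1.
have L1fz : L1loc Om (fun x => f x * zeta x) by exact: L1loc_mul_C0.
have ifz : intg Om (fun x => f x * zeta x).
  by apply: (L1loc_support_intg oO cK KO L1fz) => x /z0 ->; rewrite mulr0.
(* The factor [zeta] turns local integrability into integrability over the whole space, so the
   integral of [F] over every Borel set is meaningful. *)
pose F := (fun t => (f (vec t) * zeta (vec t))%:E) \_ (@vec R N @^-1` Om).
have iF : (lebN N).-integrable setT F by apply/integrable_restrict => //; rewrite setTI.
have mF := measurable_int _ iF.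
have iFA A : measurable A -> (lebN N).-integrable A F.
  by move=> mA; apply: integrableS iF.
pose G := [set A | exists c : 'rV[R]_N -> R, [/\ C1 setT c, forall x, 0 <= c x &
  A = @vec R N @^-1` [set x | 0 < c x]]].
have posG (c : 'rV[R]_N -> R) : C1 setT c -> measurable (@vec R N @^-1` [set x | 0 < c x]).
  move=> [cc _]; apply: open_measurable_vec; rewrite openE => x /= cx.
  exact: (cvgr_gt _ (cc x I) _ cx).
have [sG0 sGC sGU] := smallest_sigma_algebra setT G.
have GE : @measurable _ (N.-tuple (measurableTypeR R)) = <<s G >>.
  apply/seteqP; split; last first.
    by apply: smallest_sub; [exact: sigma_algebra_measurable|move=> _ [c [C1c _ ->]]; exact: posG].
  apply: smallest_sub; first exact: smallest_sigma_algebra.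
  move=> A; rewrite -bigcup_seq /= => -[i _ [B mB <-]]; rewrite setTI.
  pose pre : set (set R) := [set B | <<s G >> ((fun t : N.-tuple (measurableTypeR R) => tnth t i) @^-1` B)].
  suff : measurable `<=` pre by move=> /(_ _ mB).
  rewrite [X in X `<=` _]RGenOInfty.measurableE; apply: smallest_sub.
    split; rewrite /pre /=.
    - by rewrite preimage_set0.
    - by move=> C h; have := sGC _ h; rewrite !setTD preimage_setC.
    - by move=> C h; rewrite preimage_bigcup; exact: sGU.
  move=> _ [a ->]; apply: sub_gen_smallest.
  (* A C^1 function that is positive exactly on the half-space where the coordinate [i] exceeds [a];
     such half-spaces generate the sigma-algebra. *)
  exists (fun x => Num.max (x 0 i + - a) 0 ^+ 2); split.
  - have h := C1_with_comp is_derive_pos_sqr continuous_pos_sqr_deriv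
      (C1_with_add (@C1_with_coord R N setT i) (@C1_with_cst R N setT (- a))).
    exact: (C1_withP openT h).
  - by move=> x; exact: sqr_ge0.
  - apply/seteqP; split => t /=; rewrite in_itv /= andbT vecE => h.
      by rewrite exprn_gt0// lt_max subr_gt0 h.
    rewrite ltNge; apply/negP => h'; move: h; rewrite max_r ?subr_le0//.
    by rewrite expr0n /= ltxx.
have GI : setI_closed G.
  move=> _ _ [c [C1c c0 ->]] [d [C1d d0 ->]].
  exists (fun x => c x * d x); split; [|by move=> x; rewrite mulr_ge0|].
    exact: (C1_withP openT (C1_with_mul (C1_with_of C1c) (C1_with_of C1d))).
  apply/seteqP; split => t /=; first by move=> [h1 h2]; rewrite mulr_gt0.
  move=> h; split; rewrite lt_neqAle ?c0 ?d0 andbT eq_sym; apply/eqP => e.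
    by rewrite e mul0r ltxx in h.
  by rewrite e mulr0 ltxx in h.
(* The factor [theta] may have full support: [zeta * theta] is still an admissible test function. *)
have Feta (theta : 'rV[R]_N -> R) : C1 setT theta -> (forall x, `|theta x| <= 1) ->
    (\int[lebN N]_t (F t * (theta (vec t))%:E) = 0)%E.
  move=> C1t t1.
  have /fint : C1_compact_support Om (fun x => zeta x * theta x).
    split; first exact: (C1_withP openT (C1_with_mul (C1_with_of C1z) (C1_with_of C1t))).
    by exists K; split => // x /z0 ->; rewrite mul0r.
  have hint : intg Om (fun x => f x * (zeta x * theta x)).
    apply: (L1loc_support_intg oO cK KO).
      by apply: L1loc_mul_C0 => // x _; exact: (cvgM (C1z.1 x I) (C1t.1 x I)).
    by move=> x /z0 ->; rewrite mul0r mulr0.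
  rewrite /int_in /Rintegral => e.
  have : (\int[lebN N]_(t in @vec R N @^-1` Om) (f (vec t) * (zeta (vec t) * theta (vec t)))%:E = 0)%E.
    by rewrite -[LHS]fineK ?e//; exact: integrable_fin_num hint.
  move=> <-; rewrite [RHS]integral_mkcond; apply: eq_integral => t _.
  by rewrite /F !patchE; case: ifPn => _; rewrite ?mul0e// -EFinM mulrA.
have FT : (\int[lebN N]_t F t = 0)%E.
  have C11 : C1 setT (fun _ : 'rV[R]_N => 1 : R).
    exact: (C1_withP openT (@C1_with_cst R N setT 1)).
  rewrite -[RHS](Feta _ C11); last by move=> x; rewrite normr1.
  by apply: eq_integral => t _; rewrite mule1.
have main A : measurable A -> (\int[lebN N]_(t in A) F t = 0)%E.
  move=> mA; have : <<s G >> A by rewrite -GE.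
  move: A {mA}; apply: (@dynkin_induction _ _ G (fun A => \int[lebN N]_(t in A) F t = 0)%E GE GI) => //.
  - move=> _ [c [C1c c0 ->]].
    have mA := posG c C1c.
    pose th n := fun x : 'rV[R]_N => 1 + -1 * expR (- n%:R * c x).
    have C1th n : C1 setT (th n).
      have de (z : R) : is_derive z (1 : R) (fun z => expR (- n%:R * z)) (- n%:R * expR (- n%:R * z)).
        by apply: is_derive_eq; rewrite /GRing.scale /=; ring.
      have cde : continuous (fun z : R => - n%:R * expR (- n%:R * z)).
        move=> z; apply: cvgMl_tmp; apply: continuous_comp; last exact: continuous_expR.
        by apply: cvgMl_tmp; exact: cvg_id.
      have h := C1_with_add (@C1_with_cst R N setT 1) (C1_with_mul (@C1_with_cst R N setT (-1))
        (C1_with_comp de cde (C1_with_of C1c))).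
      exact: (C1_withP openT h).
    have th1 n x : 0 <= th n x <= 1.
      rewrite /th mulN1r subr_ge0 gerBl expR_ge0 andbT.
      by rewrite -expR0 ler_expR mulNr oppr_le0 mulr_ge0.
    have thn n x : `|th n x| <= 1 by have /andP[h1 h2] := th1 n x; rewrite ger0_norm.
    have mth n : measurable_fun setT (fun t => (th n (vec t))%:E).
      by apply/measurable_EFinP; apply: continuous_measurable_vec => x; exact: (C1th n).1.
    set A := (X in (\int[_]_(_ in X) _)%E = _).
    have mFA : measurable_fun setT (F \_ A).
      by apply/(measurable_restrict _ _ measurableT) => //; apply: measurable_funS mF.
    have cvgF : {ae lebN N, forall t, setT t ->
        (fun n => F t * (th n (vec t))%:E)%E @ \oo --> (F \_ A) t}.
      apply: aeW => t _; rewrite patchE; have [r Fr] : exists r, F t = r%:E.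
        by rewrite /F patchE; case: ifPn => _; [exists (f (vec t) * zeta (vec t))|exists 0].
      rewrite Fr; case: ifPn => [|/negP]; rewrite inE /A /= => tA; last first.
        have -> : (fun n => r%:E * (th n (vec t))%:E)%E = cst 0%E.
          apply/funext => n; have -> : th n (vec t) = 0.
            have ct : c (vec t) = 0 by apply/eqP; rewrite eq_le c0 andbT leNgt; apply/negP.
            by rewrite /th ct mulr0 expR0 mulr1 subrr.
          by rewrite mule0.
        exact: cvg_cst.
      have cvgth : (fun n => r * th n (vec t)) @ \oo --> r.
        rewrite -[X in _ --> X]mulr1; apply: cvgMl_tmp.
        rewrite -[X in _ --> X]addr0 -[X in _ --> _ + X](mulr0 (-1)).
        apply: cvgD; first exact: cvg_cst.
        apply: cvgMl_tmp.
        have -> : (fun n : nat => expR (- n%:R * c (vec t))) = (fun n => expR (- c (vec t)) ^+ n).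
          by apply/funext => n; rewrite -expRM_natl mulNr mulrN.
        by apply: cvg_expr; rewrite ger0_norm ?expR_ge0// expR_lt1 oppr_lt0.
      have -> : (fun n => r%:E * (th n (vec t))%:E)%E = EFin \o (fun n => r * th n (vec t)).
        by apply/funext => n; rewrite /= EFinM.
      by apply/fine_cvgP; split; [exact: nearW|exact: cvgth].
    have dom : {ae lebN N, forall t n, setT t -> `|F t * (th n (vec t))%:E| <= `|F t|}%E.
      apply: aeW => t n _; rewrite abseM -[leRHS]mule1; apply: lee_wpmul2l => //.
      by rewrite lee_fin.
    have [_ _] := dominated_convergence measurableT (fun n => emeasurable_funM mF (mth n))
      mFA cvgF (integrable_abse iF) dom.
    rewrite (_ : (fun n => _) = cst 0%E); last first.
      by apply/funext => n; exact: Feta (C1th n) (thn n).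
    rewrite -integral_mkcond => h.
    have h0 : (cst 0 : nat -> \bar R)%E @ \oo --> 0%E by exact: cvg_cst.
    exact: cvg_unique h h0.
  - move=> S mS S0; have := @integral_setU _ _ _ (lebN N) S (~` S) F mS (measurableC mS).
    rewrite setUv => /(_ mF); rewrite FT S0 add0e => <- //.
    by apply/disj_setPCl.
  - move=> S mS tS S0; rewrite integral_bigcup//; last by apply: iFA; exact: bigcupT_measurable.
    by rewrite eseries0.
have : ae_eq (lebN N) setT F (cst 0%E).
  by apply: integral_ae_eq => // E _ mE; rewrite main// integral0.
rewrite /ae_in; apply: filterS => t /(_ I); rewrite /F patchE => + Ot.
by rewrite ifT ?inE//= => -[].
Qed.

End pairing.

(** * Spectrum and Pucci operator of a scalar plus rank-one matrix *)

Lemma det_scalar_sub_rank1 (K : idomainType) n (c : K) (u : 'cV[K]_n) (v : 'rV[K]_n) : c != 0 ->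
  \det (c%:M - u *m v) * c = (c - (v *m u) 0 0) * c ^+ n.
Proof.
move=> c0.
(* The bordered matrix is eliminated in two ways, once on each side. The extra factor [c] stands in
   for an inverse, since [c] will be the polynomial ['X - a%:P]. *)
pose B : 'M[K]_(1 + n) := block_mx 1%:M v u c%:M.
have dB1 : \det B = \det (c%:M - u *m v).
  pose L : 'M[K]_(1 + n) := block_mx 1%:M 0 (- u) 1%:M.
  have dL : \det L = 1 by rewrite det_lblock !det1 mulr1.
  rewrite -[LHS]mul1r -dL -det_mulmx mulmx_block.
  rewrite !mul1mx !mul0mx !addr0 mulmx1 addNr det_ublock det1 mul1r.
  by rewrite mulNmx addrC.
have dB2 : \det B * c = (c - (v *m u) 0 0) * c ^+ n.
  pose L : 'M[K]_(1 + n) := block_mx c%:M 0 (- u) 1%:M.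
  have dL : \det L = c by rewrite det_lblock det1 mulr1 det_scalar expr1.
  rewrite -{1}dL -det_mulmx mulmx_block.
  rewrite !mul1mx !mulmx0 !mulmx1 !add0r mulmxN mul_mx_scalar mul_scalar_mx scalerN subrr.
  by rewrite det_ublock det_scalar det_mx11 !mxE eqxx mulr1n.
by rewrite -dB1.
Qed.
Section pucci_rank_one.
Context {R : realType} (lam Lam : R).
Hypotheses (lam0 : 0 < lam) (lamLam : lam <= Lam).

Lemma char_poly_scalar_rank1 n (a b : R) (x : 'rV[R]_n.+1) :
  char_poly (a%:M + b *: (x^T *m x)) =
  \prod_(e <- a + b * (\sum_i x 0 i ^+ 2) :: nseq n a) ('X - e%:P).
Proof.
pose u : 'cV[{poly R}]_n.+1 := map_mx polyC (b *: x^T).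
pose v : 'rV[{poly R}]_n.+1 := map_mx polyC x.
have E : char_poly_mx (a%:M + b *: (x^T *m x)) = ('X - a%:P)%:M - u *m v.
  rewrite /char_poly_mx map_mxD map_scalar_mx /= opprD addrA -raddfB /=; congr (_ - _).
  by rewrite scalemxAl map_mxM.
have Xa : 'X - a%:P != 0 :> {poly R} by rewrite polyXsubC_eq0.
apply: (mulIf Xa); rewrite /char_poly E det_scalar_sub_rank1// big_cons big_nseq iter_mulr_1.
rewrite -mulrA -exprSr; congr (_ * _); rewrite polyCD opprD addrA; congr (_ - _).
rewrite mxE polyCM rmorph_sum mulr_sumr; apply: eq_bigr => i _.
by rewrite !mxE polyCM rmorphXn /= expr2 mulrCA mulrA.
Qed.

(** The list [eigenvalues X] is a choice, but two lists of roots that split the same polynomial are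
    permutations of each other, so any explicit splitting computes the operator. *)
Lemma Mminus_sum n (X : 'M[R]_n) (s : seq R) : char_poly X = \prod_(e <- s) ('X - e%:P) ->
  Mminus lam Lam X = \sum_(e <- s) pucci1 lam Lam e.
Proof.
move=> Xs; have /prod_XsubC_eq es : \prod_(e <- eigenvalues X) ('X - e%:P) =
    \prod_(e <- s) ('X - e%:P).
  by rewrite -Xs; have /= <- := @xgetI _ [::] [set s | char_poly X = \prod_(e <- s) ('X - e%:P)] s Xs.
rewrite -(perm_big _ es) /Mminus !mulr_sumr [X in X + _]big_mkcond [X in _ + X]big_mkcond.
rewrite -big_split; apply: eq_bigr => e _ /=.
have [e0|e0|->] := ltgtP e 0.
- by rewrite add0r pucci1_neg// ltW.
- by rewrite addr0 pucci1_pos// ltW.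
- by rewrite addr0 pucci1_pos// mulr0.
Qed.

Lemma Mminus_scalar_rank1 n (a b : R) (x : 'rV[R]_n.+1) :
  Mminus lam Lam (a%:M + b *: (x^T *m x)) =
  pucci1 lam Lam (a + b * (\sum_i x 0 i ^+ 2)) + n%:R * pucci1 lam Lam a.
Proof.
rewrite (Mminus_sum (char_poly_scalar_rank1 a b x)) big_cons big_nseq.
by rewrite iter_addr_0 mulr_natl.
Qed.

End pucci_rank_one.

(** * Contact with quartics and the differential inequality *)

Section touching.
Context {R : realType} (lam Lam k rad : R).
Hypotheses (lam0 : 0 < lam) (lamLam : lam <= Lam) (k0 : 0 <= k).
Local Notation m := (pucci1 lam Lam).
Implicit Types (u w f : R -> R) (g r C : R).

Lemma pucci1_lt (a b : R) : a < b -> m a < m b.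
Proof.
have Lam0 : 0 < Lam by apply: lt_le_trans lamLam.
by move=> ab; rewrite /pucci1 lt_min !gt_min !ltr_pM2l// ab orbT.
Qed.

Lemma pucci1_inj_lt (a b : R) : m a < m b -> a < b.
Proof.
rewrite ltNge => h; rewrite ltNge; apply: contra h.
by rewrite le_eqVlt => /predU1P[->//|/pucci1_lt/ltW].
Qed.

Lemma pucci1_sub_ge (a d : R) : 0 <= d -> m a - Lam * d <= m (a - d).
Proof.
move=> d0; rewrite /pucci1 le_min !mulrBr; apply/andP; split.
  by apply: lerB; [rewrite ge_min lexx|rewrite ler_wpM2r].
by rewrite lerB// ge_min lexx orbT.
Qed.

Lemma continuous_pucci1 : continuous m.
Proof.
move=> e; apply: (@continuous_min R R (fun e => lam * e) (fun e => Lam * e)).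
  by apply: cvgMl_tmp; exact: cvg_id.
by apply: cvgMl_tmp; exact: cvg_id.
Qed.

(* [u r - (B r ^+ 2 + C / 2 * r ^+ 4)] is [u] minus a quadratic polynomial in [r ^+ 2]. *)
Definition quartic (B C : R) (r : R) := B * r ^+ 2 + C / 2 * r ^+ 4.

(** The strict gaps at the endpoints leave room to lift the quartic slightly while the radii where
    it lies above [u] stay compactly inside the interval, as the energy argument requires. *)
Definition touches_below u B C x c y := [/\ x < c < y,
  forall r, x <= r <= y -> u c - quartic B C c <= u r - quartic B C r,
  u c - quartic B C c < u x - quartic B C x & u c - quartic B C c < u y - quartic B C y].

(* What the viscosity (or strong) inequality says about the radial tests
   [B |x|^2 + C |x|^4 / 2]: the second derivative of the test is prescribed through [C],
   and [B] adjusts its first derivative at the contact radius. *)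
Definition no_touch g u w f := forall r C, 0 < r < rad ->
  0 < m (w r / r + 4 * r ^+ 2 * C) + k * m (w r / r) - g * `|w r| + f r ->
  exists2 d, 0 < d & forall B x c y, r - d < x -> y < r + d ->
    touches_below u B C x c y -> w c <> 2 * c * (B + C * c ^+ 2).

Lemma is_derive_quartic B C (r : R) : is_derive r 1 (quartic B C) (2 * r * (B + C * r ^+ 2)).
Proof.
have -> : quartic B C = (fun r => B * r ^+ 2 + C / 2 * r ^+ 4) by [].
by apply: is_derive_eq; rewrite /GRing.scale /=; field.
Qed.

(** The derivative of [u - quartic] is negative at [x] and positive at [y], so its minimum over
    [[x, y]] is interior and lies strictly below both endpoint values. *)
Lemma touches_below_exists u w B C x y : continuous u -> continuous w -> deriv_on rad u w ->
  0 < x -> x < y -> y < rad ->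
  w x < 2 * x * (B + C * x ^+ 2) -> 2 * y * (B + C * y ^+ 2) < w y ->
  exists2 c, touches_below u B C x c y & w c = 2 * c * (B + C * c ^+ 2).
Proof.
move=> cu cw du x0 xy yr wx wy.
pose z r := u r - quartic B C r; pose dz r := w r - 2 * r * (B + C * r ^+ 2).
have dzE r : 0 < r < rad -> is_derive r (1 : R) z (dz r).
  by move=> rr; apply: is_deriveB; [exact: du|exact: is_derive_quartic].
have cq : continuous (quartic B C).
  by move=> r; apply/differentiable_continuous/derivable1_diffP; have [] := is_derive_quartic B C r.
have cz : continuous z by move=> r; apply: cvgB; [exact: cu|exact: cq].
have cdz : continuous dz.
  move=> r; apply: cvgB; first exact: cw.
  apply: cvgM; first by apply: cvgMl_tmp; exact: cvg_id.
  apply: cvgD; first exact: cvg_cst.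
  by apply: cvgMl_tmp; exact: exprn_continuous.
have [c + cmin] := EVT_min (ltW xy) (continuous_subspaceT cz).
rewrite in_itv /= => /andP[xc cy].
have {}cmin r : x <= r <= y -> z c <= z r by move=> rr; apply: cmin; rewrite in_itv.
have zx : z c < z x.
  have : \forall r \near x, dz r < 0 by apply: (cvgr_lt _ (cdz x)); rewrite subr_lt0.
  move=> /nbhs_ballP[e /= e0 He].
  pose r := Num.min y (x + e / 2).
  have [ry re] : r <= y /\ r <= x + e / 2 by rewrite !ge_min !lexx orbT.
  have xr : x < r by rewrite lt_min xy ltrDl divr_gt0.
  have [xi] := @MVT _ z dz x r xr
    (fun t h => dzE t ltac:(move: h; rewrite in_itv /= => /andP[? ?]; lra)) (continuous_subspaceT cz).
  rewrite in_itv /= => /andP[xxi xir] hxi.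
  have dxi : dz xi < 0 by apply: He; rewrite /ball /= ltr_norml; lra.
  have := cmin r; have : dz xi * (r - x) < 0 by rewrite nmulr_rlt0// subr_gt0.
  by move=> h /(_ ltac:(lra)); lra.
have zy : z c < z y.
  have : \forall r \near y, 0 < dz r by apply: (cvgr_gt _ (cdz y)); rewrite subr_gt0.
  move=> /nbhs_ballP[e /= e0 He].
  pose r := Num.max x (y - e / 2).
  have [ry re] : x <= r /\ y - e / 2 <= r by rewrite !le_max !lexx orbT.
  have xr : r < y by rewrite gt_max xy ltrBlDr ltrDl divr_gt0.
  have [xi] := @MVT _ z dz r y xr
    (fun t h => dzE t ltac:(move: h; rewrite in_itv /= => /andP[? ?]; lra)) (continuous_subspaceT cz).
  rewrite in_itv /= => /andP[xxi xir] hxi.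
  have dxi : 0 < dz xi by apply: He; rewrite /ball /= ltr_norml; lra.
  have := cmin r; have : 0 < dz xi * (y - r) by rewrite mulr_gt0// subr_gt0.
  by move=> h /(_ ltac:(lra)); lra.
have xc' : x < c by rewrite lt_neqAle xc andbT; apply/eqP => e; rewrite e ltxx in zx.
have cy' : c < y by rewrite lt_neqAle cy andbT; apply/eqP => e; rewrite e ltxx in zy.
exists c; first by split => //; rewrite xc'.
have dc : is_derive c (1 : R) z 0.
  apply: (@derive1_at_min _ z x y) => //; first exact: ltW.
  - by move=> t; rewrite in_itv /= => /andP[? ?]; have [] := dzE t ltac:(lra).
  - by rewrite in_itv /= xc'.
  - by move=> t; rewrite in_itv /= => /andP[? ?]; apply: cmin; rewrite !ltW.
have [_ h1] := dc; have [_ h2] := dzE c ltac:(lra).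
by apply/eqP; rewrite -subr_eq0 -/(dz c) -h2 h1.
Qed.

(** Dividing the derivative of the quartic by [2 * r] gives [B + C * r ^+ 2]. For fixed [C] and free
    [B], absence of contact thus says that [w r / (2 * r) - C * r ^+ 2] does not increase, and this
    is converted into a slope bound for [w] by continuity. *)
Lemma no_touch_supD g u w f : 0 <= g -> continuous u -> continuous w -> deriv_on rad u w ->
  no_touch g u w f -> supD lam Lam k rad g w f.
Proof.
move=> g0 cu cw du NT r K r0R pos; have [r0 rR] := andP r0R.
have Lam0 : 0 < Lam by apply: lt_le_trans lamLam.
pose v0 := m K + k * m (w r / r) - g * `|w r| + f r.
have v00 : 0 < v0 := pos.
(* This decrement costs at most half of the excess [v0]. The coefficient [C] is then the one for
   which a quartic with derivative [w r] at [r] has second derivative [K'] there. *)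
pose K' := K - v0 / (2 * Lam).
have e0 : 0 < v0 / (2 * Lam) by rewrite divr_gt0// mulr_gt0.
pose C := (K' - w r / r) / (4 * r ^+ 2).
have KC : w r / r + 4 * r ^+ 2 * C = K' by rewrite /C; field; rewrite gt_eqF.
have [|d d0 Hd] := NT r C r0R.
  rewrite KC; have := pucci1_sub_ge K (ltW e0); rewrite -/K'.
  have -> : Lam * (v0 / (2 * Lam)) = v0 / 2 by field; rewrite gt_eqF.
  have : v0 = m K + k * m (w r / r) - g * `|w r| + f r by [].
  by clearbody K' C v0; lra.
have HW x y : 0 < x -> r - d < x -> x < y -> y < r + d -> y < rad ->
    w y / (2 * y) - w x / (2 * x) <= C * (y ^+ 2 - x ^+ 2).
  move=> x0 rx xy yr yR; rewrite leNgt; apply/negP => lt.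
  pose a := w x / (2 * x) - C * x ^+ 2; pose b := w y / (2 * y) - C * y ^+ 2.
  have ab : a < b by rewrite /a /b; lra.
  have y0 : 0 < y by lra.
  (* With [B] the midpoint of [a] and [b], the derivative of [u - quartic] changes sign from
     negative at [x] to positive at [y], which forces a contact in between. *)
  have h1 : w x < 2 * x * ((a + b) / 2 + C * x ^+ 2).
    have -> : w x = 2 * x * (a + C * x ^+ 2) by rewrite /a; field; rewrite gt_eqF.
    by rewrite ltr_pM2l ?mulr_gt0// ltrD2r; lra.
  have h2 : 2 * y * ((a + b) / 2 + C * y ^+ 2) < w y.
    have -> : w y = 2 * y * (b + C * y ^+ 2) by rewrite /b; field; rewrite gt_eqF.
    by rewrite ltr_pM2l ?mulr_gt0// ltrD2r; lra.
  have [c tc wc] := touches_below_exists cu cw du x0 xy yR h1 h2.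
  exact: (Hd _ _ _ _ rx yr tc).
have cF : {for (r, r), continuous (fun xy : R * R => 2 * xy.2 * C * (xy.1 + xy.2) + w xy.1 / xy.1)}.
  have c1 : (fun xy : R * R => xy.1) @ (r, r) --> r by exact: cvg_fst.
  have c2 : (fun xy : R * R => xy.2) @ (r, r) --> r by exact: cvg_snd.
  have cw1 := @continuous_comp _ _ _ (fun xy : R * R => xy.1) w (r, r) c1 (cw _).
  apply: cvgD; last by apply: cvgM => //; apply: cvgV => //; rewrite gt_eqF.
  apply: cvgM; last exact: cvgD.
  by apply: cvgMr_tmp; apply: cvgMl_tmp.
have lim : 2 * r * C * (r + r) + w r / r = K' by rewrite -KC; ring.
have : \forall xy \near (r, r), 2 * xy.2 * C * (xy.1 + xy.2) + w xy.1 / xy.1 < K.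
  by apply: (cvgr_lt _ cF); rewrite /= lim /K'; lra.
move=> /nbhs_ballP[d1 /= d10 Hd1].
pose D := Num.min (Num.min d d1) (Num.min r (rad - r)).
have D0 : 0 < D by rewrite !lt_min d0 d10 r0 subr_gt0.
have [[Dd Dd1] [Dr DR]] : (D <= d /\ D <= d1) /\ (D <= r /\ D <= rad - r).
  by rewrite !ge_min !lexx !orbT.
exists D => // x y rx xy yr.
have x0 : 0 < x by lra.
have y0 : 0 < y by lra.
have h := HW x y x0 ltac:(lra) xy ltac:(lra) ltac:(lra).
have /= hK : 2 * y * C * (x + y) + w x / x < K.
  by apply: (Hd1 (x, y)); split; rewrite /ball /= ltr_norml; lra.
have -> : w y - w x = 2 * y * (w y / (2 * y) - w x / (2 * x)) + (y - x) * (w x / x).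
  by field; rewrite !gt_eqF.
have h2 : 2 * y * (w y / (2 * y) - w x / (2 * x)) <= 2 * y * (C * (y ^+ 2 - x ^+ 2)).
  by rewrite ler_pM2l// mulr_gt0.
apply: (le_trans (lerD h2 (lexx _))).
have -> : 2 * y * (C * (y ^+ 2 - x ^+ 2)) + (y - x) * (w x / x) =
  (2 * y * C * (x + y) + w x / x) * (y - x) by ring.
by rewrite ler_pM2r ?subr_gt0// ltW.
Qed.

End touching.

(** * The Euclidean norm and quartic test functions on R^N *)

Section quartic_test.
Context {R : realType} {N : nat}.
Implicit Types (x : 'rV[R]_N) (Om : set 'rV[R]_N).

Lemma enorm_ge0 x : 0 <= enorm x.
Proof. exact: sqrtr_ge0. Qed.

Lemma enorm_sqr x : enorm x ^+ 2 = \sum_i x 0 i ^+ 2.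
Proof. by rewrite sqr_sqrtr// sumr_ge0// => i _; exact: sqr_ge0. Qed.

Lemma enormZ (a : R) x : enorm (a *: x) = `|a| * enorm x.
Proof.
rewrite /enorm -sqrtr_sqr -sqrtrM ?sqr_ge0// mulr_sumr; congr Num.sqrt.
by apply: eq_bigr => i _; rewrite mxE exprMn.
Qed.

Lemma C1_with_sqr_sum : C1_with setT (fun x => \sum_j x 0 j ^+ 2) (fun i x => 2 * x 0 i).
Proof.
have H (s : seq 'I_N) : C1_with setT (fun x : 'rV[R]_N => \sum_(j <- s) x 0 j ^+ 2)
    (fun i x => \sum_(j <- s) (x 0 j * (i == j)%:R + (i == j)%:R * x 0 j)).
  elim: s => [|j s IH].
    have := @C1_with_cst R N setT 0.
    by congr C1_with; [apply/funext => x|apply/funext => i; apply/funext => x]; rewrite big_nil.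
  have := C1_with_add (C1_with_mul (@C1_with_coord R N setT j) (@C1_with_coord R N setT j)) IH.
  by congr C1_with; [apply/funext => x|apply/funext => i; apply/funext => x]; rewrite big_cons ?expr2.
have := H (index_enum _); congr C1_with; apply/funext => i; apply/funext => x.
have z : \sum_(j < N | j != i) (x 0 j * (i == j)%:R + (i == j)%:R * x 0 j) = 0.
  by apply: big1 => j ji; rewrite eq_sym (negPf ji) mulr0 mul0r addr0.
by rewrite (bigD1 i)//= z eqxx mulr1 mul1r addr0 mulr_natl mulr2n.
Qed.

Lemma continuous_enorm : continuous (@enorm R N).
Proof.
move=> x; apply: (@continuous_comp _ _ _ (fun x : 'rV[R]_N => \sum_j x 0 j ^+ 2) Num.sqrt).
  exact: (C1_with_sqr_sum I).1.
exact: sqrt_continuous.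
Qed.

Definition qtest (B C : R) x := quartic B C (enorm x).

Lemma qtestE B C : qtest B C = (fun s => B * s + C / 2 * s ^+ 2) \o (fun x => \sum_j x 0 j ^+ 2).
Proof. by apply/funext => x /=; rewrite /qtest /quartic -enorm_sqr -exprM. Qed.

Lemma C1_with_qtest B C :
  C1_with setT (qtest B C) (fun i x => 2 * (B + C * enorm x ^+ 2) * x 0 i).
Proof.
have dP (s : R) : is_derive s (1 : R) (fun s => B * s + C / 2 * s ^+ 2) (B + C * s).
  by apply: is_derive_eq; rewrite /GRing.scale /=; field.
have cP : continuous (fun s : R => B + C * s).
  by move=> s; apply: cvgD; [exact: cvg_cst|apply: cvgMl_tmp; exact: cvg_id].
have := C1_with_comp dP cP C1_with_sqr_sum; rewrite qtestE; congr C1_with.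
by apply/funext => i; apply/funext => x; rewrite enorm_sqr; ring.
Qed.

Lemma partial_qtest B C i : partial i (qtest B C) = fun x => 2 * (B + C * enorm x ^+ 2) * x 0 i.
Proof. by apply/funext => x; rewrite (C1_with_partial (C1_with_qtest B C)). Qed.

Lemma C1_with_partial_qtest B C j : C1_with setT (partial j (qtest B C))
  (fun i x => 2 * (B + C * enorm x ^+ 2) * (i == j)%:R + 4 * C * x 0 i * x 0 j).
Proof.
have := C1_with_mul (C1_with_mul (@C1_with_cst R N setT 2)
  (C1_with_add (@C1_with_cst R N setT B) (C1_with_mul (@C1_with_cst R N setT C) C1_with_sqr_sum)))
  (@C1_with_coord R N setT j).
rewrite partial_qtest; congr C1_with.
  by apply/funext => x; rewrite enorm_sqr.
by apply/funext => i; apply/funext => x; rewrite enorm_sqr; ring.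
Qed.

Lemma grad_qtest B C x : grad (qtest B C) x = (2 * (B + C * enorm x ^+ 2)) *: x.
Proof. by apply/rowP => i; rewrite !mxE partial_qtest. Qed.

Lemma hess_qtest B C x :
  hess (qtest B C) x = (2 * (B + C * enorm x ^+ 2))%:M + (4 * C) *: (x^T *m x).
Proof.
apply/matrixP => i j; rewrite !mxE (C1_with_partial (C1_with_partial_qtest B C j))// big_ord1 !mxE.
by rewrite mulr_natr; congr (_ + _); ring.
Qed.

Lemma symm_hess_qtest B C x : symm (hess (qtest B C) x).
Proof. by rewrite /symm hess_qtest linearD linearZ /= tr_scalar_mx trmx_mul trmxK. Qed.

Lemma C1_sub Om f : C1 setT f -> C1 Om f.
Proof.
move=> [cf df]; split; first by move=> x _; exact: cf.
by move=> i; split => x _; [exact: (df i).1|exact: (df i).2].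
Qed.

Lemma C1_qtest B C : C1 setT (qtest B C).
Proof. exact: C1_withP openT (C1_with_qtest B C). Qed.

Lemma C1_partial_qtest B C i : C1 setT (partial i (qtest B C)).
Proof. exact: C1_withP openT (C1_with_partial_qtest B C i). Qed.

Lemma C0_Lloc (p : R) Om f : open Om -> 0 <= p -> C0 Om f -> Lloc p Om f.
Proof.
move=> oO p0 cf; split; first exact: C0_measurable.
move=> K cK KO; have mK := compact_measurable_vec cK.
have cKf : {within K, continuous f}.
  by apply: continuous_in_subspaceT => x; rewrite inE => /KO; exact: cf.
have [M [Mr HM]] := compact_bounded (continuous_compact cKf cK).
pose M1 := Num.max 0 (M + 1).
have M10 : 0 <= M1 by rewrite le_max lexx.
have fM t : K (vec t) -> `|f (vec t)| <= M1.
  have M1M : M < M1 by rewrite lt_max ltrDl ltr01 orbT.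
  by move=> Kt; apply: HM M1M _ _; exists (vec t).
apply: (@le_lt_trans _ _ (\int[lebN N]_(t in @vec R N @^-1` K) (M1 `^ p)%:E)%E).
  apply: ge0_le_integral => //.
  - apply/measurable_EFinP; apply: (measurableT_comp (measurable_powR p)).
    apply: measurableT_comp => //; apply: measurable_funS (C0_measurable oO cf).
      exact: open_measurable_vec.
    by move=> t /KO.
  - by move=> t Kt; rewrite lee_fin ge0_ler_powR ?nnegrE//; exact: fM.
rewrite integral_cst// lte_mul_pinfty ?lee_fin ?powR_ge0//.
exact: compact_lebN_lty.
Qed.

Lemma W2loc_qtest (p : R) Om B C : open Om -> 0 <= p ->
  W2loc p Om (qtest B C) (grad (qtest B C)) (hess (qtest B C)).
Proof.
move=> oO p0; have C1q := C1_sub Om (C1_qtest B C).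
have C1dq i := C1_sub Om (C1_partial_qtest B C i).
split; last by move=> x; exact: symm_hess_qtest.
- exact: C1q.1.
- exact: C0_Lloc oO p0 C1q.1.
- move=> i; have -> : (fun x => grad (qtest B C) x 0 i) = partial i (qtest B C).
    by apply/funext => x; rewrite mxE.
  split; first exact: C0_Lloc oO p0 (C1q.2 i).2.
  exact: weak_partial_C1.
- move=> i j; have -> : (fun x => grad (qtest B C) x 0 j) = partial j (qtest B C).
    by apply/funext => x; rewrite mxE.
  have -> : (fun x => hess (qtest B C) x i j) = partial i (partial j (qtest B C)).
    by apply/funext => x; rewrite mxE.
  split; last exact: weak_partial_C1.
  exact: C0_Lloc oO p0 ((C1dq j).2 i).2.
Qed.

Lemma C2_qtest Om B C : C2 Om (qtest B C).
Proof. by split; [exact: C1_sub _ (C1_qtest B C)|move=> i; exact: C1_sub _ (C1_partial_qtest B C i)]. Qed.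

Lemma open_eball (r : R) : open (@eball R N r).
Proof.
rewrite openE /eball => x /= xr; exact: (cvgr_lt _ (@continuous_enorm x) _ xr).
Qed.

Lemma open_annulus (a b : R) : open [set x : 'rV[R]_N | a < enorm x < b].
Proof.
rewrite openE => x /= /andP[ax xb].
have h1 : \forall t \near x, a < enorm t by apply: (cvgr_gt _ (@continuous_enorm x)).
have h2 : \forall t \near x, enorm t < b by apply: (cvgr_lt _ (@continuous_enorm x)).
by apply: filterS (filterI h1 h2) => t [/= -> ->].
Qed.

End quartic_test.

(** * Viscosity supersolutions admit no contact with violating quartics *)

Section touching_viscosity.
Context {R : realType} {n : nat} (lam Lam rad gam : R).
Local Notation N := n.+1.
Hypotheses (lam0 : 0 < lam) (lamLam : lam <= Lam) (rad0 : 0 < rad) (gam0 : 0 <= gam).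
Local Notation m := (pucci1 lam Lam).
Implicit Types (F : operator R N) (u w f : R -> R).

(** Comparison with the zero jet is the only part of (SC) that the touching arguments consume. In
    contrast with the two-sided condition, it is stated for a fixed [gam], shared by an operator and
    its reflection. *)
Definition SC_lower F := forall x xi X, eball rad x -> symm X ->
  Mminus lam Lam X - gam * enorm xi <= F x xi X.

Lemma SC_lower_rank1 F (x : 'rV[R]_N) (s c : R) : SC_lower F -> eball rad x ->
  m (s + c * enorm x ^+ 2) + n%:R * m s - gam * (`|s| * enorm x) <=
  F x (s *: x) (s%:M + c *: (x^T *m x)).
Proof.
move=> hF xr; apply: le_trans (hF _ _ _ xr _).
  by rewrite (Mminus_scalar_rank1 lamLam) -enorm_sqr enormZ.
by rewrite /symm linearD linearZ /= tr_scalar_mx trmx_mul trmxK.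
Qed.

(* The inequality violated at the reference radius stays violated, with a uniform
   margin, near it, and also after lowering the radial second derivative by [kap]. *)
Lemma touch_prelude w f (r0 C : R) : continuous w -> {for r0, continuous f} -> 0 < r0 < rad ->
  0 < m (w r0 / r0 + 4 * r0 ^+ 2 * C) + n%:R * m (w r0 / r0) - gam * `|w r0| + f r0 ->
  exists d eps kap, [/\ 0 < d, 0 < eps, 0 < kap, d < r0 /\ d < rad - r0 & forall B c r,
    r0 - d < c < r0 + d -> w c = 2 * c * (B + C * c ^+ 2) -> r0 - d < r < r0 + d ->
    let s := 2 * (B + C * r ^+ 2) in
    eps <= m (s + 4 * C * r ^+ 2) + n%:R * m s - gam * (`|s| * r) + f r /\
    0 < m (s + 4 * C * r ^+ 2 + n%:R * (s - w r / r) - kap) + n%:R * m (w r / r)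
        - gam * `|w r| + f r].
Proof.
move=> cw cf r0R pos; have [r00 r0rad] := andP r0R.
have Lam0 : 0 < Lam by apply: lt_le_trans lamLam.
pose v0 := m (w r0 / r0 + 4 * r0 ^+ 2 * C) + n%:R * m (w r0 / r0) - gam * `|w r0| + f r0.
(* Lowering the argument of [m] by [kap] costs at most [v0 / 2]. *)
pose kap := v0 / (2 * Lam).
have kap0 : 0 < kap by rewrite divr_gt0 ?mulr_gt0.
(* The value of [2 * (B + C * r ^+ 2)] after [B] has been eliminated through the contact condition
   at [c]; this makes the neighbourhood independent of [B]. *)
pose s (rc : R * R) := w rc.2 / rc.2 + 2 * C * (rc.1 ^+ 2 - rc.2 ^+ 2).
pose E1 (rc : R * R) := m (s rc + 4 * C * rc.1 ^+ 2) + n%:R * m (s rc)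
  - gam * (`|s rc| * rc.1) + f rc.1.
(* The argument of the first [m] is the radial second derivative for which the Laplacian of [u],
   whose tangential eigenvalues are [w r / r], would equal that of the quartic minus [kap]. *)
pose E2 (rc : R * R) := m (s rc + 4 * C * rc.1 ^+ 2 + n%:R * (s rc - w rc.1 / rc.1) - kap)
  + n%:R * m (w rc.1 / rc.1) - gam * `|w rc.1| + f rc.1.
have c1 : (fun rc : R * R => rc.1) @ (r0, r0) --> r0 by exact: cvg_fst.
have c2 : (fun rc : R * R => rc.2) @ (r0, r0) --> r0 by exact: cvg_snd.
have cw1 := @continuous_comp _ _ _ (fun xy : R * R => xy.1) w (r0, r0) c1 (cw _).
have cw2 := @continuous_comp _ _ _ (fun xy : R * R => xy.2) w (r0, r0) c2 (cw _).
have cf1 := @continuous_comp _ _ _ (fun xy : R * R => xy.1) f (r0, r0) c1 cf.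
have r0n : r0 != 0 by rewrite gt_eqF.
have cq1 : {for (r0, r0), continuous (fun rc : R * R => w rc.1 / rc.1)}.
  by apply: cvgM => //; apply: cvgV.
have cs : {for (r0, r0), continuous s}.
  apply: cvgD; first by apply: cvgM => //; apply: cvgV.
  by apply: cvgMl_tmp; apply: cvgB; apply: cvgM.
have cr2 : {for (r0, r0), continuous (fun rc : R * R => 4 * C * rc.1 ^+ 2)}.
  by apply: cvgMl_tmp; apply: cvgM.
have cm g : {for (r0, r0), continuous g} -> {for (r0, r0), continuous (fun rc : R * R => m (g rc))}.
  by move=> cg; apply: (@continuous_comp _ _ _ g m) => //; exact: continuous_pucci1.
have cE1 : {for (r0, r0), continuous E1}.
  apply: cvgD => //; apply: cvgB; [apply: cvgD|].
  - by apply: cm; apply: cvgD.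
  - by apply: cvgMl_tmp; exact: cm.
  - by apply: cvgMl_tmp; apply: cvgM => //; exact: (cvg_norm cs).
have cE2 : {for (r0, r0), continuous E2}.
  apply: cvgD => //; apply: cvgB; [apply: cvgD|].
  - apply: cm; apply: cvgB; last exact: cvg_cst.
    apply: cvgD; first exact: cvgD.
    by apply: cvgMl_tmp; apply: cvgB.
  - by apply: cvgMl_tmp; exact: cm.
  - by apply: cvgMl_tmp; exact: (cvg_norm cw1).
have s0 : s (r0, r0) = w r0 / r0 by rewrite /s /= subrr mulr0 addr0.
have nw : `|w r0 / r0| * r0 = `|w r0|.
  by rewrite normrM normfV (gtr0_norm r00) divfK.
have E10 : E1 (r0, r0) = v0.
  by rewrite /E1 s0 /= nw /v0 (_ : 4 * C * r0 ^+ 2 = 4 * r0 ^+ 2 * C)//; ring.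
have E20 : 0 < E2 (r0, r0).
  rewrite /E2 s0 /= subrr mulr0 addr0.
  have := pucci1_sub_ge lamLam (w r0 / r0 + 4 * C * r0 ^+ 2) (ltW kap0).
  have -> : Lam * kap = v0 / 2 by rewrite /kap; field; rewrite gt_eqF.
  have : v0 = m (w r0 / r0 + 4 * C * r0 ^+ 2) + n%:R * m (w r0 / r0) - gam * `|w r0| + f r0.
    by rewrite /v0; congr (m (_ + _) + _ - _ + _); ring.
  have : 0 < v0 by [].
  by clearbody v0 kap; lra.
have h1 : \forall rc \near (r0, r0), v0 / 2 < E1 rc.
  by apply: (cvgr_gt _ cE1); rewrite E10 ltr_pdivrMr// ltr_pMr// ltr1n.
have h2 : \forall rc \near (r0, r0), 0 < E2 rc by apply: (cvgr_gt _ cE2).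
have [d /= d0 Hd] := (nbhs_ballP _ _).1 (filterI h1 h2).
pose D := Num.min d (Num.min (r0 / 2) ((rad - r0) / 2)).
have D0 : 0 < D by rewrite !lt_min d0 !divr_gt0// subr_gt0.
have [Dd [Dr DR]] : D <= d /\ (D <= r0 / 2 /\ D <= (rad - r0) / 2).
  by rewrite !ge_min !lexx !orbT.
have v00 : 0 < v0 by [].
clearbody D; exists D, (v0 / 2), kap; split => //.
- by rewrite divr_gt0.
- by clear -n lam0 lamLam rad0 gam0 Dr DR r00 r0rad; split; lra.
move=> B c r cd wc rd.
have c0 : 0 < c by clear -n lam0 lamLam rad0 gam0 cd Dr r00; lra.
have sE : 2 * (B + C * r ^+ 2) = s (r, c).
  by rewrite /s /= wc; field; rewrite gt_eqF.
have [] : v0 / 2 < E1 (r, c) /\ 0 < E2 (r, c).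
  by apply: Hd; split; rewrite /ball /= ltr_norml; clear -n lam0 lamLam rad0 gam0 cd rd Dd; lra.
by rewrite /E1 /E2 /= -sE => /ltW.
Qed.

Lemma radial_touch_local_min u B C (x c y : R) (z : 'rV[R]_N) : touches_below u B C x c y ->
  enorm z = c -> local_min (fun t => radial u t - qtest B C t) z.
Proof.
move=> [/andP[xc cy] min _ _] zc; rewrite /local_min.
have h1 : \forall t \near z, x < enorm t by apply: (cvgr_gt _ (@continuous_enorm R N z)); rewrite zc.
have h2 : \forall t \near z, enorm t < y by apply: (cvgr_lt _ (@continuous_enorm R N z)); rewrite zc.
apply: filterS (filterI h1 h2) => t [/= t1 t2].
by rewrite /radial /qtest zc; apply: min; rewrite !ltW.
Qed.

Definition axis (r : R) : 'rV[R]_N := r *: delta_mx 0 0.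

Lemma enorm_axis r : 0 <= r -> enorm (axis r) = r.
Proof.
move=> r0; rewrite enormZ ger0_norm// /enorm (bigD1 0)//= big1 ?addr0 => [|i i0].
  by rewrite mxE !eqxx expr1n sqrtr1 mulr1.
by rewrite mxE (negPf i0) andbF expr0n.
Qed.

Lemma C_super_no_touch F u w f : SC_lower F -> continuous w ->
  (forall r, 0 < r < rad -> {for r, continuous f}) ->
  C_supersolution (eball rad) F (fun x => - f (enorm x)) (radial u) ->
  no_touch lam Lam n%:R rad gam u w f.
Proof.
move=> hF cw cf [_ sup] r0 C r0R pos.
have [d [eps [kap [d0 e0 k0 [dr dR] H]]]] := touch_prelude cw (cf _ r0R) r0R pos.
exists d => // B x c y rx yr tc wc; have [/andP[xc cy] _ _ _] := tc.
have cd : r0 - d < c < r0 + d by rewrite (lt_trans rx) ?(lt_trans cy).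
have c0 : 0 < c by clear -n lam0 lamLam rad0 gam0 cd dr; lra.
have ca := enorm_axis (ltW c0).
have Oa : eball rad (axis c) by rewrite /eball /= ca; clear -n lam0 lamLam rad0 gam0 cd dR; lra.
have := sup (qtest B C) (axis c) (C2_qtest _ B C) Oa (radial_touch_local_min tc ca).
rewrite grad_qtest hess_qtest => h1.
have := SC_lower_rank1 (2 * (B + C * enorm (axis c) ^+ 2)) (4 * C) hF Oa.
have [/= h2 _] := H B c c cd wc cd.
move=> h3; move: (le_trans h3 h1) h2; rewrite ca; move: (_ + _ - _) => Z.
by clear -n lam0 lamLam rad0 gam0 e0; lra.
Qed.

(** The margin [eps] holds on a whole annulus around the contact radius, which supplies the open set
    demanded by the definition; a point of the contact sphere is then a forbidden local minimum. *)
Lemma Lm_super_no_touch (p : R) F u w f : 0 <= p -> SC_lower F -> continuous w ->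
  (forall r, 0 < r < rad -> {for r, continuous f}) ->
  Lm_supersolution p (eball rad) F (fun x => - f (enorm x)) (radial u) ->
  no_touch lam Lam n%:R rad gam u w f.
Proof.
move=> p0 hF cw cf [_ sup] r0 C r0R pos.
have [d [eps [kap [d0 e0 k0 [dr dR] H]]]] := touch_prelude cw (cf _ r0R) r0R pos.
exists d => // B x c y rx yr tc wc; have [/andP[xc cy] _ _ _] := tc.
have cd : r0 - d < c < r0 + d by rewrite (lt_trans rx) ?(lt_trans cy).
have c0 : 0 < c by clear -n lam0 lamLam rad0 gam0 cd dr; lra.
have ca := enorm_axis (ltW c0).
pose O := [set z : 'rV[R]_N | r0 - d < enorm z < r0 + d].
have OO : O `<=` eball rad by move=> z /andP[_ h]; rewrite /eball /=; clear -n lam0 lamLam rad0 gam0 h dR; lra.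
have oO : open O by exact: open_annulus.
have W := W2loc_qtest B C (@open_eball R N rad) p0.
have aeO : ae_in O (fun z => eps <= F z (grad (qtest B C) z) (hess (qtest B C) z) - - f (enorm z)).
  apply: ae_inW => z Oz; rewrite grad_qtest hess_qtest.
  have [/= h2 _] := H B c (enorm z) cd wc Oz.
  have := SC_lower_rank1 (2 * (B + C * enorm z ^+ 2)) (4 * C) hF (OO _ Oz).
  rewrite opprK; move: h2; move: (_ + _ - _) (F _ _ _) => Z Y; clear -n lam0 lamLam rad0 gam0; lra.
have Oa : O (axis c) by rewrite /O /= ca.
exact: (sup _ _ _ eps O W e0 oO OO aeO (axis c) Oa (radial_touch_local_min tc ca)).
Qed.

End touching_viscosity.

(** * Locality of C^1 data and uniqueness of weak derivatives in the ball *)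

Section C1_locality.
Context {R : realType} {N : nat}.
Implicit Types (g h : 'rV[R]_N -> R) (dg : 'I_N -> 'rV[R]_N -> R) (Om : set 'rV[R]_N).

Lemma eq_open_C1_with (U : set 'rV[R]_N) g h dg : open U -> (forall x, U x -> h x = g x) ->
  C1_with U g dg -> C1_with U h dg.
Proof.
move=> oU hg Cg x Ux; have [cg dgx] := Cg x Ux.
have nE : \forall y \near x, g y = h y.
  have nU : nbhs x U by exact: open_nbhs_nbhs.
  by apply: filterS nU => y Uy; rewrite hg.
split; first by rewrite /prop_for /continuous_at hg//; exact: cvg_trans (near_eq_cvg nE) cg.
by move=> i; have [d1 d2] := dgx i; split => //; exact: near_eq_is_derive nE d1.
Qed.

Lemma C1_with_sub Om1 Om2 g dg : Om1 `<=` Om2 -> C1_with Om2 g dg -> C1_with Om1 g dg.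
Proof. by move=> sub h x /sub; exact: h. Qed.

End C1_locality.

Section weak_uniqueness.
Context {R : realType} {N : nat} (rad : R).
Hypothesis rad0 : 0 < rad.
Local Notation Om := (@eball R N rad).
Implicit Types (f g eta : 'rV[R]_N -> R).

Lemma coord_le_enorm (x : 'rV[R]_N) i : `|x 0 i| <= enorm x.
Proof.
rewrite -sqrtr_sqr /enorm ler_wsqrtr// (bigD1 i)//= lerDl sumr_ge0// => j _.
exact: sqr_ge0.
Qed.

Lemma enorm_le_compact (A : set 'rV[R]_N) (rho : R) : closed A -> (forall x, A x -> enorm x <= rho) -> compact A.
Proof.
move=> cA Ar; apply: bounded_closed_compact => //.
exists (rho + 1); split; first exact: num_real.
move=> M rM x /Ar xr /=; apply/ltW/(lt_trans _ rM).
have rho0 : 0 <= rho by apply: le_trans xr; exact: enorm_ge0.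
have : ball (0 : 'rV[R]_N) (rho + 1) x.
  split=> [|i j]; first by rewrite ltr_wpDl.
  rewrite ord1 /ball /= !mxE sub0r normrN (le_lt_trans (coord_le_enorm x j))//.
  by rewrite (le_lt_trans xr)// ltrDl.
by rewrite mx_norm_ball /ball_ /= sub0r normrN.
Qed.

Lemma closed_enorm_itv (a b : R) : closed [set x : 'rV[R]_N | a <= enorm x <= b].
Proof.
have -> : [set x : 'rV[R]_N | a <= enorm x <= b] =
    (@enorm R N @^-1` [set r | a <= r]) `&` (@enorm R N @^-1` [set r | r <= b]).
  by apply/seteqP; split => x /=; [move=> /andP[-> ->]|move=> [-> ->]].
by apply: closedI; apply: closed_comp => [x _|];
  [exact: continuous_enorm|exact: closed_ge|exact: continuous_enorm|exact: closed_le].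
Qed.

(** The cutoffs (rho^2 - |x|^2)_+^2 are positive exactly on the smaller open balls of radius rho =
    [rad * (1 - 1 / (k + 1))], and countably many of these balls exhaust the domain. *)
Lemma ae_zero f : L1loc Om f ->
  (forall eta, C1_compact_support Om eta -> int_in Om (fun x => f x * eta x) = 0) ->
  ae_in Om (fun x => f x = 0).
Proof.
move=> L1f f0.
have step (k : nat) : {ae lebN N, forall t, enorm (vec t) < rad * (1 - k.+1%:R^-1) -> f (vec t) = 0}.
  set rho := rad * _.
  have rhor : rho < rad by rewrite /rho mulrBr mulr1 ltrBlDr ltrDl mulr_gt0// invr_gt0.
  have rho0 : 0 <= rho.
    by rewrite mulr_ge0 ?(ltW rad0)// subr_ge0 invf_le1// ler1n.
  pose zeta (x : 'rV[R]_N) := Num.max (rho ^+ 2 + -1 * (\sum_j x 0 j ^+ 2)) 0 ^+ 2.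
  have zE x : zeta x = Num.max (rho ^+ 2 - enorm x ^+ 2) 0 ^+ 2.
    by rewrite /zeta mulN1r enorm_sqr.
  have Cz : C1_compact_support Om zeta.
    split.
      have h := C1_with_comp (@is_derive_pos_sqr R) (@continuous_pos_sqr_deriv R)
        (C1_with_add (@C1_with_cst R N setT (rho ^+ 2)) (C1_with_mul (@C1_with_cst R N setT (-1))
        (@C1_with_sqr_sum R N))).
      exact: (C1_withP openT h).
    exists [set x | 0 <= enorm x <= rho]; split.
    - by apply: (@enorm_le_compact _ rho); [exact: closed_enorm_itv|move=> x /andP[]].
    - by move=> x /andP[_ xr]; exact: le_lt_trans rhor.
    - move=> x; rewrite zE /= enorm_ge0 /= => /negP; rewrite -ltNge => rx.
      rewrite max_r ?expr0n// subr_le0 ler_sqr ?nnegrE ?enorm_ge0//; exact: ltW.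
  have := du_bois_reymond (@open_eball R N rad) L1f Cz f0.
  rewrite /ae_in; apply: filterS => t h tr.
  have /eqP := h (lt_trans tr rhor); rewrite mulf_eq0 => /orP[/eqP//|].
  rewrite zE expf_eq0 /= max_l; last by rewrite subr_ge0 ler_sqr ?nnegrE ?enorm_ge0// ltW.
  by rewrite subr_eq0 eqrXn2 ?enorm_ge0// => /eqP e; rewrite e ltxx in tr.
have := ae_foralln step; rewrite /ae_in; apply: filterS => t h tO.
have e0 : 0 < (rad - enorm (vec t)) / rad by rewrite divr_gt0// subr_gt0.
have [k _ hk] := near_infty_natSinv_lt (PosNum e0).
apply: (h k); have := hk k (leqnn k); rewrite /= ltr_pdivlMr// mulrBr mulr1 ltrBrDr.
by rewrite -ltrBrDl mulrC.
Qed.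

Lemma L1locB f g : L1loc Om f -> L1loc Om g -> L1loc Om (fun x => f x - g x).
Proof. by move=> hf hg; under eq_fun do rewrite -mulN1r; apply: L1locD => //; exact: L1locZ. Qed.

Lemma weak_partial_unique i f g g' : weak_partial Om i f g -> weak_partial Om i f g' ->
  L1loc Om g -> L1loc Om g' -> ae_in Om (fun x => g x = g' x).
Proof.
move=> hg hg' Lg Lg'.
have : ae_in Om (fun x => g x - g' x = 0).
  apply: ae_zero; first exact: L1locB.
  move=> eta heta; have [C1e [K [cK KO e0]]] := heta.
  have Ce : C0 Om eta by move=> x _; exact: C1e.1.
  have ig h : L1loc Om h -> intg Om (fun x => h x * eta x).
    move=> Lh; apply: (L1loc_support_intg (@open_eball R N rad) cK KO).
      exact: L1loc_mul_C0 (@open_eball R N rad) Lh Ce.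
    by move=> x /e0 ->; rewrite mulr0.
  have -> : (fun x => (g x - g' x) * eta x) = (fun x => g x * eta x + -1 * (g' x * eta x)).
    by apply/funext => x; ring.
  rewrite int_inD ?int_inZ//; try exact: open_eball; try exact: ig.
    by have := hg _ heta; rewrite (hg' _ heta) => /eqP; rewrite eqr_opp => /eqP ->; ring.
  by apply: intgZ; [exact: open_eball|exact: ig].
by apply: ae_inS => x _ /eqP; rewrite subr_eq0 => /eqP.
Qed.

Lemma int_in_sum (s : seq 'I_N) (F : 'I_N -> 'rV[R]_N -> R) : (forall i, intg Om (F i)) ->
  intg Om (fun x => \sum_(i <- s) F i x) /\
  int_in Om (fun x => \sum_(i <- s) F i x) = \sum_(i <- s) int_in Om (F i).
Proof.
have oO := @open_eball R N rad.
move=> iF; elim: s => [|i s [IH1 IH2]].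
  have -> : (fun x : 'rV[R]_N => \sum_(i <- [::]) F i x) = (fun=> 0).
    by apply/funext => x; rewrite big_nil.
  split; last by rewrite big_nil /int_in /Rintegral integral0.
  exact: integrable0.
have -> : (fun x => \sum_(j <- i :: s) F j x) = (fun x => F i x + \sum_(j <- s) F j x).
  by apply/funext => x; rewrite big_cons.
by split; [exact: intgD|rewrite int_inD// IH2 big_cons].
Qed.

End weak_uniqueness.

(** The relations say that every row of M = H - s I is parallel to x, so M has rank at most one; by
    symmetry its columns are parallel to x too. Contracting with x twice gives the coefficient
    [q / S ^+ 2]. *)
Lemma symm_parallel_rank1 (R : realType) N (x : 'rV[R]_N) (H : 'M[R]_N) (s : R) : symm H ->
  0 < enorm x ->
  (forall i j k, x 0 k * H i j - x 0 j * H i k = s * ((i == j)%:R * x 0 k - (i == k)%:R * x 0 j)) ->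
  exists c, H = s%:M + c *: (x^T *m x).
Proof.
move=> sH x0 hx.
pose M i j := H i j - s * (i == j)%:R.
have Msym i j : M i j = M j i.
  by rewrite /M (eq_sym i j); congr (_ - _); rewrite -{1}sH mxE.
have Mx i j k : x 0 k * M i j = x 0 j * M i k.
  by have := hx i j k; rewrite /M => h; apply/eqP; rewrite -subr_eq0; apply/eqP; lra.
pose S := \sum_i x 0 i ^+ 2; have S0 : S != 0 by rewrite /S -enorm_sqr sqrf_eq0 gt_eqF.
pose v i := \sum_k M i k * x 0 k.
have Mv i j : M i j * S = x 0 j * v i.
  rewrite /S /v !mulr_sumr; apply: eq_bigr => k _.
  by rewrite expr2 mulrCA (mulrA (x 0 k)) [x 0 k * M i j]mulrC [M i j * _]mulrC Mx; ring.
pose q := \sum_j v j * x 0 j.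
have vS i : v i * S = x 0 i * q.
  rewrite {1}/v mulr_suml /q mulr_sumr; apply: eq_bigr => k _.
  by rewrite mulrAC Msym Mv; ring.
exists (q / S ^+ 2); apply/matrixP => i j; rewrite !mxE big_ord1 !mxE.
have -> : H i j = s * (i == j)%:R + M i j by rewrite /M; ring.
rewrite mulr_natr; congr (_ + _).
apply: (mulIf S0); apply: (mulIf S0); rewrite Mv -(mulrA (x 0 j)) vS.
by rewrite (_ : ord0 = 0 :> 'I_1)//; field.
Qed.

(** * Strong solutions: the weak Hessian of a radial function and the energy argument *)

Section strong.
Context {R : realType} {n : nat} (lam Lam rad gam : R).
Local Notation N := n.+1.
Hypotheses (lam0 : 0 < lam) (lamLam : lam <= Lam) (rad0 : 0 < rad) (gam0 : 0 <= gam).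
Local Notation m := (pucci1 lam Lam).
Local Notation Om := (@eball R N rad).
Implicit Types (F : operator R N) (u uc w f : R -> R).

Lemma is_derive_radial u (du : R) (x : 'rV[R]_N) i : 0 < enorm x ->
  is_derive (enorm x) (1 : R) u du ->
  is_derive x (delta_mx 0 i) (radial u) (du / enorm x * x 0 i).
Proof.
move=> x0 hu; have s0 : 0 < \sum_j x 0 j ^+ 2 by rewrite -enorm_sqr exprn_gt0.
have h2 := (C1_with_sqr_sum (x := x) I).2 i.
have h1 := is_derive1_sqrt s0.
have h3 := @is_derive_comp_line _ _ Num.sqrt _ x _ _ _ h1 h2.1.
have h4 := @is_derive_comp_line _ _ u (@enorm R N) x _ _ _ hu h3.
apply: is_derive_eq h4 _; rewrite -/(enorm x); field.
by rewrite gt_eqF.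
Qed.

Section hessian_structure.
Variables (u w : R -> R) (p : R) (G : 'rV[R]_N -> 'rV[R]_N) (H : 'rV[R]_N -> 'M[R]_N).
Hypotheses (p1 : 1 <= p) (C1u : C1 Om (radial u)) (dw : deriv_on rad u w)
  (W : W2loc p Om (radial u) G H).

Let oO : open Om. Proof. exact: open_eball. Qed.
Let LG i : L1loc Om (fun x => G x 0 i).
Proof. by have [_ _ /(_ i)[h _] _ _] := W; exact: Lloc_L1loc oO p1 h. Qed.
Let LH i j : L1loc Om (fun x => H x i j).
Proof. by have [_ _ _ /(_ i j)[h _] _] := W; exact: Lloc_L1loc oO p1 h. Qed.

Lemma weak_gradient_radial i : ae_in Om (fun x => G x 0 i = partial i (radial u) x).
Proof.
have [_ _ /(_ i)[_ h] _ _] := W.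
apply: (weak_partial_unique rad0 h (weak_partial_C1 i oO C1u)) => //.
exact: C0_L1loc oO (C1u.2 i).2.
Qed.

Lemma partial_radial x i : Om x -> 0 < enorm x ->
  partial i (radial u) x = w (enorm x) / enorm x * x 0 i.
Proof.
move=> xr x0; apply: is_derive_partial; apply: is_derive_radial => //.
by apply: dw; rewrite x0.
Qed.

Lemma enorm_eq0 (x : 'rV[R]_N) : ~ 0 < enorm x -> x = 0.
Proof.
move=> /negP; rewrite -leNgt => x0; apply/rowP => i; rewrite mxE; apply/eqP.
by rewrite -normr_le0 (le_trans (coord_le_enorm x i)).
Qed.

(* Differentiating [x_k D_j u = x_j D_k u] weakly in the direction [i]. *)
Lemma weak_hessian_relation i j k : ae_in Om (fun x =>
  x 0 k * H x i j - x 0 j * H x i k = (i == j)%:R * G x 0 k - (i == k)%:R * G x 0 j).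
Proof.
have [_ _ _ WH _] := W.
have Cx l : C0 Om (fun x : 'rV[R]_N => x 0 l) by move=> x _; exact: coord_continuous.
have Ccst (c : R) : C0 Om (fun _ : 'rV[R]_N => c) by move=> x _; exact: cst_continuous.
have par : ae_in Om (fun x => x 0 k * G x 0 j = x 0 j * G x 0 k).
  apply: ae_inS (ae_in_and (weak_gradient_radial j) (weak_gradient_radial k)) => x Ox [-> ->].
  have [x0|x0] := pselect (0 < enorm x); last first.
    have xl l : x 0 l = 0 by rewrite (enorm_eq0 x0) mxE.
    by move: (partial j _ _) (partial k _ _) => a b; rewrite !xl !mul0r.
  by rewrite !partial_radial//; ring.
pose T x := H x i j * x 0 k + -1 * (H x i k * x 0 j) +
  ((i == k)%:R * G x 0 j + - (i == j)%:R * G x 0 k).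
have LT : L1loc Om T.
  apply: L1locD; first by apply: L1locD; [exact: L1loc_mul_C0|apply: L1locZ; exact: L1loc_mul_C0].
  by apply: L1locD; exact: L1locZ.
have : ae_in Om (fun x => T x = 0).
  apply: (ae_zero rad0 LT) => eta heta; have [C1e [K [cK KO e0]]] := heta.
  have closedK : closed K by apply: compact_closed cK; exact: norm_hausdorff.
  have de0 x l : ~ K x -> partial l eta x = 0.
    by move=> nKx; exact: is_derive_partial (compact_support_derive0 _ closedK e0 nKx).
  have Ce : C0 Om eta by move=> x _; exact: C1e.1.
  have Cde : C0 Om (partial i eta) by move=> x _; exact: (C1e.2 i).2.
  have ig h : L1loc Om h -> (forall x, ~ K x -> h x = 0) -> intg Om h.
    by move=> Lh; exact: (L1loc_support_intg oO cK KO).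
  have hth l := C1_with_mul (@C1_with_coord R N setT l) (C1_with_of C1e).
  have Ct l : C1_compact_support Om (fun x => x 0 l * eta x).
    split; first exact: C1_withP openT (hth l).
    by exists K; split => // x /e0 ->; rewrite mulr0.
  have pt l x : partial i (fun x => x 0 l * eta x) x = x 0 l * partial i eta x + (i == l)%:R * eta x.
    by rewrite (C1_with_partial (hth l)).
  have Cpt l : C0 Om (partial i (fun x => x 0 l * eta x)).
    by move=> x _; exact: ((Ct l).1.2 i).2.
  have pt0 l x : ~ K x -> partial i (fun x => x 0 l * eta x) x = 0.
    by move=> nK; rewrite pt de0// e0// !mulr0 addr0.
  have e1 := (WH i j).2 _ (Ct k); have e2 := (WH i k).2 _ (Ct j).
  have i1 : intg Om (fun x => H x i j * (x 0 k * eta x)).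
    apply: ig => [|x /e0 ->]; last by rewrite !mulr0.
    by apply: L1loc_mul_C0 => // x _; exact: ((Ct k).1.1 x I).
  have i2 : intg Om (fun x => H x i k * (x 0 j * eta x)).
    apply: ig => [|x /e0 ->]; last by rewrite !mulr0.
    by apply: L1loc_mul_C0 => // x _; exact: ((Ct j).1.1 x I).
  have L3 : L1loc Om (fun x => G x 0 j * partial i (fun x => x 0 k * eta x) x) by exact: L1loc_mul_C0.
  have L4 : L1loc Om (fun x => G x 0 k * partial i (fun x => x 0 j * eta x) x) by exact: L1loc_mul_C0.
  have i3 : intg Om (fun x => G x 0 j * partial i (fun x => x 0 k * eta x) x).
    by apply: ig => // x /pt0 ->; rewrite mulr0.
  have i4 : intg Om (fun x => G x 0 k * partial i (fun x => x 0 j * eta x) x).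
    by apply: ig => // x /pt0 ->; rewrite mulr0.
  have L5 : L1loc Om (fun x => ((i == k)%:R * G x 0 j + - (i == j)%:R * G x 0 k) * eta x).
    by apply: L1loc_mul_C0 => //; apply: L1locD; exact: L1locZ.
  have i5 : intg Om (fun x => ((i == k)%:R * G x 0 j + - (i == j)%:R * G x 0 k) * eta x).
    by apply: ig => // x /e0 ->; rewrite mulr0.
  have -> : (fun x => T x * eta x) = (fun x => (H x i j * (x 0 k * eta x) +
      -1 * (H x i k * (x 0 j * eta x))) + ((i == k)%:R * G x 0 j + - (i == j)%:R * G x 0 k) * eta x).
    by apply/funext => x; rewrite /T; ring.
  have iZ2 := intgZ (-1) oO i2; have iZ4 := intgZ (-1) oO i4.
  rewrite int_inD//; last exact: intgD.
  rewrite int_inD// int_inZ//.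
  (* By the product rule the right side has in addition the terms (x_k G_j - x_j G_k) times the
     derivative of [eta], which vanish almost everywhere by [par]. *)
  have e3 : int_in Om (fun x => ((i == k)%:R * G x 0 j + - (i == j)%:R * G x 0 k) * eta x) =
      int_in Om (fun x => G x 0 j * partial i (fun x => x 0 k * eta x) x +
        -1 * (G x 0 k * partial i (fun x => x 0 j * eta x) x)).
    apply: eq_int_in_ae => //; first by apply: L1locD => //; exact: L1locZ.
    rewrite /ae_in in par; apply: filterS par => t h Ot; have {h} := h Ot.
    by rewrite !pt => h; ring: h.
  rewrite e3 int_inD// int_inZ// e1 e2; ring.
apply: ae_inS => x _; rewrite /T => h; lra.
Qed.

(** The tangential eigenvalue is identified as w / r because it involves first derivatives only. The
    coefficient [c], hence the radial eigenvalue, stays unspecified at each point. *)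
Lemma weak_hessian_radial : ae_in Om (fun x => 0 < enorm x ->
  G x = (w (enorm x) / enorm x) *: x /\
  exists c, H x = (w (enorm x) / enorm x)%:M + c *: (x^T *m x)).
Proof.
have h1 := ae_in_all (fun i => weak_gradient_radial i).
have h2 : ae_in Om (fun x => forall i j k,
    x 0 k * H x i j - x 0 j * H x i k = (i == j)%:R * G x 0 k - (i == k)%:R * G x 0 j).
  apply: ae_in_all => i; apply: ae_in_all => j; apply: ae_in_all => k.
  exact: weak_hessian_relation.
apply: ae_inS (ae_in_and h1 h2) => x Ox [{}h1 {}h2] x0.
have Gx : G x = (w (enorm x) / enorm x) *: x.
  by apply/rowP => i; rewrite h1 partial_radial// mxE.
split => //; have [_ _ _ _ sH] := W.
apply: symm_parallel_rank1 => // i j k; rewrite h2 Gx !mxE; ring.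
Qed.

End hessian_structure.

Lemma trace_scalar_rank1 (s c : R) (x : 'rV[R]_N) :
  \sum_i (s%:M + c *: (x^T *m x)) i i = s *+ N + c * enorm x ^+ 2.
Proof.
rewrite (eq_bigr (fun i => s + c * x 0 i ^+ 2)).
  by rewrite big_split /= sumr_const card_ord -mulr_sumr enorm_sqr.
move=> i _; rewrite !mxE eqxx mulr1n big_ord1 !mxE expr2 //.
Qed.

(* Energy argument: on the set where [u] lies below the lifted test function
   [theta + qtest], the square of the positive part of the difference is an admissible
   test function for the weak Hessians, and its gradient pairs nonnegatively with the
   gradient of the difference. *)
Lemma strong_super_no_touch (p : R) F u uc w f : 1 <= p -> SC_lower lam Lam rad gam F ->
  continuous uc -> (forall r : R, 0 < r < rad -> u r = uc r) ->
  continuous w -> deriv_on rad u w ->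
  (forall r : R, 0 < r < rad -> {for r, continuous f}) ->
  C1 Om (radial u) -> strong_solution p Om F (fun x => - f (enorm x)) (radial u) ->
  no_touch lam Lam n%:R rad gam u w f.
Proof.
move=> p1 hF cu uuc cw dw cf C1u [G [H [W FH]]] r0 C r0R pos.
have [d [eps [kap [d0 e0 kap0 [dr dR] Hpre]]]] := touch_prelude lam0 lamLam cw (cf _ r0R) r0R pos.
exists d => // B x c y rx yr tc wc; have [/andP[xc cy] tmin tx ty] := tc.
have cd : r0 - d < c < r0 + d by rewrite (lt_trans rx) ?(lt_trans cy).
have x0 : 0 < x by apply: le_lt_trans rx; rewrite subr_ge0 ltW.
have yR : y < rad by apply: (lt_trans yr); rewrite -ltrBrDl.
have oO : open Om by exact: open_eball.
pose phi := @qtest R N B C.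
pose z r := uc r - quartic B C r.
have zE r : x <= r <= y -> u r - quartic B C r = z r.
  by move=> /andP[xr ry']; rewrite /z uuc// (lt_le_trans x0)//= (le_lt_trans ry').
have [zx zc zy] : [/\ u x - quartic B C x = z x, u c - quartic B C c = z c &
    u y - quartic B C y = z y].
  have xy : x <= y by apply/ltW/(lt_trans xc).
  by split; apply: zE; rewrite ?lexx ?xy ?(ltW xc) ?(ltW cy).
rewrite zc zx in tx; rewrite zc zy in ty.
have cz : continuous z.
  move=> r; apply: cvgB; first exact: cu.
  by apply/differentiable_continuous/derivable1_diffP; have [] := is_derive_quartic B C r.
(* A level strictly between [z c] and both endpoint values: the sublevel set contains the contact
   sphere and is compact inside the annulus. *)
have [th [zth thx thy]] : exists th, [/\ z c < th, th < z x & th < z y].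
  exists ((z c + Num.min (z x) (z y)) / 2).
  have mzx : Num.min (z x) (z y) <= z x by rewrite ge_min lexx.
  have mzy : Num.min (z x) (z y) <= z y by rewrite ge_min lexx orbT.
  have mc : z c < Num.min (z x) (z y) by rewrite lt_min tx ty.
  clear -mzx mzy mc lam0 lamLam rad0 gam0 n; split; lra.
pose U := [set t : 'rV[R]_N | x < enorm t < y].
have oU : open U by exact: open_annulus.
have UO : U `<=` Om by move=> t /andP[_ h]; exact: lt_trans yR.
pose psi t := th + -1 * (radial u t + -1 * phi t).
have psiE t : x <= enorm t <= y -> psi t = th - z (enorm t).
  by move=> /zE <-; rewrite /psi /phi /qtest /radial; ring.
have Cphi : C1_with Om phi (fun i => partial i phi).
  by move=> t _; exact: (C1_with_of (C1_qtest B C)).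
have Cpsi := C1_with_add (@C1_with_cst R N Om th) (C1_with_mul (@C1_with_cst R N Om (-1))
  (C1_with_add (C1_with_of C1u) (C1_with_mul (@C1_with_cst R N Om (-1)) Cphi))).
have Csq := C1_with_sub UO (C1_with_comp (@is_derive_pos_sqr R) (@continuous_pos_sqr_deriv R) Cpsi).
(* Cutting off at the annulus keeps the function C^1, since inside the annulus [psi] is negative off
   the compact set [K]. *)
pose eta t := if x < enorm t < y then Num.max (psi t) 0 ^+ 2 else 0.
have etaU t : U t -> eta t = Num.max (psi t) 0 ^+ 2 by rewrite /eta => ->.
have Ceta := eq_open_C1_with oU etaU Csq.
pose K := [set t : 'rV[R]_N | x <= enorm t <= y] `&` [set t | z (enorm t) <= th].
have closedK : closed K.
  apply: closedI; first exact: closed_enorm_itv.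
  apply: (@closed_comp _ _ (z \o @enorm R N) [set r | r <= th]); last exact: closed_le.
  by move=> t _; apply: continuous_comp; [exact: continuous_enorm|exact: cz].
have cK : compact K by apply: (@enorm_le_compact _ _ _ y) => // t [/andP[]].
have KU : K `<=` U.
  move=> t [/andP[xt ty'] zt]; rewrite /U /= !lt_neqAle xt ty' !andbT.
  apply/andP; split; apply/eqP => e.
    by move: zt; rewrite /= -e leNgt thx.
  by move: zt; rewrite /= e leNgt thy.
have eta0 t : ~ K t -> eta t = 0.
  rewrite /eta; case: ifP => // /andP[xt ty'] nK; rewrite max_r ?expr0n//.
  rewrite psiE ?(ltW xt) ?(ltW ty')// subr_le0 leNgt; apply/negP => zt; apply: nK.
  by split; [rewrite /= !ltW|exact: ltW].
have KO : K `<=` Om by move=> t /KU /UO.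
have C1eta : C1 setT eta by apply: (C1_extend closedK KU _ eta0); exact: C1_withP oU Ceta.
have Heta : C1_compact_support Om eta by split => //; exists K.
have eta_ge0 t : 0 <= eta t by rewrite /eta; case: ifP => // _; exact: sqr_ge0.
have deta0 i t : ~ K t -> partial i eta t = 0.
  by move=> nK; exact: is_derive_partial (compact_support_derive0 _ closedK eta0 nK).
have Cde i : C0 Om (partial i eta) by move=> t _; exact: (C1eta.2 i).2.
have CeO : C0 Om eta by move=> t _; exact: C1eta.1.
have ig h : L1loc Om h -> (forall t, ~ K t -> h t = 0) -> intg Om h.
  by move=> Lh; exact: (L1loc_support_intg oO cK KO).
have [_ _ WG WH _] := W.
have LG i : L1loc Om (fun t => G t 0 i) by exact: Lloc_L1loc oO p1 (WG i).1.
have LH i : L1loc Om (fun t => H t i i) by exact: Lloc_L1loc oO p1 (WH i i).1.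
have C1dphi i : C1 Om (partial i phi) by exact: C1_sub (C1_partial_qtest B C i).
have Lphi i : L1loc Om (partial i phi) by exact: C0_L1loc oO (C1dphi i).1.
have Lphi2 i : L1loc Om (partial i (partial i phi)) by exact: C0_L1loc oO ((C1dphi i).2 i).2.
pose A i t := (partial i phi t + -1 * G t 0 i) * partial i eta t.
pose D i t := (H t i i + -1 * partial i (partial i phi) t) * eta t.
have LA i : L1loc Om (A i).
  by apply: L1loc_mul_C0 (Cde i) => //; apply: L1locD => //; exact: L1locZ.
have LD i : L1loc Om (D i).
  by apply: L1loc_mul_C0 CeO => //; apply: L1locD => //; exact: L1locZ.
have iA i : intg Om (A i) by apply: ig => // t /deta0; rewrite /A => ->; rewrite mulr0.
have iD i : intg Om (D i) by apply: ig => // t /eta0; rewrite /D => ->; rewrite mulr0.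
(* Two integrations by parts: the weak Hessian pairs with [eta] by definition, that of [phi] because
   it is classical. *)
have AD i : int_in Om (A i) = int_in Om (D i).
  have i1 : intg Om (fun t => partial i phi t * partial i eta t).
    by apply: ig => [|t /deta0 ->]; [exact: L1loc_mul_C0|rewrite mulr0].
  have i2 : intg Om (fun t => G t 0 i * partial i eta t).
    by apply: ig => [|t /deta0 ->]; [exact: L1loc_mul_C0|rewrite mulr0].
  have i3 : intg Om (fun t => H t i i * eta t).
    by apply: ig => [|t /eta0 ->]; [exact: L1loc_mul_C0|rewrite mulr0].
  have i4 : intg Om (fun t => partial i (partial i phi) t * eta t).
    by apply: ig => [|t /eta0 ->]; [exact: L1loc_mul_C0|rewrite mulr0].
  have -> : A i = fun t => partial i phi t * partial i eta t + -1 * (G t 0 i * partial i eta t).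
    by apply/funext => t; rewrite /A; ring.
  have -> : D i = fun t => H t i i * eta t + -1 * (partial i (partial i phi) t * eta t).
    by apply/funext => t; rewrite /D; ring.
  have iZ2 := intgZ (-1) oO i2; have iZ4 := intgZ (-1) oO i4.
  rewrite !int_inD// !int_inZ// (weak_partial_C1 i oO (C1dphi i) Heta) ((WH i i).2 _ Heta).
  ring.
have [isA SA] := int_in_sum (index_enum 'I_N) iA.
have [isD SD] := int_in_sum (index_enum 'I_N) iD.
have SAD : int_in Om (fun t => \sum_i A i t) = int_in Om (fun t => \sum_i D i t).
  by rewrite SA SD; apply: eq_bigr => i _; exact: AD.
have i0 : intg Om (fun=> 0 : R) by exact: integrable0.
have I0 : int_in Om (fun _ : 'rV[R]_N => 0 : R) = 0 by rewrite /int_in /Rintegral integral0.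
(* The gradient of [psi] is that of [phi] minus that of [u], so the summed integrand is
   [2 * Num.max psi 0] times a sum of squares. *)
have A0 : 0 <= int_in Om (fun t => \sum_i A i t).
  have := @le_int_in_ae R N Om _ _ oO i0 isA; rewrite I0; apply.
  have := ae_in_all (weak_gradient_radial p1 C1u W); rewrite /ae_in; apply: filterS => t h Ot.
  apply: sumr_ge0 => i _; rewrite /A h//.
  have [Kt|nKt] := pselect (K (vec t)); last by rewrite deta0// mulr0.
  rewrite (C1_with_partial Ceta i (KU _ Kt)).
  have -> : (partial i phi (vec t) + -1 * partial i (radial u) (vec t)) *
    (2 * Num.max (psi (vec t)) 0 * (0 + (-1 * (partial i (radial u) (vec t) +
      (-1 * partial i phi (vec t) + 0 * phi (vec t))) + 0 * (radial u (vec t) + -1 * phi (vec t))))) =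
    2 * Num.max (psi (vec t)) 0 * (partial i phi (vec t) - partial i (radial u) (vec t)) ^+ 2 by ring.
  by rewrite mulr_ge0 ?sqr_ge0// mulr_ge0// le_max lexx orbT.
have ieta : intg Om eta by apply: ig => //; exact: C0_L1loc oO CeO.
have ik : intg Om (fun t => - kap * eta t) by exact: intgZ.
(* On [K] the equation and the second inequality of [touch_prelude] confine the radial eigenvalue
   [s + e * r ^+ 2] by monotonicity of [m]; adding the tangential eigenvalues, the trace of [H] is
   below the Laplacian of [phi] by more than [kap]. *)
have Dk : int_in Om (fun t => \sum_i D i t) <= int_in Om (fun t => - kap * eta t).
  apply: le_int_in_ae => //.
  have := ae_in_and FH (weak_hessian_radial p1 C1u dw W); rewrite /ae_in; apply: filterS => t h Ot.
  have [{}FHt {}h] := h Ot.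
  have [Kt|nKt] := pselect (K (vec t)); last first.
    by rewrite eta0// mulr0; apply: sumr_le0 => i _; rewrite /D eta0// mulr0.
  have /andP[xt ty'] := KU _ Kt.
  have t0 : 0 < enorm (vec t) by exact: lt_trans xt.
  have [Gt [e Ht]] := h t0.
  rewrite /D -mulr_suml ler_wpM2r//.
  have td : r0 - d < enorm (vec t) < r0 + d by rewrite (lt_trans rx)// (lt_trans ty').
  have [_] := Hpre B c _ cd wc td.
  have := SC_lower_rank1 lamLam (w (enorm (vec t)) / enorm (vec t)) e hF Ot.
  rewrite -Gt -Ht FHt.
  rewrite big_split /= -mulr_sumr Ht trace_scalar_rank1.
  have -> : \sum_i partial i (partial i phi) (vec t) = (2 * (B + C * enorm (vec t) ^+ 2)) *+ N +
      4 * C * enorm (vec t) ^+ 2.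
    rewrite -trace_scalar_rank1 -hess_qtest; apply: eq_bigr => i _; by rewrite mxE.
  set r := enorm (vec t) in t0 *; set s := w r / r; set S := 2 * (B + C * r ^+ 2).
  have -> : `|s| * r = `|w r| by rewrite /s normrM normfV (gtr0_norm t0) divfK// gt_eqF.
  move=> h1 h2; have : m (s + e * r ^+ 2) < m (S + 4 * C * r ^+ 2 + n%:R * (S - s) - kap).
    by move: h1 h2; move: (m _) (n%:R * m _) (m _) (_ * `|w r|) => a1 a2 a3 a4; clear -n lam0 lamLam rad0 gam0; lra.
  move=> /(pucci1_inj_lt lam0 lamLam).
  rewrite -[s *+ N]mulr_natl -[S *+ N]mulr_natl (_ : N%:R = n%:R + 1 :> R); last by rewrite natr1.
  by move: (n%:R) => nn; clearbody s S r; clear -lam0 lamLam rad0 gam0; lra.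
have eta_pos : 0 < int_in Om eta.
  rewrite int_inT; last first.
    by move=> t nO; apply: eta0 => /KO.
  apply: (int_in_gt0 (x0 := @axis R n c) cK) => //; first by move=> t; exact: C1eta.1.
  have c0 : 0 <= c by apply/ltW/(lt_trans x0).
  rewrite etaU; last by rewrite /U /= enorm_axis// xc.
  by rewrite exprn_gt0// lt_max psiE enorm_axis// ?(ltW xc) ?(ltW cy)// subr_gt0 zth.
have : 0 < kap * int_in Om eta by rewrite mulr_gt0.
have : 0 <= - kap * int_in Om eta by rewrite -int_inZ//; apply: (le_trans A0); rewrite SAD.
by rewrite mulNr oppr_ge0 leNgt => /negP.
Qed.

End strong.

(** * Negation: subsolutions as supersolutions *)

Section negation.
Context {R : realType} {N : nat}.
Implicit Types (Om : set 'rV[R]_N) (f g phi : 'rV[R]_N -> R) (F : operator R N).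

(** The operator for which [- w] solves the equation with right-hand side [- h]. *)
Definition opp_operator F : operator R N := fun x xi X => - F x (- xi) (- X).

Lemma C0N Om f : C0 Om f -> C0 Om (fun x => - f x).
Proof. by move=> h x Ox; exact: (cvgN (h x Ox)). Qed.

Lemma LlocN p Om f : Lloc p Om f -> Lloc p Om (fun x => - f x).
Proof.
move=> [mf fK]; split; first exact: measurableT_comp.
by move=> K cK KO; under eq_integral do rewrite normrN; exact: fK.
Qed.

Lemma weak_partialN Om i f g : open Om -> L1loc Om f -> L1loc Om g -> weak_partial Om i f g ->
  weak_partial Om i (fun x => - f x) (fun x => - g x).
Proof.
move=> oO Lf Lg h eta heta; have [C1e [K [cK KO e0]]] := heta.
have closedK : closed K by apply: compact_closed cK; exact: norm_hausdorff.
have ig k th : L1loc Om k -> C0 Om th -> (forall x, ~ K x -> th x = 0) ->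
    intg Om (fun x => k x * th x).
  move=> Lk Ct t0; apply: (L1loc_support_intg oO cK KO); first exact: L1loc_mul_C0.
  by move=> x /t0 ->; rewrite mulr0.
have de0 x : ~ K x -> partial i eta x = 0.
  by move=> nKx; exact: is_derive_partial (compact_support_derive0 _ closedK e0 nKx).
have i1 := ig _ _ Lf (fun x _ => (C1e.2 i).2 x I) de0.
have i2 := ig _ _ Lg (fun x _ => C1e.1 x I) e0.
have -> : (fun x => - f x * partial i eta x) = (fun x => -1 * (f x * partial i eta x)).
  by apply/funext => x; ring.
have -> : (fun x => - g x * eta x) = (fun x => -1 * (g x * eta x)).
  by apply/funext => x; ring.
by rewrite !int_inZ// (h _ heta); ring.
Qed.

Lemma W2locN (p : R) Om phi G H : open Om -> 1 <= p -> W2loc p Om phi G H ->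
  W2loc p Om (fun x => - phi x) (fun x => - G x) (fun x => - H x).
Proof.
move=> oO p1 [Cp Lp WG WH sH]; split.
- exact: C0N.
- exact: LlocN.
- move=> i; have -> : (fun x => (- G x) 0 i) = (fun x => - G x 0 i).
    by apply/funext => x; rewrite mxE.
  split; first exact: LlocN (WG i).1.
  apply: weak_partialN (WG i).2 => //; first exact: C0_L1loc.
  exact: Lloc_L1loc oO p1 (WG i).1.
- move=> i j; have -> : (fun x => (- G x) 0 j) = (fun x => - G x 0 j).
    by apply/funext => x; rewrite mxE.
  have -> : (fun x => (- H x) i j) = (fun x => - H x i j) by apply/funext => x; rewrite mxE.
  split; first exact: LlocN (WH i j).1.
  apply: weak_partialN (WH i j).2 => //; first exact: Lloc_L1loc oO p1 (WG j).1.
  exact: Lloc_L1loc oO p1 (WH i j).1.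
- by move=> x; rewrite /symm linearN /= sH.
Qed.

Lemma local_maxN f x : local_min f x -> local_max (fun y => - f y) x.
Proof. by rewrite /local_min /local_max; apply: filterS => y; rewrite lerN2. Qed.

Lemma Lm_subsolution_opp (p : R) Om F h w : open Om -> 1 <= p -> Lm_subsolution p Om F h w ->
  Lm_supersolution p Om (opp_operator F) (fun x => - h x) (fun x => - w x).
Proof.
move=> oO p1 [Cw sub]; split; first exact: C0N.
move=> phi G H eps O W e0 oO' OO ae x Ox lmin.
apply: (sub _ _ _ eps O (W2locN oO p1 W) e0 oO' OO _ x Ox).
  by apply: ae_inS ae => y _; rewrite /opp_operator; lra.
have := local_maxN lmin; congr local_max; apply/funext => y; ring.
Qed.

Lemma C1N_with Om phi : C1 Om phi -> C1_with Om (fun x => - phi x) (fun i x => - partial i phi x).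
Proof.
move=> C1p; have := C1_with_mul (@C1_with_cst R N Om (-1)) (C1_with_of C1p).
congr C1_with; first by apply/funext => x; ring.
by apply/funext => i; apply/funext => x; ring.
Qed.

Lemma C2N Om phi : open Om -> C2 Om phi -> C2 Om (fun x => - phi x).
Proof.
move=> oO [C1p C2p]; have h := C1N_with C1p; split; first exact: C1_withP oO h.
move=> i; apply: (C1_withP oO (eq_open_C1_with oO _ (C1N_with (C2p i)))).
by move=> x Ox; rewrite (C1_with_partial h).
Qed.

Lemma grad_opp Om phi x : C1 Om phi -> Om x -> grad (fun x => - phi x) x = - grad phi x.
Proof. by move=> C1p Ox; apply/rowP => i; rewrite !mxE (C1_with_partial (C1N_with C1p)). Qed.

Lemma hess_opp Om phi x : open Om -> C2 Om phi -> Om x ->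
  hess (fun x => - phi x) x = - hess phi x.
Proof.
move=> oO [C1p C2p] Ox; have h := C1N_with C1p; apply/matrixP => i j; rewrite !mxE.
apply: (C1_with_partial (eq_open_C1_with oO _ (C1N_with (C2p j)))) => // y Oy.
by rewrite (C1_with_partial h).
Qed.

Lemma C_subsolution_opp Om F h w : open Om -> C_subsolution Om F h w ->
  C_supersolution Om (opp_operator F) (fun x => - h x) (fun x => - w x).
Proof.
move=> oO [Cw sub]; split; first exact: C0N.
move=> phi x C2phi Ox lmin; rewrite /opp_operator lerN2.
rewrite -(grad_opp C2phi.1 Ox) -(hess_opp oO C2phi Ox).
apply: (sub _ x (C2N oO C2phi) Ox).
have := local_maxN lmin; congr local_max; apply/funext => y; ring.
Qed.

Lemma strong_solution_opp (p : R) Om F h w : open Om -> 1 <= p -> strong_solution p Om F h w ->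
  strong_solution p Om (opp_operator F) (fun x => - h x) (fun x => - w x).
Proof.
move=> oO p1 [G [H [W ae]]]; exists (fun x => - G x), (fun x => - H x).
split; first exact: W2locN.
by apply: ae_inS ae => x _; rewrite /opp_operator !opprK => ->.
Qed.

End negation.

(** * From (SC) and the three notions of solution to absence of contact *)

Section solution_touching.
Context {R : realType} {n : nat} (lam Lam rad : R).
Local Notation N := n.+1.
Hypotheses (lam0 : 0 < lam) (lamLam : lam <= Lam) (rad0 : 0 < rad).
Local Notation Om := (@eball R N rad).
Implicit Types (F : operator R N) (u uc w f : R -> R).

Lemma symm0 : symm (0 : 'M[R]_N). Proof. by rewrite /symm trmx0. Qed.

(** For the reflected operator, the zero jet is put in first position and the reflected jet in
    second: the lower bound of (SC) on F(x, 0, 0) - F(x, - xi, - X) is the required one. *)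
Lemma SC_lower_of F : SC lam Lam Om F -> exists2 gam, 0 <= gam &
  SC_lower lam Lam rad gam F /\ SC_lower lam Lam rad gam (opp_operator F).
Proof.
move=> [F0 [gam g0 h]]; exists gam => //; split=> x xi X Ox sX.
  by have := h x xi 0 X 0 Ox sX symm0; rewrite !subr0 F0// subr0 => /andP[].
have sNX : symm (- X) by rewrite /symm linearN /= sX.
have := h x 0 (- xi) 0 (- X) Ox symm0 sNX; rewrite !sub0r !opprK F0//.
by rewrite sub0r => /andP[].
Qed.

(* The profile of a radial function is only constrained on [[0, rad]]; [uc] is a
   continuous function on the whole line agreeing with it there. *)
Lemma solution_no_touch (p gam : R) F u uc w f : 1 <= p -> 0 <= gam ->
  SC_lower lam Lam rad gam F -> SC_lower lam Lam rad gam (opp_operator F) ->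
  continuous uc -> (forall r : R, 0 < r < rad -> u r = uc r) ->
  continuous w -> deriv_on rad u w ->
  (forall r : R, 0 < r < rad -> {for r, continuous f}) ->
  C1 Om (radial u) -> solution p Om F (fun x => - f (enorm x)) (radial u) ->
  no_touch lam Lam n%:R rad gam u w f /\
  no_touch lam Lam n%:R rad gam (fun r => - u r) (fun r => - w r) (fun r => - f r).
Proof.
move=> p1 g0 hF hFo cuc uuc cw du cf C1u [sLm sC sS].
have p0 : 0 <= p by apply: le_trans p1.
have oO : open Om by exact: open_eball.
have cfN r : 0 < r < rad -> {for r, continuous (fun r => - f r)}.
  by move=> rr; exact: (cvgN (cf r rr)).
have cwN : continuous (fun r => - w r) by move=> r; exact: (cvgN (cw r)).
have cucN : continuous (fun r => - uc r) by move=> r; exact: (cvgN (cuc r)).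
have uucN r : 0 < r < rad -> - u r = - uc r by move=> /uuc ->.
have duN : deriv_on rad (fun r => - u r) (fun r => - w r).
  by move=> r rr; have ? := du r rr; apply: is_deriveN.
have C1uN : C1 Om (radial (fun r => - u r)) by exact: C1_withP oO (C1N_with C1u).
(* The kind of solution is decided for [F] alone; negation is applied within each case, so neither
   continuity nor convexity has to be transferred to [opp_operator F]. *)
have [cd|ncd] := pselect (continuous_data Om F (fun x => - f (enorm x))); last first.
  have [_ sub sup] := sLm ncd; split; first exact: (Lm_super_no_touch lam0 lamLam p0 hF cw cf sup).
  apply: (Lm_super_no_touch lam0 lamLam p0 hFo cwN cfN).
  exact: (Lm_subsolution_opp oO p1 sub).
have [cc|ncc] := pselect (convex_hessian Om F \/ concave_hessian Om F).
  have s := sS cd cc.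
  split; first exact: (strong_super_no_touch lam0 lamLam rad0 p1 hF cuc uuc cw du cf C1u s).
  apply: (strong_super_no_touch lam0 lamLam rad0 p1 hFo cucN uucN cwN duN cfN C1uN).
  exact: (strong_solution_opp oO p1 s).
have [sub sup] := sC cd ncc; split; first exact: (C_super_no_touch lam0 lamLam hF cw cf sup).
apply: (C_super_no_touch lam0 lamLam hFo cwN cfN).
exact: (C_subsolution_opp oO sub).
Qed.

End solution_touching.

(** * Profiles of radial C^1 functions and the conclusion *)

Section profiles.
Context {R : realType} {n : nat} (lam Lam rad : R).
Local Notation N := n.+1.
Hypotheses (lam0 : 0 < lam) (lamLam : lam <= Lam) (rad0 : 0 < rad).
Local Notation Om := (@eball R N rad).
Local Notation ax := (@axis R n).
Implicit Types (u uc w f : R -> R) (g : 'rV[R]_N -> R).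

(** The retraction of the line onto [[0, rad]]; composed with it, functions continuous on the closed
    ball give profiles continuous on the whole line. *)
Definition clamp (r : R) : R := Num.max 0 (Num.min r rad).

Lemma clamp_itv r : 0 <= clamp r <= rad.
Proof. by rewrite /clamp le_max lexx /= ge_max (ltW rad0) ge_min lexx orbT. Qed.

Lemma clamp_id r : 0 <= r <= rad -> clamp r = r.
Proof. by move=> /andP[r0 rR]; rewrite /clamp min_l// max_r. Qed.

Lemma continuous_clamp : continuous clamp.
Proof.
move=> r; suff : {for r, continuous (fun s : R => Num.max 0 (Num.min s rad))} by [].
apply: continuous_max; first exact: cst_continuous.
by apply: continuous_min; [exact: cvg_id|exact: cst_continuous].
Qed.

Lemma continuous_axis : continuous (@axis R n).
Proof. exact: scalel_continuous. Qed.

Lemma axis_eball r : 0 <= r < rad -> Om (ax r).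
Proof. by move=> /andP[r0 rR]; rewrite /eball /= enorm_axis. Qed.

Lemma axis_closure r : 0 <= r <= rad -> closure Om (ax r).
Proof.
move=> /andP[r0]; rewrite le_eqVlt => /predU1P[->|rR]; last first.
  by apply: subset_closure; apply: axis_eball; rewrite r0.
move=> B nB.
have h1 : \forall c \near rad^'-, B (ax c).
  exact: (cvg_at_left_filter (@continuous_axis rad) nB).
have h2 : \forall c \near rad^'-, B (ax c) /\ 0 < c.
  by apply: filterI h1 _; exact: nbhs_left_gt.
have [c [[Bc c0] cR]] : exists c, (B (ax c) /\ 0 < c) /\ c < rad.
  by apply: (@filter_ex _ (rad^'-)); apply: filterI h2 _; exact: nbhs_left_lt.
by exists (ax c); split => //; apply: axis_eball; rewrite ltW.
Qed.

Lemma continuous_clamp_axis g : {within closure Om, continuous g} ->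
  continuous (fun r => g (ax (clamp r))).
Proof.
move=> /subspace_continuousP cg r.
have Acl s : closure Om (ax (clamp s)) by apply: axis_closure; exact: clamp_itv.
have ca : (fun s => ax (clamp s)) @ r --> ax (clamp r).
  by apply: continuous_comp; [exact: continuous_clamp|exact: continuous_axis].
apply: (cvg_comp (fun s => ax (clamp s)) g _ (cg _ (Acl r))).
move=> W nW; have h : \forall s \near r, closure Om (ax (clamp s)) -> W (ax (clamp s)) := ca _ nW.
suff : \forall s \near r, W (ax (clamp s)) by [].
by apply: filterS h => s /(_ (Acl s)).
Qed.

Lemma within_closure_C0 (U : set 'rV[R]_N) g : open U -> {within closure U, continuous g} -> C0 U g.
Proof.
move=> oU /subspace_continuousP cg x Ux W nW.
have nU : nbhs x (closure U).
  by apply: filterS (open_nbhs_nbhs (conj oU Ux)); exact: subset_closure.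
by have := cg x (subset_closure Ux) W nW; apply: filterS2 nU => y cy; exact.
Qed.

Lemma C1_closure_C1 (U : set 'rV[R]_N) g : open U -> C1_closure U g -> C1 U g.
Proof.
move=> oU [cg dg]; split; first exact: within_closure_C0.
move=> i; have [dgi [gi [cgi gE]]] := dg i; split => // x Ux.
have nE : \forall y \near x, gi y = partial i g y.
  by apply: filterS (open_nbhs_nbhs (conj oU Ux)) => y; exact: gE.
rewrite /prop_for /continuous_at -gE//.
exact: cvg_trans (near_eq_cvg nE) (within_closure_C0 oU cgi Ux).
Qed.

Lemma is_derive_axis u (r d : R) : is_derive (ax r) (delta_mx 0 0) (radial u) d ->
  is_derive r 1 (fun h => u `|h|) d.
Proof.
rewrite /axis -[X in is_derive X]addr0 => /is_derive_line.
congr is_derive; apply/funext => h; rewrite addr0 /radial enormZ.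
by have := @enorm_axis R n 1 ler01; rewrite /axis scale1r => ->; rewrite mulr1.
Qed.

(** By the mean value theorem the quotients at [rad] are values of [w] at points tending to [rad],
    so continuity of [w] identifies the one-sided derivative. *)
Lemma left_deriv_deriv_on u uc w l : continuous uc -> continuous w -> deriv_on rad uc w ->
  (forall r : R, 0 <= r <= rad -> u r = uc r) -> left_deriv u rad l -> w rad = l.
Proof.
move=> cu cw du uE hl; apply: (@cvg_unique _ (@Rhausdorff R) _ _ _ _ _ hl).
apply/cvgrPdist_lt => e e0.
have /cvgrPdist_lt/(_ e e0) [d /= d0 Hd] := cw rad.
have lt0 : Num.max 0 (rad - d) < rad by rewrite gt_max rad0 /= gtrBl.
near=> r.
have : Num.max 0 (rad - d) < r by near: r; exact: nbhs_left_gt.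
rewrite gt_max => /andP[r0 dr].
have rR : r < rad by near: r; exact: nbhs_left_lt.
have [c /andP[rc cR] E] := deriv_on_MVT lam0 lamLam ler01 rad0 cu du (ltW r0) rR (lexx _).
have -> : (u r - u rad) / (r - rad) = w c.
  have -> : u r - u rad = w c * (r - rad) by rewrite !uE ?lexx ?ltW//; lra.
  by rewrite mulfK// subr_eq0 lt_eqF.
by apply: Hd; rewrite /ball /= ger0_norm ?subr_ge0 ?ltW//; lra.
Unshelve. all: by end_near. Qed.

(** Along the first axis the extended partial derivative in that direction is the radial derivative,
    which provides [w] up to the boundary. It vanishes at 0 because the restriction of [u] to the
    axis is even and differentiable there. *)
Lemma radial_profile u : C1_closure Om (radial u) -> exists uc w,
  [/\ continuous uc /\ (forall r : R, 0 <= r <= rad -> u r = uc r),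
      continuous w, deriv_on rad u w, deriv_on rad uc w & w 0 = 0].
Proof.
move=> [cu /(_ 0) [du [g [cg gE]]]].
have partialE r : 0 <= r < rad -> is_derive r 1 (fun h => u `|h|) (g (ax (clamp r))).
  move=> /[dup] /andP[r0 rR] rr; rewrite clamp_id ?r0 ?ltW// gE; last exact: axis_eball.
  by apply: is_derive_axis; apply: derivable_partial; apply: du; exact: axis_eball.
have dw : deriv_on rad u (fun r => g (ax (clamp r))).
  move=> r /andP[r0 rR]; have := partialE r; rewrite ltW// => /(_ rR).
  apply: near_eq_is_derive; near=> h; rewrite ger0_norm// ltW//; near: h.
  exact: lt_nbhsr.
exists (fun r => u (clamp r)), (fun r => g (ax (clamp r))); split => //.
- split; last by move=> r rr; rewrite clamp_id.
  have -> : (fun r => u (clamp r)) = (fun r => radial u (ax (clamp r))).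
    by apply/funext => r; rewrite /radial enorm_axis//; have /andP[] := clamp_itv r.
  exact: continuous_clamp_axis.
- exact: continuous_clamp_axis.
- move=> r rr; apply: near_eq_is_derive (dw r rr); have /andP[r0 rR] := rr; near=> h.
  rewrite clamp_id//; apply/andP; split; apply: ltW; near: h.
    exact: lt_nbhsr.
  exact: lt_nbhsl.
- have := partialE 0; rewrite lexx rad0 => /(_ isT) d0.
  have d1 : is_derive (0 : R) 1 (fun h => u `|h|) (- g (ax (clamp 0))).
    have := @is_derive1_comp _ (fun h => u `|h|) (fun h : R => - h) 0 (g (ax (clamp 0))) (-1).
    rewrite oppr0 mulrN1 => /(_ d0 _); rewrite (_ : _ \o _ = fun h => u `|h|).
      by apply.
    by apply/funext => h; rewrite /= normrN.
  by have [_ e0] := d0; have [_ e1] := d1; move: e1; rewrite e0; lra.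
Unshelve. all: by end_near. Qed.

(** The exponent [q - 1] may be negative, so continuity at [x = 0] is not obtained factor by factor;
    it follows from the modulus |y|^q with [q > 0]. *)
Lemma continuous_signed_powR (c q r x : R) : 0 < r -> 0 < q ->
  {for (r, x), continuous (fun z : R * R => signed_powR c q z.1 z.2)}.
Proof.
move=> r0 q0.
have c1 : (fun z : R * R => z.1) @ (r, x) --> r by exact: cvg_fst.
have c2 : (fun z : R * R => z.2) @ (r, x) --> x by exact: cvg_snd.
have cp a y : 0 < y -> {for y, continuous (@powR R ^~ a)}.
  by move=> y0; apply: differentiable_continuous; apply/derivable1_diffP; apply: derivable_powR; rewrite in_itv/= y0.
have cr := @continuous_comp _ _ _ (fun z : R * R => z.1) (@powR R ^~ c) (r, x) c1 (cp c r r0).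
have cx : {for x, continuous (fun y : R => `|y| `^ (q - 1) * y)}.
  have [->|x0] := eqVneq x 0; last first.
    have nx : 0 < `|x| by rewrite normr_gt0.
    have h := @continuous_comp _ _ _ (fun y : R => `|y|) (@powR R ^~ (q - 1)) x (@norm_continuous _ _ x) (cp _ _ nx).
    exact: (cvgM h cvg_id).
  apply/cvgrPdist_lt => e e0; rewrite mulr0.
  have e1 : 0 < e `^ q^-1 by exact: powR_gt0.
  have := @nbhsx_ballx _ R (0 : R) _ e1; apply: filterS => y; rewrite /ball /= !sub0r !normrN => ye.
  have := @norm_signed_powR R 0 q 1 y q0; rewrite /signed_powR powR1 !mul1r => ->.
  have := gt0_ltr_powR q0 (normr_ge0 y) (powR_ge0 _ _) ye.
  by rewrite -powRrM mulVf ?gt_eqF// powRr1// ltW.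
have cxx := @continuous_comp _ _ _ (fun z : R * R => z.2) _ (r, x) c2 cx.
rewrite (_ : (fun z => _) = fun z : R * R => z.1 `^ c * (`|z.2| `^ (q - 1) * z.2)).
  exact: (cvgM cr cxx).
by apply/funext => z; rewrite /signed_powR mulrA.
Qed.

Lemma continuous_signed_powR_profile v vc (c q r : R) : 0 < q -> continuous vc ->
  (forall r : R, 0 <= r <= rad -> v r = vc r) -> 0 < r < rad ->
  {for r, continuous (fun r => signed_powR c q r (v r))}.
Proof.
move=> q0 cv vE rr; have /andP[r0 rR] := rr.
have nE : \forall s \near r, signed_powR c q s (vc s) = signed_powR c q s (v s).
  near=> s; rewrite vE//; apply/andP; split; apply: ltW; near: s.
    exact: lt_nbhsr.
  exact: lt_nbhsl.
rewrite /prop_for /continuous_at (vE r) ?ltW//.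
apply: cvg_trans (near_eq_cvg nE) _.
apply: (@continuous_comp _ _ _ (fun s => (s, vc s)) (fun z : R * R => signed_powR c q z.1 z.2)).
  exact: (cvg_pair cvg_id (cv r)).
exact: continuous_signed_powR.
Unshelve. all: by end_near. Qed.

Lemma no_touch_ext (k gam : R) u uc w f fc : (forall r : R, 0 < r < rad -> u r = uc r) ->
  (forall r : R, 0 < r < rad -> f r = fc r) ->
  no_touch lam Lam k rad gam u w f -> no_touch lam Lam k rad gam uc w fc.
Proof.
move=> uE fE h r C rr; rewrite -fE// => /(h r C rr)[d d0 hd].
have /andP[r0 rR] := rr.
exists (Num.min d (Num.min r (rad - r))); first by rewrite !lt_min d0 r0 subr_gt0.
move=> B x c y.
have [dd [dr dR]] : Num.min d (Num.min r (rad - r)) <= d /\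
    (Num.min d (Num.min r (rad - r)) <= r /\ Num.min d (Num.min r (rad - r)) <= rad - r).
  by rewrite !ge_min !lexx !orbT.
move: (Num.min _ _) dd dr dR => D dd dr dR rx yr [xcy h1 h2 h3]; have /andP[xc cy] := xcy.
have uE' s : x <= s <= y -> u s = uc s.
  by move=> /andP[xs sy]; apply: uE; apply/andP; split; lra.
apply: (hd B x c y); [lra|lra|].
have xy := lt_trans xc cy.
have ux : u x = uc x by rewrite uE'// lexx ltW.
have uy : u y = uc y by rewrite uE'// lexx ltW.
have uc' : u c = uc c by rewrite uE'// !ltW.
by split; rewrite ?ux ?uy ?uc'// => s sxy; rewrite uE'// h1.
Qed.

Lemma solution_supD (p : R) (F : operator R N) u uc w f fc : 1 <= p -> SC lam Lam Om F ->
  C1 Om (radial u) -> continuous uc -> (forall r : R, 0 <= r <= rad -> u r = uc r) ->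
  continuous w -> deriv_on rad u w -> deriv_on rad uc w ->
  (forall r : R, 0 < r < rad -> {for r, continuous f}) ->
  (forall r : R, 0 < r < rad -> f r = fc r) ->
  solution p Om F (fun x => - f (enorm x)) (radial u) ->
  exists2 gam, 0 <= gam & supD lam Lam n%:R rad gam w fc /\
    supD lam Lam n%:R rad gam (fun r => - w r) (fun r => - fc r).
Proof.
move=> p1 hF C1u cu uE cw du duc cf fE sol.
have [gam g0 [hFl hFo]] := SC_lower_of hF; exists gam => //.
have uE' r : 0 < r < rad -> u r = uc r by move=> /andP[r0 rR]; rewrite uE// !ltW.
have [nt1 nt2] := solution_no_touch lam0 lamLam rad0 p1 g0 hFl hFo cu uE' cw du cf C1u sol.
split.
  exact: (no_touch_supD lam0 lamLam g0 cu cw duc (no_touch_ext uE' fE nt1)).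
have cuN : continuous (fun r => - uc r) by move=> r; exact: (cvgN (cu r)).
have cwN : continuous (fun r => - w r) by move=> r; exact: (cvgN (cw r)).
have duN : deriv_on rad (fun r => - uc r) (fun r => - w r).
  by move=> r rr; have ? := duc r rr; apply: is_deriveN.
apply: (no_touch_supD lam0 lamLam g0 cuN cwN duN).
apply: no_touch_ext nt2 => r rr; first by rewrite uE'.
by rewrite fE.
Qed.

End profiles.

Theorem theorem1p7 (R : realType) (N : nat) (hN : (0 < N)%N)
    (m : R) (hm : N%:R < m)
    (lam Lam : R) (hlam : 0 < lam) (hlamLam : lam <= Lam)
    (rad : R) (hrad : 0 < rad)
    (F1 F2 : operator R N)
    (hF1 : SC lam Lam (eball rad) F1) (hF2 : SC lam Lam (eball rad) F2)
    (alpha beta p q : R) (halpha : 0 <= alpha) (hbeta : 0 <= beta)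
    (hp : 0 < p) (hq : 0 < q) (hpq : 1 <= p * q)
    (u v : R -> R)
    (hu : @C1_closure R N (eball rad) (radial u))
    (hv : @C1_closure R N (eball rad) (radial v))
    (huv : system_solution m (eball rad) F1 F2 alpha beta p q
             (radial u) (radial v))
    (huR : u rad = 0) (hvR : v rad = 0)
    (hder : left_deriv u rad 0 \/ left_deriv v rad 0) :
  forall x : 'rV[R]_N, eball rad x -> radial u x = 0 /\ radial v x = 0.
Proof.
(* Writing [N] as [n.+1] exhibits the [n] tangential eigenvalues, so [n%:R] is the coefficient [k]
   of the differential inequality. *)
case: N hN hm F1 F2 hF1 hF2 hu hv huv => [//|n] _ hm F1 F2 hF1 hF2 hu hv [s1 s2].
have m1 : 1 <= m by apply: ltW; apply: le_lt_trans hm; rewrite ler1n.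
have oO : open (@eball R n.+1 rad) by exact: open_eball.
have [uc [wu [[cu uE] cwu du duc wu0]]] := radial_profile hrad hu.
have [vc [wv [[cv vE] cwv dv dvc wv0]]] := radial_profile hrad hv.
pose f1 r := signed_powR beta q r (vc r).
pose f2 r := signed_powR alpha p r (uc r).
have cf1 r := continuous_signed_powR_profile (c := beta) (r := r) hq cv vE.
have cf2 r := continuous_signed_powR_profile (c := alpha) (r := r) hp cu uE.
have f1E r : 0 < r < rad -> signed_powR beta q r (v r) = f1 r.
  by move=> /andP[r0 rR]; rewrite vE// !ltW.
have f2E r : 0 < r < rad -> signed_powR alpha p r (u r) = f2 r.
  by move=> /andP[r0 rR]; rewrite uE// !ltW.
have [g1 g10 [sD1 sD1N]] := solution_supD hlam hlamLam hrad m1 hF1 (C1_closure_C1 oO hu) cu uE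
  cwu du duc cf1 f1E s1.
have [g2 g20 [sD2 sD2N]] := solution_supD hlam hlamLam hrad m1 hF2 (C1_closure_C1 oO hv) cv vE
  cwv dv dvc cf2 f2E s2.
have ucR : uc rad = 0 by rewrite -uE// lexx ltW.
have vcR : vc rad = 0 by rewrite -vE// lexx ltW.
have der : wu rad = 0 \/ wv rad = 0.
  by case: hder => h; [left; exact: left_deriv_deriv_on duc uE h|
                       right; exact: left_deriv_deriv_on dvc vE h].
have zero r : 0 < r <= rad -> uc r = 0 /\ vc r = 0.
  exact: (profile_system_eq0 hlam hlamLam (ler0n _ n) hrad g10 g20 cu cv cwu cwv duc dvc
    sD1 sD1N sD2 sD2N halpha hbeta hp hq hpq ucR vcR wu0 wv0 der).
(* The one-dimensional argument stops short of the centre, where the inequality is singular; the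
   value there is a limit. *)
have zero0 (h : R -> R) : continuous h -> (forall r, 0 < r <= rad -> h r = 0) -> h 0 = 0.
  move=> ch h0; apply: (@cvg_unique _ (@Rhausdorff R) (h r @[r --> 0^'+])).
    by apply: cvg_at_right_filter; exact: ch.
  apply: cvg_near_cst; near=> r; apply/h0/andP; split; near: r.
    exact: nbhs_right_gt.
  exact: nbhs_right_le.
move=> x xr; rewrite /radial uE ?vE ?enorm_ge0 ?(ltW xr)//.
have [x0|] := ltP 0 (enorm x); first by apply: zero; rewrite x0 ltW.
rewrite le_eqVlt ltNge enorm_ge0 orbF => /eqP ->.
by split; apply: zero0 => // r /zero[].
Unshelve. all: by end_near. Qed.
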